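(* Let $N\ge 3$. Consider the eigenvalue problem $$-\Delta w=\lambda\,\frac{N(N+2)}{(1+|x|^2)^2}\,w\quad\text{in }\mathbb{R}^N,\qquad w\in D^{1,2}(\mathbb{R}^N).$$ Its eigenvalues are exactly the numbers $$\lambda_n=\frac{(2n+N-2)(2n+N)}{N(N+2)},\qquad n=0,1,2,\dots$$ Each eigenvalue $\lambda_n$ has multiplicity $$m(\lambda_n)=\sum_{h=0}^n\frac{(N+2h-2)\,(N+h-3)!}{(N-2)!\,h!},$$ and the corresponding eigenfunctions are, in polar coordinates $r=|x|$, $\theta=x/|x|\in\mathbb{S}^{N-1}$, the linear combinations of the functions $$w_{n,h}(r,\theta)=\frac{r^h}{(1+r^2)^{h+\frac{N-2}{2}}}\,P_{n-h}^{\left(h+\frac{N-2}{2},\,h+\frac{N-2}{2}\right)}\!\left(\frac{1-r^2}{1+r^2}\right)Y_h(\theta),\qquad h=0,\dots,n,$$ where $Y_h$ ranges over the spherical harmonics on $\mathbb{S}^{N-1}$ associated with the eigenvalue $h(h+N-2)$ of $-\Delta_{\mathbb{S}^{N-1}}$.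
   Context: $2^*=\frac{2N}{N-2}$ and $D^{1,2}(\mathbb{R}^N)=\{u\in L^{2^*}(\mathbb{R}^N): |\nabla u|\in L^2(\mathbb{R}^N)\}$, with norm $\|\nabla u\|_{L^2}$. Equations are understood in the weak sense. An eigenvalue is a number $\lambda$ for which the problem has a solution $w\ne 0$; its multiplicity is the dimension of the space of solutions. $\Delta_{\mathbb{S}^{N-1}}$ is the Laplace–Beltrami operator of the standard sphere. The Jacobi polynomials are $$P_m^{(\beta,\gamma)}(\xi)=\sum_{s=0}^m\binom{m+\beta}{s}\binom{m+\gamma}{m-s}\left(\frac{\xi-1}{2}\right)^{m-s}\left(\frac{\xi+1}{2}\right)^s .$$ *)

(* Defs.v *)
From HB Require Import structures.
From mathcomp Require Import all_boot all_order all_algebra.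
From mathcomp Require Import all_classical all_reals all_analysis.

Set Implicit Arguments.
Unset Strict Implicit.
Unset Printing Implicit Defensive.
Import Order.TTheory GRing.Theory Num.Theory.
Import numFieldNormedType.Exports.
Local Open Scope classical_set_scope.
Local Open Scope ring_scope.

Definition measure_rV_display : measure_display.
Proof. exact: default_measure_display. Qed.

(* The product sigma-algebra, which is the Borel sigma-algebra of R^n. *)
Section measurable_rV.
Context {R : realType} (n : nat).

Let coord (i : 'I_n) (x : 'rV[R]_n) : measurableTypeR R := x 0 i.

Let rV_set0 : g_sigma_preimage coord set0.
Proof. exact: sigma_algebra0. Qed.

Let rV_setC A : g_sigma_preimage coord A -> g_sigma_preimage coord (~` A).
Proof. exact: sigma_algebraC. Qed.

Let rV_bigcup (F : (set 'rV[R]_n)^nat) : (forall i, g_sigma_preimage coord (F i)) ->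
  g_sigma_preimage coord (\bigcup_i (F i)).
Proof. exact: sigma_algebra_bigcup. Qed.

HB.instance Definition _ := @isMeasurable.Build measure_rV_display
  'rV[R]_n (g_sigma_preimage coord) rV_set0 rV_setC rV_bigcup.

Lemma measurable_coord (i : 'I_n) :
  measurable_fun [set: 'rV[R]_n] (fun x : 'rV[R]_n => x 0 i).
Proof.
move=> _ Y mY; rewrite setTI; apply: sub_sigma_algebra => /=.
rewrite -bigcup_seq/=; exists i => /=; first by rewrite mem_index_enum.
by exists Y => //; rewrite setTI.
Qed.

Lemma measurable_fun_rV d (T : measurableType d) (f : T -> 'rV[R]_n) :
  (forall i, measurable_fun setT (fun t => f t 0 i)) -> measurable_fun setT f.
Proof.
move=> mf; pose g t := f t.
have H : g_sigma_preimage coord `<=` [set A | measurable (f @^-1` A)].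
  apply: smallest_sub.
    split => /=; first by rewrite preimage_set0.
      by move=> A mA; rewrite setTD preimage_setC; exact: measurableC.
    by move=> F mF; rewrite preimage_bigcup; exact: bigcup_measurable.
  move=> A; rewrite -bigcup_seq => -[i _ [B mB <-]] /=.
  rewrite setTI -comp_preimage -[X in measurable X]setTI.
  exact: mf.
by move=> _ A mA; rewrite setTI; exact: H.
Qed.

End measurable_rV.

(* Lebesgue measure on R^n, by iterated products along R^(1 + n) = R x R^n. *)
Section lebesgue_rV_step.
Context {R : realType} (n : nat).

Definition cons_rV (p : measurableTypeR R * 'rV[R]_n) : 'rV[R]_n.+1 :=
  row_mx (\row_(i < 1) p.1) p.2.

Lemma cons_rV0 p : cons_rV p 0 0 = p.1.
Proof.
have -> : (0 : 'I_n.+1) = lshift n (0 : 'I_1) by exact/val_inj.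
exact: etrans (row_mxEl _ _ _ _) (mxE _ _ _ _).
Qed.

Lemma cons_rVS p (i : 'I_n) : cons_rV p 0 (lift 0 i) = p.2 0 i.
Proof.
have -> : lift 0 i = rshift 1 i by exact/val_inj.
exact: row_mxEr.
Qed.

Lemma measurable_cons_rV : measurable_fun setT cons_rV.
Proof.
apply: measurable_fun_rV => i; have [j ->|->] := unliftP 0 i.
- under eq_fun do rewrite cons_rVS.
  apply: (@measurableT_comp _ _ _ _ _ _ (fun x : 'rV[R]_n => x 0 j)) => //.
  exact: measurable_coord.
- by under eq_fun do rewrite cons_rV0; exact: measurable_fst.
Qed.

Variable m : {sigma_finite_measure set 'rV[R]_n -> \bar R}.

Definition cons_measure : set 'rV[R]_n.+1 -> \bar R :=
  pushforward (@lebesgue_measure R \x m)%E cons_rV.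

Let cons_measure0 : cons_measure set0 = 0%E.
Proof. by rewrite /cons_measure /pushforward preimage_set0 measure0. Qed.

Let cons_measure_ge0 A : (0 <= cons_measure A)%E.
Proof. exact: (measure_ge0 (lebesgue_measure \x m)%E). Qed.

Let cons_measure_sigma_additive : semi_sigma_additive cons_measure.
Proof.
move=> F mF tF mUF; rewrite /cons_measure /pushforward preimage_bigcup.
apply: measure_semi_sigma_additive.
- by move=> k; rewrite -[X in measurable X]setTI; exact: measurable_cons_rV.
- apply/trivIsetP => /= i j _ _ ij; rewrite -preimage_setI.
  by move/trivIsetP : tF => /(_ _ _ _ _ ij) ->//; rewrite preimage_set0.
- rewrite -preimage_bigcup -[X in measurable X]setTI.
  exact: measurable_cons_rV.
Qed.

HB.instance Definition _ := isMeasure.Build _ _ _ cons_measure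
  cons_measure0 cons_measure_ge0 cons_measure_sigma_additive.

Let cons_measure_sigma_finite : sigma_finite setT cons_measure.
Proof.
have /sigma_finiteP[F [TF ndF Foo]] := sigma_finiteT (@lebesgue_measure R).
have /sigma_finiteP[G [TG ndG Goo]] := sigma_finiteT m.
pose tail_rV (x : 'rV[R]_n.+1) : 'rV[R]_n := \row_i x 0 (lift 0 i).
have mtail : measurable_fun setT tail_rV.
  apply: measurable_fun_rV => i.
  by under eq_fun do rewrite mxE; exact: measurable_coord.
exists (fun k => [set x : 'rV[R]_n.+1 | F k (x 0 0)] `&` (tail_rV @^-1` G k)).
  apply/seteqP; split => // x _.
  have [i _ Fi] : (\bigcup_i F i) (x 0 0) by rewrite -TF.
  have [j _ Gj] : (\bigcup_i G i) (tail_rV x) by rewrite -TG.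
  exists (maxn i j) => //; split.
  - by have /subsetPset := ndF i (maxn i j) (leq_maxl i j); exact.
  - by have /subsetPset := ndG j (maxn i j) (leq_maxr i j); exact.
move=> k; have [mF Fk] := Foo k; have [mG Gk] := Goo k; split.
  by apply: measurableI; rewrite -[X in measurable X]setTI;
    [exact: measurable_coord|exact: mtail].
rewrite /cons_measure /pushforward (_ : _ @^-1` _ = F k `*` G k).
  rewrite product_measure1E// lte_mul_pinfty// ge0_fin_numE//.
apply/seteqP.
have tE p : tail_rV (cons_rV p) = p.2.
  by apply/rowP => i; rewrite mxE cons_rVS.
by split => p /=; rewrite cons_rV0 tE.
Qed.

HB.instance Definition _ :=
  Measure_isSigmaFinite.Build _ _ _ cons_measure cons_measure_sigma_finite.

End lebesgue_rV_step.

Fixpoint lebesgue_rV (R : realType) (n : nat) :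
    {sigma_finite_measure set 'rV[R]_n -> \bar R} :=
  match n with
  | 0 => @dirac _ 'rV[R]_0 0 R
  | n'.+1 => @cons_measure R n' (lebesgue_rV R n')
  end.

Lemma lebesgue_rV_box (R : realType) (n : nat) (a b : 'rV[R]_n) :
  (forall i, a 0 i <= b 0 i) ->
  lebesgue_rV R n [set x | forall i, x 0 i \in `[a 0 i, b 0 i]] =
  (\prod_i (b 0 i - a 0 i))%:E.
Proof.
elim: n a b => [|n IH] a b ab.
  rewrite big_ord0 /= diracE mem_set//= => -[]//.
pose a' : 'rV[R]_n := \row_i a 0 (lift 0 i).
pose b' : 'rV[R]_n := \row_i b 0 (lift 0 i).
have mB : measurable [set x : 'rV[R]_n | forall i, x 0 i \in `[a' 0 i, b' 0 i]].
  rewrite (_ : mkset _ = \bigcap_(i in [set: 'I_n])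
    ((fun x : 'rV[R]_n => x 0 i) @^-1` [set` `[a' 0 i, b' 0 i]])); last first.
    by apply/seteqP; split => [x /= H i _|x H i]; [exact: H|exact: (H i)].
  apply: fin_bigcap_measurable => // i _; rewrite -[X in measurable X]setTI.
  exact: measurable_coord.
rewrite /= /cons_measure /pushforward.
rewrite (_ : _ @^-1` _ = [set` `[a 0 0, b 0 0]] `*`
    [set x : 'rV[R]_n | forall i, x 0 i \in `[a' 0 i, b' 0 i]]); last first.
  apply/seteqP; split => [[t v] /= H|[t v] /= [Ht Hv] i].
    split; first by have := H 0; rewrite cons_rV0.
    by move=> i; have := H (lift 0 i); rewrite cons_rVS !mxE.
  have [j ->|->] := unliftP 0 i; last by rewrite cons_rV0.
  by have := Hv j; rewrite cons_rVS !mxE.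
rewrite product_measure1E//= IH; last by move=> i; rewrite !mxE.
rewrite lebesgue_measure_itv/= lte_fin big_ord_recl EFinM; congr (_ * _)%E.
  case: ltP => // ba; suff -> : b 0 0 = a 0 0 by rewrite subrr.
  by apply/eqP; rewrite eq_le ba ab.
by congr EFin; apply: eq_bigr => i _; rewrite !mxE.
Qed.

Section euclidean.
Context {R : realType} {N : nat}.
Implicit Types x y : 'rV[R]_N.

Definition dotp x y : R := \sum_i x 0 i * y 0 i.

(* The library norm on 'rV[R]_N is the sup norm. *)
Definition enorm x : R := Num.sqrt (dotp x x).

Definition partial (i : 'I_N) (f : 'rV[R]_N -> R) : 'rV[R]_N -> R :=
  'D_(delta_mx 0 i) f.

Definition gradient (f : 'rV[R]_N -> R) x : 'rV[R]_N := \row_i partial i f x.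

Fixpoint Ck_on (A : set 'rV[R]_N) (k : nat) (f : 'rV[R]_N -> R) : Prop :=
  (forall x, A x -> {for x, continuous f}) /\
  match k with
  | 0 => True
  | k'.+1 => forall i : 'I_N,
      (forall x, A x -> derivable f x (delta_mx 0 i)) /\ Ck_on A k' (partial i f)
  end.

(* Meant for open A. *)
Definition smooth_on (A : set 'rV[R]_N) (f : 'rV[R]_N -> R) : Prop :=
  forall k, Ck_on A k f.

Definition test_function (phi : 'rV[R]_N -> R) : Prop :=
  smooth_on setT phi /\ compact (closure [set x | phi x != 0]).

End euclidean.

Section sobolev.
Context {R : realType} {N : nat}.
Local Notation mu := (lebesgue_rV R N).

(* Only used for functions u, G in some L^p with p >= 1, so that all the
   integrals converge. *)
Definition weak_gradient (u : 'rV[R]_N -> R) (G : 'rV[R]_N -> 'rV[R]_N) : Prop :=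
  forall phi, test_function phi -> forall i : 'I_N,
    \int[mu]_x (u x * partial i phi x) = - \int[mu]_x (G x 0 i * phi x).

Definition sobolev_exponent : R := 2 * N%:R / (N%:R - 2).

Definition D12_with_gradient (u : 'rV[R]_N -> R) (G : 'rV[R]_N -> 'rV[R]_N) : Prop :=
  [/\ u \in Lfun mu sobolev_exponent%:E,
      weak_gradient u G,
      measurable_fun setT G
    & (fun x => enorm (G x)) \in Lfun mu 2%:E].

Definition weight (x : 'rV[R]_N) : R :=
  N%:R * (N%:R + 2) / (1 + enorm x ^+ 2) ^+ 2.

Definition weak_solution (lambda : R) (w : 'rV[R]_N -> R) : Prop :=
  exists2 G, D12_with_gradient w G &
    forall phi, test_function phi ->
      \int[mu]_x dotp (G x) (gradient phi x) =
      lambda * \int[mu]_x (weight x * w x * phi x).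

Definition is_eigenvalue (lambda : R) : Prop :=
  exists2 w, weak_solution lambda w & ~ (w = cst 0 %[ae mu]).

(* The dimension of a space of functions considered up to equality a.e. *)
Definition ae_dimension (V : set ('rV[R]_N -> R)) (m : nat) : Prop :=
  exists b : 'I_m -> 'rV[R]_N -> R,
    [/\ forall j, V (b j),
        forall c : 'I_m -> R,
          (fun x => \sum_j c j * b j x) = cst 0 %[ae mu] -> forall j, c j = 0
      & forall v, V v ->
          exists c : 'I_m -> R, v = (fun x => \sum_j c j * b j x) %[ae mu]].

Definition multiplicity (lambda : R) (m : nat) : Prop :=
  ae_dimension (weak_solution lambda) m.

End sobolev.

Section sphere.
Context {R : realType} {N : nat}.

(* Functions and vector fields on the unit sphere are represented by functions
   on R^N of which only the values on the sphere matter; their differential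
   calculus goes through the extension that is constant along rays. *)
Definition ray_ext (T : Type) (f : 'rV[R]_N -> T) (x : 'rV[R]_N) : T :=
  f ((enorm x)^-1 *: x).

(* At a point theta of the sphere, the derivative of ray_ext f vanishes in the
   direction theta and is the intrinsic one in the tangential directions.
   Hence the Euclidean gradient of the extension is the Riemannian gradient,
   and for a tangent field the trace of the Jacobian of the extension is the
   Riemannian divergence. *)
Definition sphere_grad (Y : 'rV[R]_N -> R) (theta : 'rV[R]_N) : 'rV[R]_N :=
  gradient (ray_ext Y) theta.

Definition sphere_div (X : 'rV[R]_N -> 'rV[R]_N) (theta : 'rV[R]_N) : R :=
  \sum_i partial i (fun x => ray_ext X x 0 i) theta.

Definition laplace_beltrami (Y : 'rV[R]_N -> R) : 'rV[R]_N -> R :=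
  sphere_div (sphere_grad Y).

Definition spherical_harmonic (h : nat) (Y : 'rV[R]_N -> R) : Prop :=
  smooth_on [set x | x != 0] (ray_ext Y) /\
  forall theta, enorm theta = 1 ->
    - laplace_beltrami Y theta = h%:R * (h%:R + N%:R - 2) * Y theta.

End sphere.

Section eigenfunctions.
Context {R : realType}.

Definition gbinom (a : R) (s : nat) : R :=
  (\prod_(i < s) (a - i%:R)) / s`!%:R.

Definition jacobi (m : nat) (beta gamma xi : R) : R :=
  \sum_(s < m.+1) gbinom (m%:R + beta) s * gbinom (m%:R + gamma) (m - s) *
    ((xi - 1) / 2) ^+ (m - s) * ((xi + 1) / 2) ^+ s.

Definition lambda_ (N n : nat) : R :=
  (2 * n%:R + N%:R - 2) * (2 * n%:R + N%:R) / (N%:R * (N%:R + 2)).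

Definition w_ (N n h : nat) (Y : 'rV[R]_N -> R) (x : 'rV[R]_N) : R :=
  let r := enorm x in
  let a := h%:R + (N%:R - 2) / 2 in
  r ^+ h / (1 + r ^+ 2) `^ a
  * jacobi (n - h) a a ((1 - r ^+ 2) / (1 + r ^+ 2)) * ray_ext Y x.

Definition w_combination (N n : nat) (v : 'rV[R]_N -> R) : Prop :=
  exists (k : nat) (c : 'I_k -> R) (h : 'I_k -> 'I_n.+1)
      (Y : 'I_k -> 'rV[R]_N -> R),
    (forall j, spherical_harmonic (h j) (Y j)) /\
    v = (fun x => \sum_j c j * w_ n (h j) (Y j) x).

End eigenfunctions.

(* Main.v *)
(* Write s = |x|^2 and b = n + (N - 2) / 2. The function w_{n,h} is
   (1 + s)^(-b) p(s) H(x), where H = r^h Y_h is homogeneous of degree h and the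
   polynomial p is the Jacobi polynomial made homogeneous; the Jacobi
   differential equation for p says exactly that w_{n,h} solves the equation off
   the origin. It decays fast enough, together with its gradient,
   for an integration by parts against cutoffs vanishing near 0 and infinity:
   it is a weak solution, and it is orthogonal, for the weight
   W = N(N + 2) / (1 + s)^2, to every weak solution with another eigenvalue.

   It remains to see that the w_{n,h} are complete. Dividing by powers of 1 + s,
   and splitting homogeneous polynomials into the s^j H with H harmonic, one sees
   that they span all the (1 + s)^(-(N - 2) / 2) u with u a polynomial in
   1 / (1 + s) and the x_i / (1 + s), that is, a polynomial on the sphere seen in
   stereographic coordinates. The indicator of an orthant {x_i < a_i} is a
   bounded pointwise limit of such u. Hence if w is orthogonal to all the w_{n,h},
   then W w (1 + s)^(-(N - 2) / 2) has zero integral over every orthant, and w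
   vanishes almost everywhere. A weak solution for lambda_n minus its orthogonal
   projection on the span of the w_{n,h}, h <= n, is orthogonal to all of them.

   The multiplicity is the sum of the dimensions of the spaces of harmonic
   polynomials, given by rank-nullity for the Laplacian, as the w_{n,h} built on
   bases of these spaces are independent. *)
Require Import Defs.
From HB Require Import structures.
From mathcomp Require Import all_boot all_order all_algebra.
From mathcomp Require Import all_classical all_reals all_analysis.
From mathcomp Require Import measurable_realfun.
From mathcomp Require Import ring lra zify.
Set Implicit Arguments.
Unset Strict Implicit.
Unset Printing Implicit Defensive.
Import Order.TTheory GRing.Theory Num.Theory.
Import numFieldNormedType.Exports.
Local Open Scope classical_set_scope.
Local Open Scope ring_scope.

(** The origin is the obstacle: a spherical harmonic is only known to be smooth off it. The cutoffs
    satisfy a scale-invariant bound on |x| |grad cutoff|, so each integration by parts costs a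
    factor 1/|x|. Since N >= 3, this is affordable for functions O((1 + s)^(-(N - 2) / 2)) whose
    gradient is O of the same power over |x|. A weak solution w is only paired with explicit
    functions v; testing both its equation and the definition of its weak gradient G gives lambda' I
    = J = lambda I, where I is the integral of W w v and J that of G . grad v.

    Behind the formulas is conformal invariance: multiplication by (1 + s)^((N - 2) / 2) carries the
    problem to the sphere S^N and w_{n,h} to a spherical harmonic of degree n. Hence the single
    exponent b for all h <= n and the identity 4 b (b + 1) / (1 + s)^2 = lambda_n W.

    The statement has arbitrary spherical harmonics Y_h, whereas completeness is derived from
    harmonic polynomials. The two meet through weak solutions: both kinds of w_{n,h} are weak
    solutions, and these are spanned by the polynomial kind. *)

Section directional.
Context {R : realType} {V : normedModType R}.
Implicit Types (f : V -> R) (g : R -> R).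

(** Brings a directional derivative down to the real line, where the chain rule and the mean value
    theorem are available. *)
Lemma is_derive_line f x v (df : R) :
  is_derive (0 : R) 1 (fun h : R => f (h *: v + x)) df <-> is_derive x v f df.
Proof.
have E : (fun h : R => h^-1 *: (((fun k : R => f (k *: v + x)) \o shift 0) (h *: 1)
    - f (0 *: v + x))) = (fun h : R => h^-1 *: ((f \o shift x) (h *: v) - f x)).
  by apply/funext => h /=; rewrite addr0 scale0r add0r [_ *: 1]mulr1.
split=> -[H1 H2]; split; [move: H1|move: H2|move: H1|move: H2];
  by rewrite /derivable/derive E.
Qed.

Lemma is_derive_comp f g x v (df dg : R) :
  is_derive x v f df -> is_derive (f x) 1 g dg ->
  is_derive x v (g \o f) (dg * df).
Proof.
move=> /is_derive_line fx gx; apply/is_derive_line.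
apply: (@is_derive1_comp R g (fun h : R => f (h *: v + x)) 0 dg df) => //.
by rewrite scale0r add0r.
Qed.

Lemma is_derive_near_eq (f g : V -> R) x v (d : R) : {near x, f =1 g} ->
  is_derive x v f d -> is_derive x v g d.
Proof.
have [->|v0] := eqVneq v 0; last by move=> fg; exact: near_eq_is_derive.
have H (h : V -> R) : is_derive x 0 h 0.
  apply/is_derive_line; under eq_fun do rewrite scaler0 add0r.
  exact: is_derive_cst.
move=> _ fd; have [_ E] := H f; case: fd => _; rewrite E => <-; exact: H.
Qed.

End directional.

(** * Functions of class C^k on open sets *)

Section smooth.
Context {R : realType} {N : nat}.
Local Notation V := 'rV[R]_N.
Implicit Types (f g : V -> R) (A : set V) (B : set R).

Local Notation e i := (delta_mx 0 i : V).

Lemma is_derive_partial f i x : derivable f x (e i) ->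
  is_derive x (e i) f (partial i f x).
Proof. exact: derivableP. Qed.

Lemma partialE f i x (d : R) : is_derive x (e i) f d -> partial i f x = d.
Proof. by move=> H; rewrite /partial derive_val. Qed.

Lemma open_near A f g x : open A -> A x -> (forall y, A y -> f y = g y) ->
  {near x, f =1 g}.
Proof.
move=> oA Ax fg; near=> y; apply: fg; near: y.
exact: open_nbhs_nbhs.
Unshelve. all: by end_near. Qed.

Lemma is_derive_eq_on A f g x v (d : R) : open A -> A x ->
  (forall y, A y -> f y = g y) -> is_derive x v f d -> is_derive x v g d.
Proof.
by move=> oA Ax fg; apply: is_derive_near_eq; exact: open_near fg.
Qed.

Lemma eq_on_partial A f g i x : open A -> A x ->
  (forall y, A y -> f y = g y) -> derivable f x (e i) ->
  derivable g x (e i) /\ partial i g x = partial i f x.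
Proof.
move=> oA Ax fg /is_derive_partial/(is_derive_eq_on oA Ax fg) H.
by split; [exact: ex_derive|exact: partialE].
Qed.

Lemma continuous_eq_on A f g x : open A -> A x ->
  (forall y, A y -> f y = g y) -> {for x, continuous f} ->
  {for x, continuous g}.
Proof.
move=> oA Ax fg; rewrite /prop_for /continuous_at -(fg x)//.
move=> H; apply: cvg_trans H;  apply: (@near_eq_cvg _ _ (nbhs x)).
apply: filterS (open_nbhs_nbhs (conj oA Ax)) => y Ay; exact: fg.
Qed.

Lemma Ck_on_eq A k f g : open A -> (forall y, A y -> f y = g y) ->
  Ck_on A k f -> Ck_on A k g.
Proof.
move=> oA; elim: k f g => [|k IH] f g fg /= [cf df]; split => //.
- by move=> x Ax; apply: (continuous_eq_on oA Ax fg); exact: cf.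
- by move=> x Ax; apply: (continuous_eq_on oA Ax fg); exact: cf.
- move=> i; have [df1 df2] := df i; split.
    by move=> x Ax; case: (eq_on_partial oA Ax fg (df1 x Ax)).
  apply: IH df2 => y Ay.
  by have [_ ->] := eq_on_partial oA Ay fg (df1 y Ay).
Qed.

Lemma Ck_on_sub A A' k f : A' `<=` A -> Ck_on A k f -> Ck_on A' k f.
Proof.
move=> AA; elim: k f => [|k IH] f /= [cf df]; split => //.
- by move=> x /AA; exact: cf.
- by move=> x /AA; exact: cf.
- move=> i; have [d1 d2] := df i; split; last exact: IH.
  by move=> x /AA; exact: d1.
Qed.

Lemma Ck_onW A k f : Ck_on A k.+1 f -> Ck_on A k f.
Proof.
elim: k f => [|k IH] f /= [cf df]; split => // i.
by have [d1 d2] := df i; split => //; exact: IH.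
Qed.

Lemma Ck_on_derivable A k f i x : Ck_on A k.+1 f -> A x ->
  is_derive x (e i) f (partial i f x).
Proof. by move=> [_ /(_ i)[d _]] Ax; apply: is_derive_partial; exact: d. Qed.

(** [Ck_on] recurs on [partial i f], which is known only through a formula [f'] valid on A. This
    lets an induction on k continue with the formula. *)
Lemma Ck_on_mkS A k f (f' : 'I_N -> V -> R) : open A ->
  (forall x, A x -> {for x, continuous f}) ->
  (forall i x, A x -> is_derive x (e i) f (f' i x)) ->
  (forall i, Ck_on A k (f' i)) -> Ck_on A k.+1 f.
Proof.
move=> oA cf df Cf'; split => // i; split.
  by move=> x Ax; have := df i x Ax => ?; exact: ex_derive.
apply: Ck_on_eq (Cf' i) => // y Ay; apply/esym/partialE; exact: df.
Qed.

Lemma Ck_on_cst A k (c : R) : open A -> Ck_on A k (cst c).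
Proof.
move=> oA; elim: k c => [|k IH] c; first by split => // x _; exact: cst_continuous.
apply: (@Ck_on_mkS _ _ _ (fun _ => cst 0)) => //.
  by move=> x _; exact: cst_continuous.
Qed.

Lemma Ck_onD A k f g : open A -> Ck_on A k f -> Ck_on A k g ->
  Ck_on A k (f \+ g).
Proof.
move=> oA; elim: k f g => [|k IH] f g Cf Cg.
  by split => // x Ax; apply: continuousD; [exact: Cf.1|exact: Cg.1].
apply: (@Ck_on_mkS _ _ _ (fun i => partial i f \+ partial i g)) => //.
- by move=> x Ax; apply: continuousD; [exact: Cf.1|exact: Cg.1].
- move=> i x Ax; have := Ck_on_derivable i Cf Ax.
  by have := Ck_on_derivable i Cg Ax => ? ?; exact: is_deriveD.
- by move=> i; apply: IH; [have [] := Cf.2 i|have [] := Cg.2 i].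
Qed.

Lemma Ck_onM A k f g : open A -> Ck_on A k f -> Ck_on A k g ->
  Ck_on A k (f \* g).
Proof.
move=> oA; elim: k f g => [|k IH] f g Cf Cg.
  by split => // x Ax; apply: continuousM; [exact: Cf.1|exact: Cg.1].
apply: (@Ck_on_mkS _ _ _
    (fun i => (f \* partial i g) \+ (g \* partial i f))) => //.
- by move=> x Ax; apply: continuousM; [exact: Cf.1|exact: Cg.1].
- move=> i x Ax; have := Ck_on_derivable i Cf Ax.
  by have := Ck_on_derivable i Cg Ax => ? ?; exact: is_deriveM.
- move=> i; apply: Ck_onD => //; apply: IH;
    by [exact: Ck_onW|have [] := Cf.2 i|have [] := Cg.2 i].
Qed.

(** The derivative is a witness rather than an application of [derive], so that successive closed
    formulas can be exhibited directly. *)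
Fixpoint Ck1_on (B : set R) (k : nat) (g : R -> R) : Prop :=
  match k with
  | 0 => forall t, B t -> {for t, continuous g}
  | k'.+1 => exists2 g', (forall t, B t -> is_derive t 1 g (g' t)) & Ck1_on B k' g'
  end.

Lemma Ck1_on_continuous B k (g : R -> R) t : Ck1_on B k g -> B t -> {for t, continuous g}.
Proof.
case: k => [|k] /=; first by move=> H /H.
move=> [g' dg _] Bt; have := dg t Bt => ?.
by apply/differentiable_continuous/derivable1_diffP; exact: ex_derive.
Qed.

Lemma Ck_on_comp A B k f (g : R -> R) : open A -> (forall x, A x -> B (f x)) ->
  Ck_on A k f -> Ck1_on B k g -> Ck_on A k (g \o f).
Proof.
move=> oA AB; elim: k f g AB => [|k IH] f g AB Cf Cg.
  split => // x Ax; apply: continuous_comp; first exact: Cf.1.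
  by apply: Cg; exact: AB.
have [g' dg Cg'] := Cg.
apply: (@Ck_on_mkS _ _ _ (fun i => (g' \o f) \* partial i f)) => //.
- move=> x Ax; apply: continuous_comp; first exact: Cf.1.
  by apply: (Ck1_on_continuous Cg); exact: AB.
- move=> i x Ax; apply: is_derive_comp; first exact: Ck_on_derivable Cf Ax.
  by apply: dg; exact: AB.
- move=> i; apply: Ck_onM => //; last by have [] := Cf.2 i.
  by apply: IH => //; exact: Ck_onW.
Qed.

Lemma is_derive_coord x (v : V) i : is_derive x v (fun y : V => y 0 i) (v 0 i).
Proof.
apply/is_derive_line; under eq_fun do rewrite !mxE.
rewrite [X in is_derive _ _ X]
  (_ : _ = (v 0 i \o* id) + (cst (x 0 i) : R -> R)); last first.
  by apply/funext => h /=.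
apply: is_derive_eq.
by rewrite /= addr0 ?scaler0 ?add0r [LHS]mulr1.
Qed.

Lemma continuous_coord i : continuous (fun y : V => y 0 i).
Proof. exact: coord_continuous. Qed.

Lemma Ck_on_coord A k i : open A -> Ck_on A k (fun y : V => y 0 i).
Proof.
move=> oA; case: k => [|k]; first by split => // x _; exact: continuous_coord.
apply: (@Ck_on_mkS _ _ _ (fun j => cst ((e j) 0 i))) => //.
- by move=> x _; exact: continuous_coord.
- by move=> j x _; exact: is_derive_coord.
- by move=> j; exact: Ck_on_cst.
Qed.

Lemma Ck_on_sum A k n (F : 'I_n -> V -> R) : open A ->
  (forall j, Ck_on A k (F j)) -> Ck_on A k (fun x => \sum_j F j x).
Proof.
move=> oA; elim: n F => [|n IH] F CF.
  by apply: Ck_on_eq (Ck_on_cst k 0 oA) => // y _; rewrite big_ord0.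
apply: (@Ck_on_eq _ _ ((fun x => \sum_j F (widen_ord (leqnSn n) j) x) \+ F ord_max)) => //.
  by move=> y _; rewrite big_ord_recr.
by apply: Ck_onD => //; exact: IH.
Qed.

Lemma smooth_on_partial A f i : smooth_on A f -> smooth_on A (partial i f).
Proof. by move=> Cf k; have [_ /(_ i)[]] := Cf k.+1. Qed.

Lemma smooth_on_derive A f i x : smooth_on A f -> A x ->
  is_derive x (e i) f (partial i f x).
Proof. by move=> Cf Ax; exact: Ck_on_derivable (Cf 1%N) Ax. Qed.

Lemma smooth_on_continuous A f x : smooth_on A f -> A x -> {for x, continuous f}.
Proof. by move=> Cf Ax; have [+ _] := Cf 0; exact. Qed.

(** Serves to glue at the origin: smoothness off 0 and on a ball around 0 gives smoothness
    everywhere. *)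
Lemma smooth_on_union f A A' : smooth_on A f -> smooth_on A' f ->
  smooth_on (A `|` A') f.
Proof.
move=> sA sB k; elim: k f sA sB => [|k IH] f sA sB; split => //.
- by move=> x []; exact: smooth_on_continuous.
- by move=> x []; exact: smooth_on_continuous.
- move=> i; split; last by apply: IH; exact: smooth_on_partial.
  by move=> x [/(smooth_on_derive i sA)|/(smooth_on_derive i sB)] ?;
    exact: ex_derive.
Qed.

End smooth.

(** * Directional derivatives of C^1 functions *)

Section total_derivative.
Context {R : realType} {N : nat}.
Local Notation V := 'rV[R]_N.
Local Notation e i := (delta_mx 0 i : V).
Implicit Types (f : V -> R) (x y v : V).

Lemma rV_norm_le x (c : R) : 0 <= c -> (forall i, `|x 0 i| <= c) -> `|x| <= c.
Proof.
move=> c0 H; rewrite [`|x|]mx_normrE.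
by apply: bigmax_le => // -[i j] _ /=; rewrite (ord1 i).
Qed.

Lemma rV_coord_le_norm x i : `|x 0 i| <= `|x|.
Proof.
rewrite [`|x|]mx_normrE.
exact: (@le_bigmax _ _ _ (0 : R) (fun k : 'I_1 * 'I_N => `|x k.1 k.2|) (0, i)).
Qed.

Lemma is_derive_line_at f x v (h d : R) : is_derive (h *: v + x) v f d ->
  is_derive h 1 (fun t : R => f (t *: v + x)) d.
Proof.
move=> /is_derive_line H; apply/is_derive_line.
rewrite (_ : (fun _ => _) = (fun k : R => f (k *: v + (h *: v + x))))//.
by apply/funext => k; rewrite [k *: 1]mulr1 scalerDl addrA.
Qed.

Lemma is_derive_scale f x v (c d : R) :
  is_derive x v f d -> is_derive x (c *: v) f (c * d).
Proof.
move=> /is_derive_line H; apply/is_derive_line.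
have G : is_derive (0 : R) 1 (fun s : R => s * c) c.
  rewrite (_ : (fun _ => _) = c \*: id); last by apply/funext => s; exact: mulrC.
  by apply: is_derive_eq; exact: mulr1.
rewrite mulrC (_ : (fun _ => _) = (fun h : R => f (h *: v + x)) \o (fun s : R => s * c)).
  by apply: is_derive1_comp; rewrite mul0r.
by apply/funext => s /=; rewrite scalerA.
Qed.

Lemma mean_value f x v (D : R -> R) :
  (forall t, 0 <= t <= 1 -> is_derive (t *: v + x) v f (D t)) ->
  exists2 c, 0 <= c <= 1 & f (v + x) - f x = D c.
Proof.
move=> H; have H' (t : R) : 0 <= t <= 1 ->
    is_derive t 1 (fun s : R => f (s *: v + x)) (D t).
  by move=> /H; exact: is_derive_line_at.
have [||c cab] := @MVT_segment R (fun t => f (t *: v + x)) D 0 1 ler01.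
- by move=> t /[!in_itv]/= /andP[t0 t1]; apply: H'; rewrite !ltW.
- apply: derivable_within_continuous => t /[!in_itv]/= /H' ?; exact: ex_derive.
- rewrite scale1r scale0r add0r subr0 mulr1 => ->; exists c => //.
Qed.

(* Telescoping over the coordinates, with the mean value theorem on each step. *)
Lemma C1_is_derive f x v :
  (\forall y \near x, forall i, derivable f y (e i)) ->
  (forall i, {for x, continuous (partial i f)}) ->
  is_derive x v f (\sum_i v 0 i * partial i f x).
Proof.
move=> df cf.
pose p (k : nat) (h : R) : V := h *: (\row_(j < N) (if (j < k)%N then v 0 j else 0)) + x.
have p0 h : p 0 h = x.
  by rewrite /p (_ : \row_j _ = 0) ?scaler0 ?add0r//; apply/rowP => j; rewrite !mxE.
have pN h : p N h = h *: v + x.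
  by rewrite /p (_ : \row_j _ = v)//; apply/rowP => j; rewrite !mxE ltn_ord.
have pS (k : 'I_N) h : p k.+1 h = (h * v 0 k) *: e k + p k h.
  rewrite /p addrA; congr (_ + _); apply/rowP => j; rewrite !mxE eqxx/= ltnS leq_eqVlt.
  have [->|/negPf jk] := eqVneq j k; first by rewrite eqxx ltnn mulr0 addr0 mulr1.
  by rewrite (_ : nat_of_ord j == k = false)//= mulr0 add0r.
have telescope h : f (h *: v + x) - f x = \sum_(k < N) (f (p k.+1 h) - f (p k h)).
  by rewrite -(big_mkord xpredT (fun k => f (p k.+1 h) - f (p k h))) telescope_sumr// p0 pN.
have near_p (h t : R) (k : 'I_N) : 0 <= t <= 1 ->
    `|x - (t *: ((h * v 0 k) *: e k) + p k h)| <= `|h| * `|v|.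
  move=> /andP[t0 t1]; apply: rV_norm_le; first by rewrite mulr_ge0.
  move=> j; rewrite !mxE eqxx/= [X in `|X|](_ : _ = - (t * (h * v 0 k * (j == k)%:R)) - h * (if (j < k)%N then v 0 j else 0)); last by ring.
  have [->|jk] := eqVneq j k.
    rewrite ltnn !(mulr0, subr0, mulr1) normrN !normrM (ger0_norm t0).
    rewrite -[leRHS]mul1r ler_pM// ?mulr_ge0// ler_wpM2l//.
    exact: rV_coord_le_norm.
  rewrite !mulr0 oppr0 add0r normrN; case: ifP => _; last by rewrite mulr0 normr0 mulr_ge0.
  by rewrite normrM ler_wpM2l// rV_coord_le_norm.
suff H : (fun h : R => h^-1 *: ((f \o shift x) (h *: v) - f x)) @ 0^' -->
    \sum_i v 0 i * partial i f x.
  split; first by apply/cvg_ex; eexists; exact: H.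
  exact: cvg_lim H.
apply/cvgrPdist_le => eps eps0.
pose M := \sum_i `|v 0 i| + 1.
have M0 : 0 < M by rewrite ltr_wpDl// sumr_ge0.
have : \forall y \near x, forall i, derivable f y (e i) /\
    `|partial i f x - partial i f y| <= eps / M.
  near=> y => i; split; first by move: i; near: y.
  move: i; near: y; apply: filter_forall => i.
  by have /cvgrPdist_le := cf i; apply; rewrite divr_gt0.
move=> /nbhs_ballP[d /= d0]; rewrite -ball_normE /= => dH.
near=> h.
have hn0 : h != 0 by near: h; exact: nbhs_dnbhs_neq.
have hd : `|h| * `|v| < d.
  have : `|h| < d / (`|v| + 1).
    near: h; apply: dnbhs0_lt; rewrite divr_gt0// ltr_wpDl//.
  rewrite ltr_pdivlMr ?ltr_wpDl// => /(le_lt_trans _); apply.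
  by rewrite ler_wpM2l// lerDl.
have step (k : 'I_N) : exists2 z, `|x - z| < d &
    f (p k.+1 h) - f (p k h) = (h * v 0 k) * partial k f z.
  have [t tH|c c01] := @mean_value f (p k h) ((h * v 0 k) *: e k)
      (fun t => (h * v 0 k) * partial k f (t *: ((h * v 0 k) *: e k) + p k h)).
    set z := _ + p k h.
    have [+ _] := dH z (le_lt_trans (near_p h t k tH) hd) k.
    by move=> /is_derive_partial; exact: is_derive_scale.
  rewrite -pS => ->; exists (c *: ((h * v 0 k) *: e k) + p k h) => //.
  exact: le_lt_trans (near_p h c k c01) hd.
rewrite /= telescope scaler_sumr -sumrB.
rewrite (le_trans (ler_norm_sum _ _ _))//.
apply: (@le_trans _ _ (\sum_k `|v 0 k| * (eps / M))); last first.
  rewrite -mulr_suml mulrA ler_pdivrMr// mulrC ler_wpM2l// ?ltW//.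
  by rewrite /M ltrDl.
apply: ler_sum => k _; have [z zd ->] := step k.
rewrite [X in _ - X](_ : _ = v 0 k * partial k f z); last first.
  by rewrite -[LHS]/(h^-1 * _) !mulrA mulVf// mul1r.
rewrite -mulrBr normrM ler_wpM2l//.
by have [_] := dH z zd k.
Unshelve. all: by end_near. Qed.

End total_derivative.

(** * The Euclidean norm and its square *)

Section euclidean_norm.
Context {R : realType} {N : nat}.
Local Notation V := 'rV[R]_N.
Local Notation e i := (delta_mx 0 i : V).
Implicit Types (x : V).

(** Radial profiles are written as functions of this polynomial because, unlike [enorm], it is
    smooth at the origin. *)
Definition sq x : R := dotp x x.

Lemma sqE x : sq x = \sum_i x 0 i ^+ 2.
Proof. by apply: eq_bigr => i _; rewrite expr2. Qed.

Lemma sq_ge0 x : 0 <= sq x.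
Proof. by rewrite sqE sumr_ge0// => i _; exact: sqr_ge0. Qed.
Hint Resolve sq_ge0 : core.

Lemma coord_le_sq x i : x 0 i ^+ 2 <= sq x.
Proof.
by rewrite sqE (bigD1 i)//= lerDl sumr_ge0// => j _; exact: sqr_ge0.
Qed.

Lemma sq_eq0 x : (sq x == 0) = (x == 0).
Proof.
apply/eqP/eqP => [s0|->]; last first.
  by rewrite sqE big1// => i _; rewrite mxE expr0n.
apply/rowP => i; rewrite mxE; apply/eqP; rewrite -sqrf_eq0 eq_le sqr_ge0 andbT.
by rewrite -s0 coord_le_sq.
Qed.

Lemma sq_gt0 x : (0 < sq x) = (x != 0).
Proof. by rewrite lt_neqAle sq_ge0 andbT eq_sym sq_eq0. Qed.

Lemma sqZ (t : R) x : sq (t *: x) = t ^+ 2 * sq x.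
Proof.
by rewrite !sqE mulr_sumr; apply: eq_bigr => i _; rewrite mxE exprMn.
Qed.

Lemma enorm_sqr x : enorm x ^+ 2 = sq x.
Proof. by rewrite sqr_sqrtr// sq_ge0. Qed.

Lemma enorm_ge0 x : 0 <= enorm x.
Proof. exact: sqrtr_ge0. Qed.

Lemma enorm_gt0 x : (0 < enorm x) = (x != 0).
Proof. by rewrite sqrtr_gt0 -[dotp _ _]/(sq x) sq_gt0. Qed.

Lemma enorm0 : enorm (0 : V) = 0.
Proof.
by apply/eqP; rewrite eq_le enorm_ge0 andbT leNgt enorm_gt0 eqxx.
Qed.

Lemma coord_le_enorm x i : `|x 0 i| <= enorm x.
Proof. by rewrite -sqrtr_sqr ler_wsqrtr// coord_le_sq. Qed.

Lemma enormE x : enorm x = sq x `^ 2^-1.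
Proof. by rewrite powR12_sqrt. Qed.

Lemma enormZ (t : R) x : 0 <= t -> enorm (t *: x) = t * enorm x.
Proof.
move=> t0; rewrite /enorm -![dotp _ _]/(sq _) sqZ sqrtrM ?sqr_ge0//.
by rewrite sqrtr_sqr ger0_norm.
Qed.

Lemma smooth_sq (A : set V) : open A -> smooth_on A sq.
Proof.
by move=> oA k; apply: Ck_on_sum => // i; apply: Ck_onM => //; exact: Ck_on_coord.
Qed.

Lemma continuous_sq : continuous sq.
Proof. by move=> x; exact: (smooth_on_continuous (smooth_sq openT)). Qed.

Lemma is_derive_sq x i : is_derive x (e i) sq (2 * x 0 i).
Proof.
have -> : sq = \sum_j ((fun y : V => y 0 j) * (fun y : V => y 0 j)).
  by apply/funext => y; rewrite fct_sumE.
have H j : is_derive x (e i) (fun y : V => y 0 j) ((e i) 0 j).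
  exact: is_derive_coord.
apply: is_derive_eq; rewrite (bigD1 i)//= big1 ?addr0.
  by rewrite !mxE !eqxx/= -[RHS]/(2 * x 0 i) -[_ *: _]/(x 0 i * 1); ring.
move=> j /negPf ji; rewrite !mxE eqxx/= ji -[_ *: _]/(x 0 j * 0); ring.
Qed.

Lemma open_neq0 : open [set x : V | x != 0].
Proof.
rewrite (_ : mkset _ = sq @^-1` [set t | 0 < t]).
  by apply: open_comp; [move=> x _; exact: continuous_sq|exact: open_gt].
by apply/seteqP; split => x /=; rewrite sq_gt0.
Qed.

End euclidean_norm.
#[global] Hint Extern 0 (is_true (0 <= sq _)) => exact: sq_ge0 : core.
#[global] Hint Extern 0 (is_true (0 <= enorm _)) => exact: enorm_ge0 : core.

(** * Powers, polynomials and a smooth bump on the real line *)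

Section one_variable.
Context {R : realType}.

(** The factor [a] makes the family stable under differentiation. *)
Lemma Ck1_on_powR (a c : R) k : Ck1_on [set t : R | 0 < t] k (fun t => a * t `^ c).
Proof.
elim: k a c => [|k IH] a c; last first.
  exists (fun t => (a * c) * t `^ (c - 1)) => // t t0.
  have := @is_derive1_powR R c t t0 => H.
  rewrite [X in is_derive _ _ X](_ : _ = a \*: (fun u : R => u `^ c))//.
  by apply: is_derive_eq; rewrite -[LHS]/(a * _) mulrA.
move=> t /= t0; have := @is_derive1_powR R c t t0 => H.
apply: continuousM; first exact: cst_continuous.
by apply/differentiable_continuous/derivable1_diffP; exact: ex_derive.
Qed.

Lemma Ck1_on_poly (B : set R) (p : {poly R}) k : Ck1_on B k (fun t => p.[t]).
Proof.
elim: k p => [|k IH] p; last first.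
  by exists (fun t => p^`().[t]) => // t _; exact: is_derive_poly.
by move=> t _; exact: continuous_horner.
Qed.

(** The smooth function exp(-1/t), extended by 0 to t <= 0. The polynomial factor makes the family
    stable under differentiation, which replaces p by X^2 (p - p'). *)
Definition bumpX (p : {poly R}) (t : R) : R :=
  if 0 < t then p.[t^-1] * expR (- t^-1) else 0.

Lemma exp_dominates n (y : R) : 0 < y -> y ^+ n * expR (- y) <= n`!%:R.
Proof.
move=> y0; rewrite expRN ler_pdivrMr ?expR_gt0//.
case: n => [|n]; first by rewrite expr0 fact0 mul1r -expR0 ler_expR ltW.
have /(le_trans _) := expR_ge1Dxn n (ltW y0).
move=> /(_ (y ^+ n.+1 / n.+1`!%:R)); rewrite lerDr ler01 => /(_ isT).
by rewrite ler_pdivrMr ?ltr0n ?fact_gt0// mulrC.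
Qed.

(** With y = 1/t, a term y^i exp(-y) is t^2 y^(i+2) exp(-y) <= (i+2)! t^2. The quadratic bound makes
    the difference quotient at 0 tend to 0. *)
Lemma bumpX_bound p : exists2 C : R, 0 <= C & forall t, `|bumpX p t| <= C * t ^+ 2.
Proof.
exists (\sum_(i < size p) `|p`_i| * (i + 2)`!%:R).
  by apply: sumr_ge0 => i _; rewrite mulr_ge0.
move=> t; rewrite /bumpX; case: ifPn => [t0|_]; last first.
  by rewrite normr0 mulr_ge0 ?sqr_ge0// sumr_ge0// => i _; rewrite mulr_ge0.
rewrite horner_coef !mulr_suml (le_trans (ler_norm_sum _ _ _))//.
apply: ler_sum => i _; rewrite -!mulrA normrM ler_wpM2l//.
have y0 : 0 < t^-1 by rewrite invr_gt0.
rewrite ger0_norm; last by rewrite mulr_ge0 ?expR_ge0// exprn_ge0// ltW.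
rewrite -ler_pdivrMr ?exprn_gt0// -exprVn mulrAC -exprD; exact: exp_dominates.
Qed.

Lemma is_derive_bumpX p (t : R) :
  is_derive t 1 (bumpX p) (bumpX ('X^2 * (p - p^`())) t).
Proof.
have [t0|t0|->] := ltgtP t 0.
- apply: (@is_derive_near_eq _ _ (cst 0)); last first.
    by rewrite /bumpX ltNge ltW//=; exact: is_derive_cst.
  near=> u; rewrite /bumpX ltNge ltW//=; near: u; exact: lt_nbhsl.
- apply: (@is_derive_near_eq _ _ (fun u : R => p.[u^-1] * expR (- u^-1))).
    near=> u; rewrite /bumpX ifT//; near: u; exact: lt_nbhsr.
  have t1 : t != 0 by rewrite gt_eqF.
  have dV : is_derive t 1 (fun u : R => u^-1) (- t ^- 2).
    by have := @is_deriveV R id t 1 1 t1 _ => H; apply: is_derive_eq; exact: mulr1.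
  have dN : is_derive t 1 (fun u : R => - u^-1) (t ^- 2).
    by apply: is_derive_eq; rewrite opprK.
  have dP : is_derive t 1 (fun u : R => p.[u^-1]) (p^`().[t^-1] * - t ^- 2).
    exact: (is_derive1_comp (is_derive_poly p t^-1) dV).
  have dE : is_derive t 1 (fun u : R => expR (- u^-1)) (expR (- t^-1) * t ^- 2).
    exact: (@is_derive1_comp _ expR (fun u : R => - u^-1) _ _ _ (is_derive_expR _) dN).
  rewrite /bumpX t0 hornerM hornerXn hornerD hornerN.
  apply: is_derive_eq; rewrite -!/(_ * _); rewrite exprVn.
  rewrite -[_ *: _]/(p.[t^-1] * _) -[X in _ + X]/(expR (- t^-1) * _); ring.
- have -> : bumpX ('X^2 * (p - p^`())) 0 = 0 by rewrite /bumpX ltxx.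
  have [C C0 HC] := bumpX_bound p.
  suff H : (fun h : R => h^-1 *: ((bumpX p \o shift (0 : R)) (h *: (1 : R)) - bumpX p 0)) @ 0^'
      --> (0 : R).
    split; first by apply/cvg_ex; eexists; exact: H.
    exact: cvg_lim H.
  apply/cvgr0Pnorm_le => eps eps0; near=> h.
  have h0 : h != 0 by near: h; exact: nbhs_dnbhs_neq.
  rewrite /= addr0 [h *: 1]mulr1 {2}/bumpX ltxx subr0.
  rewrite -[_ *: _]/(h^-1 * _) normrM normfV ler_pdivrMl ?normr_gt0//.
  rewrite (le_trans (HC h))// -real_normK ?num_real// expr2 mulrCA ler_wpM2l//.
  have : `|h| < eps / (C + 1).
    by near: h; apply: dnbhs0_lt; rewrite divr_gt0// ltr_wpDl.
  rewrite ltr_pdivlMr ?ltr_wpDl// => /ltW; apply: le_trans.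
  by rewrite mulrC ler_wpM2l// lerDl.
Unshelve. all: by end_near. Qed.

Lemma Ck1_on_bumpX p k : Ck1_on setT k (bumpX p).
Proof.
elim: k p => [|k IH] p.
  move=> t _; have := is_derive_bumpX p t => ?.
  by apply/differentiable_continuous/derivable1_diffP; exact: ex_derive.
by eexists; [move=> t _; exact: is_derive_bumpX|exact: IH].
Qed.

Definition bump (t : R) := bumpX 1 t.
Definition bump' (t : R) := bumpX 'X^2 t.

Lemma is_derive_bump (t : R) : is_derive t 1 bump (bump' t).
Proof.
by have := is_derive_bumpX 1 t; rewrite -polyC1 derivC subr0 mulr1.
Qed.

Lemma bump_gt0 (t : R) : 0 < t -> bump t = expR (- t^-1).
Proof. by move=> t0; rewrite /bump /bumpX t0 hornerC mul1r. Qed.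

Lemma bump'_gt0 (t : R) : 0 < t -> bump' t = (t^-1) ^+ 2 * expR (- t^-1).
Proof. by move=> t0; rewrite /bump' /bumpX t0 hornerXn. Qed.

Lemma bump_le0 (t : R) : t <= 0 -> bump t = 0.
Proof. by move=> t0; rewrite /bump /bumpX ltNge t0. Qed.

Lemma bump'_le0 (t : R) : t <= 0 -> bump' t = 0.
Proof. by move=> t0; rewrite /bump' /bumpX ltNge t0. Qed.

Lemma bump_itv (t : R) : 0 <= bump t <= 1.
Proof.
have [t0|t0] := ltP 0 t; last by rewrite bump_le0// lexx ler01.
by rewrite bump_gt0// expR_ge0 expR_le1 oppr_le0 invr_ge0 ltW.
Qed.

Lemma bump'_itv (t : R) : 0 <= bump' t <= 2.
Proof.
have [t0|t0] := ltP 0 t; last by rewrite bump'_le0// lexx ler0n.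
rewrite bump'_gt0// mulr_ge0 ?expR_ge0 ?sqr_ge0//=.
by have := @exp_dominates 2 t^-1; rewrite invr_gt0; apply.
Qed.

(** At t = K s - 1 the factor 1 + t is K s, so that this bounds |x| times the gradient of the inner
    cutoff uniformly in K. *)
Lemma bump'_decay (t : R) : (1 + t) * bump' t <= 3.
Proof.
have [t0|t0] := ltP 0 t; last by rewrite bump'_le0// mulr0 ler0n.
rewrite bump'_gt0// mulrDl mul1r.
have y0 : 0 < t^-1 by rewrite invr_gt0.
have := exp_dominates 2 y0 : _ <= 2%:R.
have := exp_dominates 1 y0 : _ <= 1%:R.
rewrite expr1 expr2 !mulrA mulfV ?gt_eqF// mul1r; lra.
Qed.

(** At t = K s - 1 with s fixed, the right-hand side is O(1/K), whence the pointwise limit of the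
    cutoff gradients. *)
Lemma bump'_decay2 (t : R) : 0 < t -> (1 + t) * bump' t <= t^-1 + (t^-1) ^+ 2.
Proof.
move=> t0; rewrite bump'_gt0// mulrA.
rewrite [leRHS](_ : _ = (1 + t) * t^-1 ^+ 2); last first.
  by rewrite mulrDl mul1r expr2 mulrA mulfV ?gt_eqF// mul1r addrC.
rewrite ler_piMr ?expR_le1 ?oppr_le0 ?invr_ge0 ?ltW//.
by rewrite mulr_gt0 ?addr_gt0// exprn_gt0// invr_gt0.
Qed.

Lemma bump_ge (t : R) : 0 < t -> 1 - t^-1 <= bump t.
Proof. by move=> t0; rewrite bump_gt0// expR_ge1Dx. Qed.

Lemma continuous_bump (t : R) : {for t, continuous bump}.
Proof.
by have /(_ t I) := @Ck1_on_bumpX 1 0.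
Qed.

End one_variable.

(** * Cutoffs vanishing near the origin and near infinity *)

Lemma near_natS_ge {R : realType} (c : R) : \forall k \near \oo, c <= k.+1%:R.
Proof.
near=> k; apply: (@le_trans _ _ k%:R); last by rewrite ler_nat.
by near: k; exact: nbhs_infty_ger.
Unshelve. all: by end_near. Qed.

Lemma inv_pred_le {R : realType} (u : R) : 2 <= u -> (u - 1)^-1 <= 2 / u.
Proof.
move=> u2; rewrite ler_pdivlMr; last by lra.
rewrite mulrC ler_pdivrMr; lra.
Qed.

Section cutoff.
Context {R : realType} {N : nat}.
Local Notation V := 'rV[R]_N.
Local Notation e i := (delta_mx 0 i : V).
Implicit Types (x : V).

(** With K = k + 1, the factors vanish for s >= K and for s <= 1/K. At fixed s > 0 they tend to
    [bump 1], which is exp(-1), and to 1; [expR 1] normalizes the limit to 1. *)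
Definition cutoff (k : nat) x : R :=
  expR 1 * (bump (1 - sq x / k.+1%:R) * bump (k.+1%:R * sq x - 1)).

Definition cutoffD (k : nat) (i : 'I_N) x : R :=
  expR 1 * (2 * x 0 i * (k.+1%:R * (bump (1 - sq x / k.+1%:R) * bump' (k.+1%:R * sq x - 1))
    - bump (k.+1%:R * sq x - 1) * bump' (1 - sq x / k.+1%:R) / k.+1%:R)).

Lemma smooth_cutoff k : smooth_on setT (cutoff k).
Proof.
move=> m; have Cs : Ck_on setT m (@sq R N) by exact: smooth_sq openT m.
apply: Ck_onM; [exact: openT|exact/Ck_on_cst/openT|].
apply: Ck_onM; first exact: openT.
  apply: (@Ck_on_comp _ _ _ setT _ (fun x : V => 1 - sq x / k.+1%:R)) => //.
  - exact: openT.
  - apply: (@Ck_on_comp _ _ _ setT _ (@sq R N) (fun t => 1 - t / k.+1%:R)) => //.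
      exact: openT.
    have := @Ck1_on_poly R setT (1 - (k.+1%:R)^-1 *: 'X) m.
    by congr Ck1_on; apply/funext => t; rewrite !hornerE mulrC.
  - exact: Ck1_on_bumpX.
apply: (@Ck_on_comp _ _ _ setT _ (fun x : V => k.+1%:R * sq x - 1)) => //.
- exact: openT.
- apply: (@Ck_on_comp _ _ _ setT _ (@sq R N) (fun t => k.+1%:R * t - 1)) => //.
    exact: openT.
  have := @Ck1_on_poly R setT (k.+1%:R *: 'X - 1) m.
  by congr Ck1_on; apply/funext => t; rewrite !hornerE.
- exact: Ck1_on_bumpX.
Qed.

Lemma is_derive_cutoff k i x : is_derive x (e i) (cutoff k) (cutoffD k i x).
Proof.
have Ds := is_derive_sq x i.
have D1 : is_derive x (e i) (fun y : V => 1 - sq y / k.+1%:R) (- (2 * x 0 i) / k.+1%:R).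
  rewrite (_ : (fun _ => _) = cst 1 - k.+1%:R^-1 \*: (@sq R N)); last first.
    by apply/funext => y; rewrite -[RHS]/(1 - k.+1%:R^-1 * sq y) mulrC.
  by apply: is_derive_eq; rewrite sub0r -[_ *: _]/(_ * _) mulrC mulNr.
have D2 : is_derive x (e i) (fun y : V => k.+1%:R * sq y - 1) (k.+1%:R * (2 * x 0 i)).
  rewrite (_ : (fun _ => _) = k.+1%:R \*: (@sq R N) - cst 1)//.
  by apply: is_derive_eq; rewrite subr0.
have B1 := is_derive_comp D1 (is_derive_bump _).
have B2 := is_derive_comp D2 (is_derive_bump _).
rewrite (_ : cutoff k = expR 1 \*: ((bump \o (fun y : V => 1 - sq y / k.+1%:R)) *
    (bump \o (fun y : V => k.+1%:R * sq y - 1))))//.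
apply: is_derive_eq; rewrite /cutoffD -!/(_ * _) /=.
rewrite -[_ *: _]/(expR 1 * (_ * _ + _ * _)); ring.
Qed.

Lemma cutoff_itv k x : 0 <= cutoff k x <= expR 1.
Proof.
have /andP[a0 a1] := bump_itv (1 - sq x / k.+1%:R).
have /andP[b0 b1] := bump_itv (k.+1%:R * sq x - 1).
by rewrite /cutoff mulr_ge0 ?expR_ge0 ?mulr_ge0//= ler_piMr ?expR_ge0// mulr_ile1.
Qed.

Lemma cutoff_eq0 k x : (sq x < k.+1%:R^-1) || (k.+1%:R < sq x) -> cutoff k x = 0.
Proof.
rewrite /cutoff; case/orP => H.
  rewrite (@bump_le0 _ (_ * _ - _)) ?mulr0// subr_le0 mulrC -ler_pdivlMr// div1r ltW//.
by rewrite bump_le0 ?mul0r ?mulr0// subr_le0 ler_pdivlMr// mul1r ltW.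
Qed.

Let cutoffD_le k i x :
  enorm x * `|cutoffD k i x| <= expR 1 * (2 *
    ((k.+1%:R * sq x) * bump' (k.+1%:R * sq x - 1)
     + (sq x / k.+1%:R) * bump' (1 - sq x / k.+1%:R))).
Proof.
set t1 := _ * sq x - 1; set t2 := 1 - _.
have /andP[a0 a1] := bump_itv t1.
have /andP[b0 b1] := bump_itv t2.
have /andP[c0 c1] := bump'_itv t1.
have /andP[d0 d1] := bump'_itv t2.
have K0 : 0 < k.+1%:R^-1 :> R by rewrite invr_gt0.
rewrite /cutoffD normrM (ger0_norm (expR_ge0 _)) mulrCA ler_wpM2l ?expR_ge0//.
rewrite !normrM (@ger0_norm _ 2)// -mulrA mulrCA ler_wpM2l// [leLHS]mulrA.
apply: (@le_trans _ _ (sq x * (k.+1%:R * bump' t1 + bump' t2 / k.+1%:R))).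
  have H1 : enorm x * `|x 0 i| <= sq x.
    rewrite -enorm_sqr expr2 ler_wpM2l//. exact: coord_le_enorm.
  apply: (ler_pM _ _ H1) => //; first exact: mulr_ge0.
  apply: (le_trans (ler_normB _ _)); rewrite !normrM lerD//.
    rewrite (@ger0_norm _ k.+1%:R)// ler_wpM2l// !ger0_norm//.
    by rewrite ler_piMl.
  rewrite (ger0_norm (ltW K0)) !ger0_norm// ler_wpM2r ?(ltW K0)//.
  by rewrite ler_piMl.
by rewrite mulrDr lerD// mulrA; [rewrite (mulrC (sq x))|rewrite mulrAC].
Qed.

(** The gradient is bounded by a multiple of 1/|x| independent of k, which is what dominated
    convergence requires. In 10 = 2 (3 + 2), the 3 comes from [bump'_decay], and the last 2 from
    [bump' <= 2] on the region s <= K. *)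
Lemma cutoffD_bound k i x : enorm x * `|cutoffD k i x| <= 10 * expR 1.
Proof.
apply: (le_trans (cutoffD_le k i x)); rewrite [leRHS]mulrC ler_wpM2l ?expR_ge0//.
rewrite (_ : 10 = 2 * (3 + 2)) ?ler_wpM2l//; last by ring.
apply: lerD.
  by have := bump'_decay (k.+1%:R * sq x - 1); rewrite addrCA subrr addr0.
have [H|H] := leP (sq x / k.+1%:R) 1.
  have /andP[d0 d1] := bump'_itv (1 - sq x / k.+1%:R).
  by rewrite -[leRHS]mul1r ler_pM// divr_ge0.
by rewrite bump'_le0 ?mulr0 ?ler0n// subr_le0 ltW.
Qed.

Lemma cutoff_cvg x : x != 0 -> cutoff k x @[k --> \oo] --> (1 : R).
Proof.
move=> x0; have s0 : 0 < sq x by rewrite sq_gt0.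
rewrite (_ : 1 = expR 1 * (bump (1 - sq x * 0) * 1)); last first.
  by rewrite mulr0 subr0 mulr1 bump_gt0// invr1 expRN mulfV// gt_eqF// expR_gt0.
apply: cvgM; first exact: cvg_cst.
apply: cvgM.
  apply: continuous_cvg; first exact: continuous_bump.
  apply: cvgB; first exact: cvg_cst.
  apply: cvgM; first exact: cvg_cst.
  exact: cvg_harmonic.
(* For K s >= 2 one has exp(-1/(K s - 1)) >= 1 - 1/(K s - 1) >= 1 - 2/(K s). *)
apply: (@squeeze_cvgr _ _ _ _ (fun k => 1 - 2 / sq x * harmonic k) (fun _ => 1)).
- near=> k; have /andP[_ ->] := bump_itv (k.+1%:R * sq x - 1); rewrite andbT.
  have H : 2 <= k.+1%:R * sq x.
    by rewrite -ler_pdivrMr//; near: k; exact: near_natS_ge.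
  have t0 : 0 < k.+1%:R * sq x - 1 by lra.
  apply: le_trans (bump_ge t0).
  rewrite lerB// /harmonic/= -mulrA -invfM [sq x * _]mulrC.
  exact: inv_pred_le.
- rewrite -[X in _ --> X]subr0 -[X in _ --> _ - X](mulr0 (2 / sq x)).
  apply: cvgB; first exact: cvg_cst.
  apply: cvgM; [exact: cvg_cst|exact: cvg_harmonic].
- exact: cvg_cst.
Unshelve. all: by end_near. Qed.

Lemma cutoffD_cvg i x : x != 0 -> cutoffD k i x @[k --> \oo] --> (0 : R).
Proof.
move=> x0; have s0 : 0 < sq x by rewrite sq_gt0.
have r0 : 0 < enorm x by rewrite enorm_gt0.
(* The term 4/s comes from 1/t + 1/t^2 <= 2/t <= 4/(K s) at t = K s - 1 >= 1, and 2 s from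
   [bump' <= 2] in the outer factor. *)
pose C := (enorm x)^-1 * (expR 1 * (2 * (4 / sq x + 2 * sq x))).
suff H : \forall k \near \oo, `|cutoffD k i x| <= C * harmonic k.
  have C0 : C * harmonic k @[k --> \oo] --> (0 : R).
    by rewrite -[X in _ --> X](mulr0 C); apply: cvgM; [exact: cvg_cst|exact: cvg_harmonic].
  apply: (@squeeze_cvgr _ _ _ _ (fun k => - (C * harmonic k)) (fun k => C * harmonic k)) => //.
    by near=> k; rewrite -ler_norml; near: k.
  by rewrite -[X in _ --> X]oppr0; exact: cvgN.
near=> k; rewrite /C -!mulrA ler_pdivlMl//.
apply: (le_trans (cutoffD_le k i x)).
rewrite ler_wpM2l ?expR_ge0// ler_wpM2l// mulrDl; apply: lerD.
  have H : 2 <= k.+1%:R * sq x.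
    by rewrite -ler_pdivrMr//; near: k; exact: near_natS_ge.
  set t := _ - 1; have t0 : 0 < t by rewrite /t; lra.
  have := bump'_decay2 t0; rewrite {1}/t addrCA subrr addr0 => /le_trans; apply.
  have t1 : t^-1 <= 1 by rewrite invf_le1// /t; lra.
  rewrite /harmonic /= -mulrA -invfM [sq x * _]mulrC.
  have H2 := inv_pred_le H; rewrite -/t in H2.
  have t2 : t^-1 ^+ 2 <= t^-1 by rewrite expr2 ler_piMl// invr_ge0 ltW.
  rewrite (_ : 4 / _ = 2 / (k.+1%:R * sq x) + 2 / (k.+1%:R * sq x)); last first.
    by rewrite -mulrDl; congr (_ / _); ring.
  by rewrite lerD// (le_trans t2).
rewrite [leRHS](_ : _ = sq x / k.+1%:R * 2); last by rewrite /harmonic /=; ring.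
have [H|H] := leP (sq x / k.+1%:R) 1.
  have /andP[d0 d1] := bump'_itv (1 - sq x / k.+1%:R).
  by rewrite ler_wpM2l// divr_ge0.
by rewrite bump'_le0 ?mulr0 ?mulr_ge0// ?divr_ge0// subr_le0 ltW.
Unshelve. all: by end_near. Qed.

(** The product vanishes on the ball s < 1/K, and this ball and the punctured space cover
    everything. *)
Lemma cutoff_test_function k (f : V -> R) : smooth_on [set x : V | x != 0] f ->
  test_function (fun x => cutoff k x * f x).
Proof.
move=> sf; split.
  pose B := [set x : V | sq x < k.+1%:R^-1].
  have oB : open B.
    rewrite (_ : B = sq @^-1` [set t | t < k.+1%:R^-1])//.
    by apply: open_comp; [move=> x _; exact: continuous_sq|exact: open_lt].
  rewrite (_ : setT = [set x : V | x != 0] `|` B); last first.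
    apply/seteqP; split => // x _; have [->|] := eqVneq x 0; last by left.
    by right; rewrite /B/= (_ : sq 0 = 0) ?invr_gt0//; apply/eqP; rewrite sq_eq0.
  apply: smooth_on_union.
    move=> m; apply: Ck_onM => //; [exact: open_neq0|].
    exact: Ck_on_sub (smooth_cutoff k m).
  move=> m; apply: (@Ck_on_eq _ _ _ _ (cst 0)) => //; last exact: Ck_on_cst.
  by move=> y yB; rewrite cutoff_eq0 ?mul0r//; apply/orP; left.
apply: bounded_closed_compact; last exact: closed_closure.
pose D := [set x : V | sq x <= k.+1%:R].
have cD : closed D.
  rewrite (_ : D = sq @^-1` [set t | t <= k.+1%:R])//.
  by apply: closed_comp; [move=> x _; exact: continuous_sq|exact: closed_le].
have sD : closure [set x | cutoff k x * f x != 0] `<=` D.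
  rewrite [X in _ `<=` X](closure_id D).1//; apply: closure_subset => x /=.
  by rewrite /D/= leNgt; apply: contra => H; rewrite cutoff_eq0 ?mul0r// H orbT.
exists k.+1%:R; split; first exact: num_real.
move=> M kM x /sD xD; apply: rV_norm_le => [|i].
  by rewrite (le_trans _ (ltW kM)).
rewrite (le_trans _ (ltW kM))//.
have : x 0 i ^+ 2 <= k.+1%:R by apply: le_trans xD; exact: coord_le_sq.
rewrite -real_normK ?num_real// => H.
have k1 : (1 : R) <= k.+1%:R by rewrite ler1n.
rewrite leNgt; apply/negP => K; have : k.+1%:R < `|x 0 i| ^+ 2.
  by rewrite expr2 -[ltLHS]mul1r ltr_pM// (le_lt_trans k1).
by rewrite ltNge H.
Qed.

End cutoff.

(** * Borel measurability in the product sigma-algebra *)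

Section borel_rV.
Context {R : realType} {n : nat}.
Local Notation V := 'rV[R]_n.
Implicit Types (f : V -> R) (x : V).

Lemma measurable_forall_coord (P : 'I_n -> set R) :
  (forall i, measurable (P i)) -> measurable [set x : V | forall i, P i (x 0 i)].
Proof.
move=> mP; rewrite (_ : mkset _ = \bigcap_(i in [set: 'I_n])
    ((fun x : V => x 0 i) @^-1` P i)); last first.
  by apply/seteqP; split => [x /= H i _|x H i]; [exact: H|exact: (H i)].
apply: fin_bigcap_measurable => // i _; rewrite -[X in measurable X]setTI.
exact: measurable_coord.
Qed.

Lemma measurable_set1_rV x : measurable [set x].
Proof.
rewrite (_ : [set x] = [set y : V | forall i, [set x 0 i] (y 0 i)]).
  by apply: (@measurable_forall_coord (fun i => [set x 0 i])) => i; exact: measurable_set1.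
apply/seteqP; split => y /= => [->//|H]; apply/rowP => i; exact: H.
Qed.

(** An open set is the union of the cubes it contains among the countably many with rational centre
    and radius 1/(k + 1). *)
Lemma open_measurable_rV (A : set V) : open A -> measurable A.
Proof.
move=> oA.
pose B (q : 'rV[rat]_n * nat) := [set y : V | forall i,
  `|ratr (q.1 0 i) - y 0 i| < q.2.+1%:R^-1].
have mB q : measurable (B q).
  apply: (measurable_forall_coord (P := fun i => [set t | `|ratr (q.1 0 i) - t| < q.2.+1%:R^-1])) => i.
  rewrite (_ : mkset _ = ball (ratr (q.1 0 i) : R) q.2.+1%:R^-1); first by rewrite ball_itv; exact: measurable_itv.
  by rewrite -ball_normE.
rewrite (_ : A = \bigcup_q (if `[< B q `<=` A >] then B q else set0)).
  apply: countable_bigcupT_measurable => [|q]; first exact: countableP.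
  by case: ifP => _.
apply/seteqP; split => [x Ax|x [q _]]; last first.
  by case: ifPn => // /asboolP; exact.
have /nbhs_ballP[d /= d0] : nbhs x A by exact: open_nbhs_nbhs.
rewrite -ball_normE /= => dA.
(* Any cube of radius less than d/2 that contains x lies in the ball of radius d around x. *)
pose k := Num.truncn (2 / d).
have kd : k.+1%:R^-1 < d / 2.
  by rewrite invf_plt ?posrE ?divr_gt0// invf_div truncnS_gt.
have K0 : 0 < k.+1%:R^-1 :> R by rewrite invr_gt0.
have ex i : {q : rat | `|ratr q - x 0 i| < k.+1%:R^-1}.
  apply: cid; have [] := @rat_in_itvoo R (x 0 i - k.+1%:R^-1) (x 0 i + k.+1%:R^-1).
    by rewrite ltrBlDr -addrA ltrDl addr_gt0.
  by move=> q qx; exists q; rewrite ltr_distl; move: qx; rewrite in_itv.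
exists (\row_i (sval (ex i)), k) => //.
have Bx : B (\row_i (sval (ex i)), k) x.
  by move=> i; rewrite /= mxE; case: (ex i).
rewrite ifT//; apply/asboolP => y By; apply: dA.
apply: (@le_lt_trans _ _ (2 * k.+1%:R^-1)); last by rewrite mulrC -ltr_pdivlMr.
apply: rV_norm_le => [|i]; first by rewrite mulr_ge0// ltW.
rewrite !mxE -(subrK (ratr ((\row_i sval (ex i)) 0 i)) (x 0 i)) -addrA.
rewrite (le_trans (ler_normD _ _))// mulrDl mul1r lerD//.
  by rewrite distrC ltW//; exact: Bx.
by rewrite ltW//; exact: By.
Qed.

(** A preimage of an open set is an open set up to the point a. The exception is meant for functions
    that are singular at the origin. *)
Lemma continuous_neq_measurable_rV (a : V) f :
  (forall x, x != a -> {for x, continuous f}) -> measurable_fun setT f.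
Proof.
move=> cf _ Y mY.
suff : measurable_fun setT f by apply.
apply: (measurability _ (RGenOInfty.measurableE R)) => // _ [_ [b ->] <-].
set U := `]b, +oo[%classic.
have oU : open U by exact: interval_open.
rewrite setTI (_ : f @^-1` U = (f @^-1` U `\ a) `|` (f @^-1` U `&` [set a])); last first.
  by rewrite setDE -setIUr setUC setUv setIT.
apply: measurableU.
  apply: open_measurable_rV; rewrite openE => x [Ux xa] /=.
  have xa' : x != a by apply/eqP.
  rewrite /interior; apply: filterI.
    by apply: cf => //; exact: open_nbhs_nbhs.
  apply/nbhs_ballP; exists `|x - a|; first by rewrite /= normr_gt0 subr_eq0.
  by move=> y; rewrite -ball_normE /= => + ya; rewrite ya ltxx.
have [Ua|Ua] := pselect (U (f a)).
  rewrite (_ : _ `&` _ = [set a]); first exact: measurable_set1_rV.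
  by apply/seteqP; split => [x []//|x ->].
rewrite (_ : _ `&` _ = set0)//; apply/seteqP; split => // x [Ux xa].
by move: Ux; rewrite xa.
Qed.

Lemma continuous_measurable_rV f : continuous f -> measurable_fun setT f.
Proof. by move=> cf; apply: (@continuous_neq_measurable_rV 0) => x _; exact: cf. Qed.

End borel_rV.

(** * Cubes and bounded functions supported in them *)

Section boxes.
Context {R : realType} {n : nat}.
Local Notation V := 'rV[R]_n.
Local Notation mu := (lebesgue_rV R n).

Definition cube (M : R) : set V := [set x | forall i, `|x 0 i| <= M].

Lemma measurable_cube M : measurable (cube M).
Proof.
apply: (measurable_forall_coord (P := fun _ => [set t | `|t| <= M])) => i.
rewrite (_ : mkset _ = `[- M, M]%classic); first exact: measurable_itv.
by apply/seteqP; split => t /=; rewrite in_itv/= ler_norml.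
Qed.

Lemma cube_measure M : 0 <= M -> mu (cube M) = ((2 * M) ^+ n)%:E.
Proof.
move=> M0; rewrite (_ : cube M =
    [set x | forall i, x 0 i \in `[(const_mx (- M) : V) 0 i, (const_mx M : V) 0 i]]).
  rewrite lebesgue_rV_box; last by move=> i; rewrite !mxE ge0_cp.
  congr EFin; under eq_bigr do rewrite !mxE opprK.
  by rewrite prodr_const card_ord mulrDl mul1r.
by apply/seteqP; split => x /= H i; have := H i; rewrite !mxE in_itv/= ler_norml.
Qed.

Lemma bounded_integrable (f : V -> R) (M C : R) : measurable_fun setT f ->
  (forall x, `|f x| <= C) -> (forall x, f x != 0 -> cube M x) ->
  mu.-integrable setT (EFin \o f).
Proof.
move=> mf fC fM.
have M0 : cube M `<=` cube `|M|.
  by move=> x H i; rewrite (le_trans (H i))// ler_norm.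
have : mu.-integrable (cube `|M|) (EFin \o f).
  apply: measurable_bounded_integrable; first exact: measurable_cube.
  - apply: (eq_ind_r (fun z => (z < +oo)%E) _ (cube_measure (normr_ge0 M))).
    exact: ltry.
  - exact: measurable_funS mf.
  - by exists C; split; rewrite ?num_real// => D CD x _ /=; rewrite (le_trans (fC x))// ltW.
move=> /(integrable_mkcond _ (measurable_cube _)).1.
congr (integrable _ _); apply/funext => x; rewrite /patch; case: ifPn => //=.
rewrite notin_setE => nx; have [->//|/fM/M0 xM] := eqVneq (f x) 0.
by case: (nx xM).
Qed.

End boxes.

(** * Splitting off the first coordinate in an integral *)

Section integral_cons.
Context {R : realType} (n : nat).
Local Notation mu := (lebesgue_rV R n).

Lemma integrable_cons (f : 'rV[R]_n.+1 -> R) :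
  (lebesgue_rV R n.+1).-integrable setT (EFin \o f) ->
  (@lebesgue_measure R \x mu)%E.-integrable setT (EFin \o (f \o @cons_rV R n)).
Proof.
move=> /integrableP[mf foo]; apply/integrableP; split.
  apply/measurable_EFinP; move/measurable_EFinP in mf.
  exact: (measurableT_comp mf (@measurable_cons_rV R n)).
apply: le_lt_trans foo; rewrite le_eqVlt; apply/orP; left; apply/eqP/esym.
rewrite (@eq_measure_integral _ _ _ _ (pushforward (@lebesgue_measure R \x mu)%E (@cons_rV R n)))//; first exact: measurable_cons_rV.
move=> mc.
rewrite ge0_integral_pushforward//.
exact: measurableT_comp.
Qed.

Lemma integral_cons (f : 'rV[R]_n.+1 -> R) :
  (lebesgue_rV R n.+1).-integrable setT (EFin \o f) ->
  (\int[lebesgue_rV R n.+1]_x (f x)%:E =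
   \int[(@lebesgue_measure R \x mu)]_z (f (cons_rV z))%:E)%E.
Proof.
move=> fi; rewrite (@eq_measure_integral _ _ _ _
  (pushforward (@lebesgue_measure R \x mu)%E (@cons_rV R n)))//; first exact: measurable_cons_rV.
move=> mc.
rewrite (@integral_pushforward _ _ _ _ _ _ _ _ _ (EFin \o f))//.
- exact: measurable_int fi.
- exact: integrable_cons.
Qed.

End integral_cons.

(** * A compactly supported partial derivative has zero integral *)

Section integral_derive.
Context {R : realType}.

Lemma rVDE n (x y : 'rV[R]_n) i : (x + y) 0 i = x 0 i + y 0 i.
Proof. exact: mxE. Qed.

Lemma rVZE n (a : R) (x : 'rV[R]_n) i : (a *: x) 0 i = a * x 0 i.
Proof. exact: mxE. Qed.

Lemma rVNE n (x : 'rV[R]_n) i : (- x) 0 i = - x 0 i.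
Proof. exact: mxE. Qed.

Lemma rV_deltaE n (j i : 'I_n) : (delta_mx 0 j : 'rV[R]_n) 0 i = (i == j)%:R.
Proof. by rewrite mxE eqxx. Qed.

Lemma cons_rV_dist n (p q : R * 'rV[R]_n) :
  `|cons_rV p - cons_rV q| <= Num.max `|p.1 - q.1| `|p.2 - q.2|.
Proof.
apply: rV_norm_le => [|i]; first by rewrite le_max normr_ge0.
rewrite ?(rVDE, rVZE, rVNE, rV_deltaE).
have [j ->|->] := unliftP 0 i.
  rewrite !cons_rVS le_max; apply/orP; right.
  by have := rV_coord_le_norm (p.2 - q.2) j; rewrite !mxE.
by rewrite !cons_rV0 le_max lexx.
Qed.

Lemma continuous_cons_rVl n (y : 'rV[R]_n) : continuous (fun t : R => cons_rV (t, y)).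
Proof.
move=> t; apply/cvgrPdist_lt => eps eps0.
apply: filterS (nbhsx_ballx t eps eps0) => u; rewrite -ball_normE /= => H.
by rewrite (le_lt_trans (cons_rV_dist _ _))//= subrr normr0 gt_max eps0 ?andbT.
Qed.

Lemma continuous_cons_rVr n (t : R) : continuous (fun y : 'rV[R]_n => cons_rV (t, y)).
Proof.
move=> y; have FF : Filter (nbhs y) by exact: nbhs_filter.
apply/(@cvgrPdist_lt _ _ _ (nbhs y)) => eps eps0.
apply: filterS (nbhsx_ballx y eps eps0) => u; rewrite -ball_normE /= => H.
by rewrite (le_lt_trans (cons_rV_dist _ _))//= subrr normr0 gt_max eps0 ?andbT.
Qed.

Lemma cons_rV_shift0 n (t : R) (y : 'rV[R]_n) :
  cons_rV (t, y) = t *: delta_mx 0 0 + cons_rV (0, y).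
Proof.
apply/rowP => i; rewrite ?(rVDE, rVZE, rVNE, rV_deltaE).
have [j ->|->] := unliftP 0 i; last by rewrite !cons_rV0 eqxx mulr1 addr0.
by rewrite !cons_rVS mulr0 add0r.
Qed.

Lemma cons_rV_shiftS n (t h : R) (y : 'rV[R]_n) (j : 'I_n) :
  cons_rV (t, h *: delta_mx 0 j + y) = h *: delta_mx 0 (lift 0 j) + cons_rV (t, y).
Proof.
apply/rowP => i; rewrite ?(rVDE, rVZE, rVNE, rV_deltaE).
have [k ->|->] := unliftP 0 i; last by rewrite !cons_rV0 mulr0 add0r.
by rewrite !cons_rVS rVDE rVZE rV_deltaE (inj_eq (@lift_inj _ _)).
Qed.

Lemma integral_derive1_eq0 (F G : R -> R) (A : R) : 0 < A ->
  (forall t : R, is_derive t 1 F (G t)) -> continuous G ->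
  (forall t, A <= `|t| -> F t = 0) -> (forall t, A <= `|t| -> G t = 0) ->
  (\int[@lebesgue_measure R]_t (G t)%:E = 0)%E.
Proof.
move=> A0 dF cG F0 G0.
have cF : continuous F.
  move=> t; have := dF t => ?.
  by apply/differentiable_continuous/derivable1_diffP; exact: ex_derive.
have -> : (\int[@lebesgue_measure R]_t (G t)%:E =
    \int[@lebesgue_measure R]_(t in `[(- A)%R, A]) (G t)%:E)%E.
  rewrite [RHS]integral_mkcond; apply: eq_integral => t _; rewrite /patch.
  case: ifPn => //; rewrite notin_setE /= in_itv/= => /negP; rewrite -ler_norml -ltNge => H.
  by rewrite G0// ltW.
rewrite (@continuous_FTC2 _ _ F).
- by rewrite !F0 ?normrN ?gtr0_norm// subee.
- by rewrite gtrN.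
- by apply: continuous_subspaceT.
- split; [by move=> t _; have := dF t => ?; exact: ex_derive| |].
    by apply: cvg_at_right_filter; exact: cF.
  by apply: cvg_at_left_filter; exact: cF.
- by move=> t _; have := dF t => ?; rewrite derive1E derive_val.
Qed.

(** Induction on the dimension by Fubini: if i is not the first coordinate, the slices at fixed
    first coordinate are covered by the induction; otherwise the first coordinate is integrated
    first, by the fundamental theorem of calculus. *)
Lemma integral_derive_eq0 n (f g : 'rV[R]_n -> R) (i : 'I_n) (M C : R) :
  (forall x, is_derive x (delta_mx 0 i) f (g x)) -> continuous g ->
  (forall x, `|g x| <= C) ->
  (forall x, f x != 0 -> cube M x) -> (forall x, g x != 0 -> cube M x) ->
  (\int[lebesgue_rV R n]_x (g x)%:E = 0)%E.
Proof.
elim: n f g i => [|n IH] f g i df cg gC f0 g0; first by case: i df => -[].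
have gi : (lebesgue_rV R n.+1).-integrable setT (EFin \o g).
  by apply: (bounded_integrable _ gC g0); exact: continuous_measurable_rV.
have gci := integrable_cons gi.
rewrite integral_cons//; have [j ij|i0] := unliftP 0 i.
  rewrite -(integral12_prod_meas1 gci); apply: integral0_eq => t _.
  apply: (IH (fun y => f (cons_rV (t, y))) (fun y => g (cons_rV (t, y))) j) => //.
  - move=> y; have := df (cons_rV (t, y)); rewrite ij => /is_derive_line H.
    apply/is_derive_line; rewrite (_ : (fun _ => _) =
      (fun h : R => f (h *: delta_mx 0 (lift 0 j) + cons_rV (t, y))))//.
    by apply/funext => h; rewrite cons_rV_shiftS.
  - move=> y; apply: continuous_comp; [exact: continuous_cons_rVr|exact: cg].
  - by move=> y /f0 H k; have := H (lift 0 k); rewrite cons_rVS.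
  - by move=> y /g0 H k; have := H (lift 0 k); rewrite cons_rVS.
rewrite -(integral21_prod_meas1 gci); apply: integral0_eq => y _.
(* A bound strictly above M, so that the functions already vanish where |t| equals it. *)
have M1 : M < `|M| + 1 by rewrite (le_lt_trans (ler_norm M))// ltrDl.
have H : continuous (fun t : R => g (cons_rV (t, y))).
  by move=> t; apply: continuous_comp; [exact: continuous_cons_rVl|exact: cg].
apply: (@integral_derive1_eq0 (fun t => f (cons_rV (t, y))) _ (`|M| + 1)).
- by rewrite ltr_wpDl.
- move=> t; have := df (cons_rV (t, y)); rewrite i0 cons_rV_shift0 => /is_derive_line_at H1.
  rewrite (_ : (fun _ => _) = (fun s : R => f (s *: delta_mx 0 0 + cons_rV (0, y)))).
    by move: H1; rewrite -[in X in is_derive _ _ _ X -> _]cons_rV_shift0.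
  by apply/funext => s; rewrite cons_rV_shift0.
- exact: H.
- move=> t tA; apply/eqP/contraT => /f0/(_ 0); rewrite cons_rV0/= leNgt.
  by rewrite (lt_le_trans M1 tA).
- move=> t tA; apply/eqP/contraT => /g0/(_ 0); rewrite cons_rV0/= leNgt.
  by rewrite (lt_le_trans M1 tA).
Qed.

End integral_derive.

(** * Integrability of |x|^(-p) (1 + s)^(-q) *)

Section kernel_integrability.
Context {R : realType} {N : nat}.
Local Notation V := 'rV[R]_N.
Local Notation mu := (lebesgue_rV R N).
Implicit Types (x : V).

(** f is at most the sum of the c_k times the indicators of the cubes, and the integrals c_k (2
    M_k)^N of these are dominated by a geometric series. This does the work of polar coordinates. *)
Lemma integrable_le_cubes (f : V -> R) (c M : nat -> R) (rho C : R) :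
  measurable_fun setT f -> (forall x, 0 <= f x) ->
  (forall k, 0 <= c k) -> (forall k, 0 <= M k) ->
  0 <= C -> 0 < rho < 1 -> (forall k, c k * (2 * M k) ^+ N <= C * rho ^+ k) ->
  (forall x, f x != 0 -> exists2 k, f x <= c k & cube (M k) x) ->
  mu.-integrable setT (EFin \o f).
Proof.
move=> mf f0 c0 M0 C0 /andP[rho0 rho1] cM fcM.
pose g (k : nat) x : \bar R := (c k * \1_(cube (M k)) x)%:E.
have mg k : measurable_fun setT (g k).
  apply/measurable_EFinP; apply: measurable_funM; first exact: measurable_cst.
  by apply: measurable_indic; exact: measurable_cube.
have g0 k x : (0 <= g k x)%E by rewrite lee_fin mulr_ge0// indicE.
have mEf : measurable_fun setT (EFin \o f) by exact/measurable_EFinP.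
apply/integrableP; split => //.
apply: (@le_lt_trans _ _ (\int[mu]_x (\sum_(k <oo) g k x))%E).
  apply: ge0_le_integral => //.
  - exact: measurableT_comp.
  - by apply: ge0_emeasurable_sum => // k x _; exact: g0.
  - move=> x _; rewrite /= ger0_norm//.
    have [->|/fcM[k fk xk]] := eqVneq (f x) 0; first exact: nneseries_ge0.
    apply: (@le_trans _ _ (\sum_(0 <= i < k.+1) g i x)%E); last first.
      by apply: nneseries_lim_ge => i *; exact: g0.
    rewrite big_nat_recr//= -[X in (X <= _)%E]add0e leeD//; first exact: sume_ge0.
    by rewrite lee_fin indicE mem_set// mulr1.
rewrite integral_nneseries//.
apply: (@le_lt_trans _ _ (C / (1 - rho))%:E); last exact: ltry.
apply: lime_le; first by apply: is_cvg_nneseries => k _ _; exact: integral_ge0.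
near=> n; apply: (@le_trans _ _ (series (geometric C rho) n)%:E); last first.
  by rewrite lee_fin geometric_le_lim// gtr0_norm.
rewrite /series/= -sumEFin; apply: lee_sum => k _.
rewrite /g; under eq_integral do rewrite EFinM.
rewrite ge0_integralZl_EFin//; last first.
  apply/measurable_EFinP/measurable_indic; exact: measurable_cube.
rewrite integral_indic ?setIT//; last exact: measurable_cube.
apply: (eq_ind_r (fun z => (_ * z <= _)%E) _ (cube_measure (M0 k))).
by rewrite lee_fin cM.
Unshelve. all: by end_near. Qed.

(** At the origin this is 1 if p = 0 and 0 otherwise, by the convention on powers of 0. Bounds by it
    with p > 0 thus hold at the origin for functions set to 0 there. *)
Definition kern (p q : R) x : R := enorm x `^ (- p) * (1 + sq x) `^ (- q).

Lemma continuous_enorm : continuous (@enorm R N).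
Proof.
move=> x; apply: (@continuous_comp _ _ _ (@sq R N) Num.sqrt).
  exact: continuous_sq.
exact: sqrt_continuous.
Qed.

Lemma measurable_kern p q : measurable_fun setT (kern p q).
Proof.
apply: measurable_funM.
  apply: (@measurableT_comp _ _ _ _ _ _ (fun t : R => t `^ (- p))) => //.
  by apply: continuous_measurable_rV; exact: continuous_enorm.
apply: (@measurableT_comp _ _ _ _ _ _ (fun t : R => t `^ (- q))) => //.
apply: measurable_funD => //.
by apply: continuous_measurable_rV; exact: continuous_sq.
Qed.

Lemma kern_ge0 p q x : 0 <= kern p q x.
Proof. by rewrite mulr_ge0// powR_ge0. Qed.

Lemma natural_scale (y : R) : 0 <= y -> exists k, k%:R <= y < k.+1%:R.
Proof.
by move=> y0; exists (Num.truncn y); rewrite truncn_le y0 truncnS_gt.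
Qed.

(** The condition p < N is for the origin and N < p + 2 q for infinity; the two sides of |x| = 1 are
    treated apart, each cut into shells with ratio e. *)
Lemma integrable_kern p q : 0 <= p -> p < N%:R -> 0 <= q -> N%:R < p + 2 * q ->
  mu.-integrable setT (EFin \o kern p q).
Proof.
move=> p0 pN q0 Nq.
pose O := [set x : V | 1 <= enorm x].
have mO : measurable O.
  rewrite -(setCK O); apply: measurableC; apply: open_measurable_rV.
  rewrite (_ : ~` O = (@enorm R N) @^-1` [set t | t < 1]).
    by apply: open_comp; [move=> x _; exact: continuous_enorm|exact: open_lt].
  by apply/seteqP; split => x /=; rewrite /O /= ltNge; [move/negP|move=> /negP].
pose f1 x := kern p q x * \1_O x.
pose f2 x := kern p q x * \1_(~` O) x.
have kE : EFin \o kern p q = ((EFin \o f1) \+ (EFin \o f2))%E.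
  apply/funext => x; rewrite /f1 /f2 /= -EFinD -mulrDr !indicE in_setC.
  by case: (x \in O); rewrite /= ?addr0 ?add0r mulr1.
have f10 x : 0 <= f1 x by rewrite mulr_ge0 ?kern_ge0// indicE.
have f20 x : 0 <= f2 x by rewrite mulr_ge0 ?kern_ge0// indicE.
have mf1 : measurable_fun setT f1.
  by apply: measurable_funM; [exact: measurable_kern|exact: measurable_indic].
have mf2 : measurable_fun setT f2.
  apply: measurable_funM; first exact: measurable_kern.
  by apply: measurable_indic; exact: measurableC.
rewrite kE; apply: integrableD => //.
(* On the shell e^k <= |x| < e^(k+1) the kernel is at most e^(-(p + 2q) k), since 1 + s >= |x|^2;
   against the volume (2 e^(k+1))^N the ratio is e^(N - (p + 2q)) < 1. *)
- apply: (@integrable_le_cubes f1 (fun k => expR (- (p + 2 * q) * k%:R))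
    (fun k => expR k.+1%:R) (expR (N%:R - (p + 2 * q))) ((2 * expR 1) ^+ N)) => //.
  + by rewrite expR_gt0 expR_lt1 subr_lt0.
  + move=> k; rewrite !exprMn -!expRM_natl mulrCA -mulrA ler_wpM2l//.
    by rewrite -!expRD ler_expR -[k.+1%:R]natr1; lra.
  + move=> x; rewrite /f1 indicE; case: (boolP (x \in O)) => [|_]; last first.
      by rewrite mulr0 eqxx.
    rewrite inE /O /= mulr1 => r1 _.
    have r0 : 0 < enorm x by exact: lt_le_trans r1.
    have [k /andP[ky yk]] := natural_scale (ln_ge0 r1).
    have rE : enorm x = expR (ln (enorm x)) by rewrite lnK// posrE.
    exists k; last first.
      by move=> i; rewrite (le_trans (coord_le_enorm _ _))// rE ler_expR ltW.
    apply: (@le_trans _ _ (enorm x `^ (- p) * (enorm x ^+ 2) `^ (- q))).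
      rewrite ler_wpM2l ?powR_ge0// !powRN lef_pV2 ?posrE ?powR_gt0//.
      + by rewrite ge0_ler_powR ?nnegrE ?sqr_ge0// ?addr_ge0// enorm_sqr lerDr.
      + by rewrite ltr_pwDl.
      + by rewrite exprn_gt0.
    rewrite {}rE -expRM_natl -!expRM -expRD ler_expR.
    have := ler_wpM2l (_ : 0 <= p + 2 * q) ky; rewrite addr_ge0 ?mulr_ge0// => /(_ isT).
    lra.
(* On the shell e^(-k-1) < |x| <= e^(-k) the kernel is at most e^(p (k+1)); against the volume (2
   e^(-k))^N the ratio is e^(p - N) < 1. *)
- apply: (@integrable_le_cubes f2 (fun k => expR (p * k.+1%:R))
    (fun k => expR (- k%:R)) (expR (p - N%:R)) (expR p * 2 ^+ N)) => //.
  + by rewrite expR_gt0 expR_lt1 subr_lt0.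
  + move=> k; rewrite !exprMn -!expRM_natl mulrCA [leRHS]mulrAC mulrC ler_wpM2r ?exprn_ge0//.
    by rewrite -!expRD ler_expR -[k.+1%:R]natr1; lra.
  + move=> x; rewrite /f2 indicE in_setC; case: (boolP (x \in O)) => [_|].
      by rewrite mulr0 eqxx.
    rewrite notin_setE /O /= mulr1 => /negP; rewrite -ltNge => r1 _.
    have qle : (1 + sq x) `^ (- q) <= 1.
      rewrite powRN invf_le1 ?powR_gt0 ?ltr_pwDl// -[leLHS](powRr0 (1 + sq x)).
      by rewrite ler_powR// lerDl.
    have [x0|x0] := eqVneq x 0.
      (* The origin goes into layer 0, where the kernel takes a value at most 1. *)
      exists 0; last by move=> i; rewrite x0 mxE normr0 expR_ge0.
      rewrite /kern x0 enorm0; apply: (@le_trans _ _ 1); last first.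
        by rewrite -expR0 ler_expR mulr_ge0.
      have [->|pn0] := eqVneq p 0; first by rewrite oppr0 powRr0 mul1r -x0.
      by rewrite powR0 ?oppr_eq0// mul0r.
    have r0 : 0 < enorm x by rewrite enorm_gt0.
    have y0 : 0 <= - ln (enorm x) by rewrite oppr_ge0 ln_le0// ltW.
    have [k /andP[ky yk]] := natural_scale y0.
    have rE : enorm x = expR (ln (enorm x)) by rewrite lnK// posrE.
    exists k; last first.
      move=> i; rewrite (le_trans (coord_le_enorm _ _))// rE ler_expR; lra.
    rewrite /kern (le_trans (ler_wpM2l (powR_ge0 _ _) qle))// mulr1.
    by rewrite rE -expRM ler_expR mulrN -mulNr mulrC ler_wpM2l// ltW.
Qed.

End kernel_integrability.

(** * Test functions and dominated convergence *)

Section test_functions.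
Context {R : realType} {N : nat}.
Local Notation V := 'rV[R]_N.
Local Notation mu := (lebesgue_rV R N).
Local Notation e i := (delta_mx 0 i : V).
Local Notation itg f := (mu.-integrable setT (EFin \o f)).
Implicit Types (f g phi : V -> R) (x : V).

Lemma itg_le f g : measurable_fun setT f -> (forall x, `|f x| <= g x) ->
  itg g -> itg f.
Proof.
move=> mf fg; apply: le_integrable => //; first exact/measurable_EFinP.
by move=> x _ /=; rewrite lee_fin (le_trans (fg x))// ler_norm.
Qed.

Lemma itg_measurable f : itg f -> measurable_fun setT f.
Proof. by move=> /measurable_int/measurable_EFinP. Qed.

Lemma itgD f g : itg f -> itg g -> itg (fun x => f x + g x).
Proof. by move=> fi gi; have := integrableD measurableT fi gi; apply: eq_integrable. Qed.

Lemma itgZ c f : itg f -> itg (fun x => c * f x).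
Proof. by move=> fi; have := integrableZl measurableT c fi; apply: eq_integrable. Qed.

Lemma itg0 : itg (fun _ => 0).
Proof. exact: integrable0. Qed.

Lemma itg_sum n (F : 'I_n -> V -> R) : (forall j, itg (F j)) ->
  itg (fun x => \sum_j F j x).
Proof.
move=> H; elim: n F H => [|n IH] F H.
  by rewrite (_ : (fun _ => _) = fun _ => 0)//; [exact: itg0|apply/funext => x; rewrite big_ord0].
rewrite (_ : (fun _ => _) = fun x => \sum_j F (widen_ord (leqnSn n) j) x + F ord_max x).
  by apply: itgD => //; exact: IH.
by apply/funext => x; rewrite big_ord_recr.
Qed.

Lemma Rintegral_sum n (F : 'I_n -> V -> R) : (forall j, itg (F j)) ->
  \int[mu]_x (\sum_j F j x) = \sum_j \int[mu]_x F j x.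
Proof.
move=> H; elim: n F H => [|n IH] F H.
  rewrite big_ord0; under eq_Rintegral => x _ do rewrite big_ord0.
  by rewrite Rintegral_cst// mul0r.
rewrite big_ord_recr/= -IH//.
rewrite -RintegralD//; last exact: itg_sum.
by apply: eq_Rintegral => x _; rewrite big_ord_recr.
Qed.

Lemma test_smooth phi : test_function phi -> smooth_on setT phi.
Proof. by case. Qed.

Lemma test_measurable phi : test_function phi -> measurable_fun setT phi.
Proof.
move=> [s _]; apply: continuous_measurable_rV => x.
exact: (smooth_on_continuous s).
Qed.

Lemma test_partial phi i : test_function phi -> test_function (partial i phi).
Proof.
move=> [s c]; split; first exact: smooth_on_partial.
apply: subclosed_compact c _; first exact: closed_closure.
rewrite [X in _ `<=` X](closure_id _).1; last exact: closed_closure.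
apply: closure_subset => x /= px; apply: contrapT => nx.
have oC : open (~` closure [set x | phi x != 0]).
  by apply: closed_openC; exact: closed_closure.
have H y : (~` closure [set x | phi x != 0]) y -> cst 0 y = phi y.
  move=> ny; apply/esym/eqP/contraT => py; exfalso; apply: ny.
  exact: subset_closure.
have [_ E] := eq_on_partial oC nx H (derivable_cst _ _ (e i)).
by move: px; rewrite E /partial derive_cst eqxx.
Qed.

Lemma test_cube phi : test_function phi ->
  exists M, forall x, phi x != 0 -> cube M x.
Proof.
move=> [_ /compact_bounded[M [_ HM]]]; exists (M + 1) => x px i.
rewrite (le_trans (rV_coord_le_norm _ _))// HM ?ltrDl//.
exact: subset_closure.
Qed.

Lemma test_bounded phi : test_function phi -> exists C, forall x, `|phi x| <= C.
Proof.
move=> [s c]; have cf : {within closure [set x | phi x != 0], continuous phi}.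
  by apply: continuous_subspaceT => x; exact: (smooth_on_continuous s).
have /compact_bounded[C [_ HC]] := continuous_compact cf c.
exists (`|C| + 1) => x; have [->|px] := eqVneq (phi x) 0.
  by rewrite normr0 addr_ge0.
apply: HC; first by rewrite (le_lt_trans (ler_norm C))// ltrDl.
by exists x => //; exact: subset_closure.
Qed.

Lemma test_itg phi : test_function phi -> itg phi.
Proof.
move=> tphi; have [M HM] := test_cube tphi; have [C HC] := test_bounded tphi.
exact: bounded_integrable (test_measurable tphi) HC HM.
Qed.

Lemma test_derive phi i x : test_function phi ->
  is_derive x (e i) phi (partial i phi x).
Proof. by move=> [s _]; exact: (smooth_on_derive i s). Qed.

Lemma integral_partial_test phi i : test_function phi ->
  \int[mu]_x partial i phi x = 0.
Proof.
move=> tphi; have [M HM] := test_cube tphi.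
have tp := test_partial i tphi.
have [M' HM'] := test_cube tp; have [C HC] := test_bounded tp.
have cubeW (a b : R) : a <= b -> cube a `<=` @cube R N b.
  by move=> ab x H j; exact: le_trans (H j) ab.
rewrite -[RHS]/(fine 0%E); congr fine.
apply: (@integral_derive_eq0 _ _ phi _ i (Num.max M M') C) => //.
- by move=> x; exact: test_derive.
- by move=> x; exact: (smooth_on_continuous (test_smooth tp)).
- by move=> x /HM; apply: cubeW; rewrite le_max lexx.
- by move=> x /HM'; apply: cubeW; rewrite le_max lexx orbT.
Qed.

Lemma sq_le_cube (M : R) x : cube M x -> sq x <= N%:R * M ^+ 2.
Proof.
move=> xM; rewrite sqE -[X in X%:R](card_ord N) mulr_natl -sumr_const.
by apply: ler_sum => i _; rewrite -real_normK ?num_real// ler_pXn2r// nnegrE (le_trans _ (xM i)).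
Qed.

(** (1 + s)^(-q) is bounded below on a cube carrying phi, so a test function inherits any decay
    rate. *)
Lemma test_le_kern phi (q : R) : 0 <= q -> test_function phi ->
  exists2 C, 0 <= C & forall x, `|phi x| <= C * kern 0 q x.
Proof.
move=> q0 tphi; have [M HM] := test_cube tphi; have [C HC] := test_bounded tphi.
have C0 : 0 <= C by exact: le_trans (HC 0).
pose D := (1 + N%:R * M ^+ 2) `^ q.
have S0 x : 0 < 1 + sq x by rewrite ltr_pwDl.
exists (C * D); first by rewrite mulr_ge0// powR_ge0.
move=> x; rewrite /kern oppr0 powRr0 mul1r.
have [->|/HM/sq_le_cube xM] := eqVneq (phi x) 0.
  by rewrite normr0 !mulr_ge0// powR_ge0.
rewrite (le_trans (HC x))// -mulrA ler_peMr// powRN ler_pdivlMr ?powR_gt0// mul1r.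
rewrite ge0_ler_powR// ?nnegrE ?lerD2l// ?ltW//.
by rewrite ltr_pwDl// (le_trans _ xM).
Qed.

(** The signs matter at the origin: for p' = -p != 0 the left side would be 0 there and the right
    side 1. *)
Lemma kernM (p q p' q' : R) x : 0 <= p -> 0 <= p' ->
  kern p q x * kern p' q' x = kern (p + p') (q + q') x.
Proof.
move=> p0 p'0; rewrite /kern mulrACA !opprD; congr (_ * _); last first.
  by rewrite powRD//; apply/implyP => _; rewrite gt_eqF// ltr_pwDl.
have [->|pn] := eqVneq p 0; first by rewrite oppr0 powRr0 mul1r add0r.
have [->|p'n] := eqVneq p' 0; first by rewrite oppr0 powRr0 mulr1 addr0.
have [r0|rn] := eqVneq (enorm x) 0; last by rewrite powRD// rn implybT.
rewrite r0 !powR0 ?mul0r// ?oppr_eq0// -opprD oppr_eq0 gt_eqF// addr_gt0// lt_neqAle eq_sym.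
  by rewrite pn.
by rewrite p'n.
Qed.

Lemma kernX (p q : R) (t : R) x : (kern p q x) `^ t = kern (p * t) (q * t) x.
Proof.
by rewrite /kern powRM ?powR_ge0// -!powRrM !mulNr.
Qed.

Lemma ae_neq0 : (0 < N)%N -> {ae mu, forall x : V, x != 0}.
Proof.
move=> N0; exists [set 0]; split; first exact: measurable_set1_rV.
  apply/eqP; rewrite eq_le measure_ge0 andbT.
  rewrite (_ : [set 0] = cube 0).
    by have := @cube_measure R N 0 (lexx _); rewrite mulr0 expr0n gtn_eqF// => ->.
  apply/seteqP; split => [x -> i|x H]; first by rewrite mxE normr0.
  by apply/rowP => i; apply/eqP; rewrite mxE -normr_le0; exact: H.
by move=> x /= /negP; rewrite negbK => /eqP.
Qed.

(** The pointwise limit is asked off the origin, a null set, because all cutoffs vanish at the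
    origin. *)
Lemma Rdominated_cvg (F : nat -> V -> R) f g : (0 < N)%N ->
  (forall k, measurable_fun setT (F k)) -> measurable_fun setT f -> itg g ->
  (forall k x, `|F k x| <= g x) ->
  (forall x, x != 0 -> F k x @[k --> \oo] --> f x) ->
  \int[mu]_x F k x @[k --> \oo] --> \int[mu]_x f x.
Proof.
move=> N0 mF mf ig Fg Ff.
have [|||||fi _ H] := @dominated_convergence _ _ _ mu setT measurableT
  (fun k => EFin \o F k) (EFin \o f) (EFin \o g).
- by move=> k; exact/measurable_EFinP.
- exact/measurable_EFinP.
- apply: filterS (ae_neq0 N0) => x x0 _ /=.
  by apply: cvg_EFin; [exact: nearW|exact: Ff].
- exact: ig.
- by apply: nearW => x k _; rewrite /= lee_fin; exact: Fg.
apply: fine_cvg; rewrite fineK; last exact: integrable_fin_num fi.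
exact: H.
Qed.

End test_functions.

(** * Removing the cutoffs in the limit; divergences off the origin *)

Lemma cvg_sum_ord {R : realType} n (a : 'I_n -> nat -> R) (l : 'I_n -> R) :
  (forall i, a i k @[k --> \oo] --> l i) ->
  \sum_i a i k @[k --> \oo] --> \sum_i l i.
Proof.
elim: n a l => [|n IH] a l H.
  by under eq_fun do rewrite big_ord0; rewrite big_ord0; exact: cvg_cst.
under eq_fun do rewrite big_ord_recr; rewrite big_ord_recr.
by apply: cvgD => //; exact: IH.
Qed.

Section cutoff_limits.
Context {R : realType} {N : nat} (N3 : (3 <= N)%N).
Local Notation V := 'rV[R]_N.
Local Notation mu := (lebesgue_rV R N).
Local Notation e i := (delta_mx 0 i : V).
Local Notation itg f := (mu.-integrable setT (EFin \o f)).
Local Notation punctured := [set x : V | x != 0].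
Local Notation c := ((N%:R - 2) / 2 : R).
Implicit Types (f g phi : V -> R) (x : V).

Let N0 : (0 < N)%N. Proof. exact: leq_trans N3. Qed.

Let N2 : 2 < N%:R :> R. Proof. by rewrite ltr_nat. Qed.

Lemma smooth_off0_measurable f : smooth_on punctured f -> measurable_fun setT f.
Proof.
move=> sf; apply: (@continuous_neq_measurable_rV _ _ 0) => x x0.
exact: (smooth_on_continuous sf).
Qed.

Lemma cutoff_measurable k : measurable_fun setT (@cutoff R N k).
Proof.
apply: continuous_measurable_rV => x.
exact: (smooth_on_continuous (smooth_cutoff k)).
Qed.

Lemma cutoffD_measurable k i : measurable_fun setT (@cutoffD R N k i).
Proof.
rewrite (_ : cutoffD k i = partial i (cutoff k)).
  apply: continuous_measurable_rV => x.
  exact: (smooth_on_continuous (smooth_on_partial i (smooth_cutoff k))).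
by apply/funext => x; rewrite (partialE (is_derive_cutoff k i x)).
Qed.

Lemma cutoff0 k : cutoff k (0 : V) = 0.
Proof.
by apply: cutoff_eq0; rewrite (_ : sq 0 = 0) ?invr_gt0 ?ltr0n//; apply/eqP; rewrite sq_eq0.
Qed.

Lemma cutoffD0 k i : cutoffD k i (0 : V) = 0.
Proof. by rewrite /cutoffD mxE mulr0 mul0r mulr0. Qed.

Lemma cutoffD_le k i x : `|cutoffD k i x| <= 10 * expR 1 * (enorm x)^-1.
Proof.
have [->|x0] := eqVneq x 0; first by rewrite cutoffD0 normr0 enorm0 invr0 mulr0.
by rewrite ler_pdivlMr ?enorm_gt0// mulrC cutoffD_bound.
Qed.

Lemma itg_cutoff k f : itg f -> itg (fun x => cutoff k x * f x).
Proof.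
move=> fi; apply: (@itg_le _ _ _ (fun x => expR 1 * `|f x|)).
- by apply: measurable_funM; [exact: cutoff_measurable|exact: itg_measurable].
- move=> x; have /andP[h0 h1] := cutoff_itv k x.
  by rewrite normrM ger0_norm// ler_wpM2r.
- by apply: itgZ; have := integrable_norm fi.
Qed.

Lemma cutoff_limit f : itg f ->
  \int[mu]_x (cutoff k x * f x) @[k --> \oo] --> \int[mu]_x f x.
Proof.
move=> fi; apply: (@Rdominated_cvg _ _ _ _ (fun x => expR 1 * `|f x|)) => //.
- by move=> k; apply: itg_measurable; exact: itg_cutoff.
- exact: itg_measurable.
- by apply: itgZ; have := integrable_norm fi.
- move=> k x; have /andP[h0 h1] := cutoff_itv k x.
  by rewrite normrM ger0_norm// ler_wpM2r.
- move=> x x0; rewrite -[X in _ --> X]mul1r.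
  by apply: cvgM; [exact: cutoff_cvg|exact: cvg_cst].
Qed.

Lemma itg_cutoffD k i f : measurable_fun setT f -> itg (fun x => (enorm x)^-1 * f x) ->
  itg (fun x => cutoffD k i x * f x).
Proof.
move=> mf fi; apply: (@itg_le _ _ _ (fun x => 10 * expR 1 * `|(enorm x)^-1 * f x|)).
- by apply: measurable_funM => //; exact: cutoffD_measurable.
- move=> x; rewrite normrM [X in _ <= _ * X]normrM normfV (ger0_norm (enorm_ge0 x)) [leRHS]mulrA.
  by rewrite ler_wpM2r// cutoffD_le.
- by apply: itgZ; have := integrable_norm fi.
Qed.

Lemma cutoffD_limit i f : measurable_fun setT f -> itg (fun x => (enorm x)^-1 * f x) ->
  \int[mu]_x (cutoffD k i x * f x) @[k --> \oo] --> (0 : R).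
Proof.
move=> mf fi; have -> : 0 = \int[mu]_x (cst 0 x) by rewrite Rintegral_cst// mul0r.
apply: (@Rdominated_cvg _ _ _ _ (fun x => 10 * expR 1 * `|(enorm x)^-1 * f x|)) => //.
- by move=> k; apply: itg_measurable; exact: itg_cutoffD.
- by apply: itgZ; have := integrable_norm fi.
- move=> k x; rewrite normrM [X in _ <= _ * X]normrM normfV (ger0_norm (enorm_ge0 x)) [leRHS]mulrA.
  by rewrite ler_wpM2r// cutoffD_le.
- move=> x x0; rewrite /cst/= -[X in _ --> X](mul0r (f x)).
  by apply: cvgM; [exact: cutoffD_cvg|exact: cvg_cst].
Qed.

Lemma partial_cutoff k f i x : smooth_on punctured f ->
  partial i (fun y => cutoff k y * f y) x =
  cutoffD k i x * f x + cutoff k x * partial i f x.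
Proof.
move=> sf; apply: partialE; have [->|x0] := eqVneq x 0.
  rewrite cutoff0 cutoffD0 !mul0r addr0.
  pose B := [set y : V | sq y < k.+1%:R^-1].
  have oB : open B.
    rewrite (_ : B = sq @^-1` [set t | t < k.+1%:R^-1])//.
    by apply: open_comp; [move=> y _; exact: continuous_sq|exact: open_lt].
  apply: (@is_derive_eq_on _ _ B (cst 0)) => //.
  - by rewrite /B/= (_ : sq 0 = 0) ?invr_gt0 ?ltr0n//; apply/eqP; rewrite sq_eq0.
  - by move=> y yB; rewrite cutoff_eq0 ?mul0r//; apply/orP; left.
have D1 := is_derive_cutoff k i x.
have D2 := smooth_on_derive i sf x0.
have D := is_deriveM D1 D2.
by apply: is_derive_eq; rewrite addrC -[X in X + _ = _]/(f x * _) mulrC.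
Qed.

(** The field [cutoff k * F] consists of test functions, so its divergence integrates to 0. As k
    grows, the term with the gradient of the cutoff disappears because that gradient is O(1/|x|) and
    F/|x| is integrable. *)
Lemma integral_divergence_eq0 (F : 'I_N -> V -> R) (D : V -> R) :
  (forall i, smooth_on punctured (F i)) ->
  (forall i, itg (fun x => (enorm x)^-1 * F i x)) -> itg D ->
  (forall x, x != 0 -> \sum_i partial i (F i) x = D x) ->
  \int[mu]_x D x = 0.
Proof.
move=> sF iF iD FD; have mF i := smooth_off0_measurable (sF i).
have H k : \sum_i \int[mu]_x (cutoffD k i x * F i x) + \int[mu]_x (cutoff k x * D x) = 0.
  rewrite -Rintegral_sum; last by move=> i; exact: itg_cutoffD.
  rewrite -RintegralD//; last 2 first.
  - by apply: itg_sum => i; exact: itg_cutoffD.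
  - exact: itg_cutoff.
  pose T i := partial i (fun y => cutoff k y * F i y).
  transitivity (\int[mu]_x \sum_i T i x).
    apply: eq_Rintegral => x _.
    under [RHS]eq_bigr => i _ do rewrite /T partial_cutoff//.
    rewrite big_split/= -mulr_sumr; congr (_ + _).
    have [->|/FD ->//] := eqVneq x 0; by rewrite cutoff0 !mul0r.
  have tF i : test_function (fun y => cutoff k y * F i y) by exact: cutoff_test_function.
  rewrite Rintegral_sum => [|i]; last by apply: test_itg; exact: test_partial.
  by rewrite big1// => i _; exact: integral_partial_test.
have L : \sum_i \int[mu]_x (cutoffD k i x * F i x) + \int[mu]_x (cutoff k x * D x)
    @[k --> \oo] --> \sum_(i < N) 0 + \int[mu]_x D x.
  apply: cvgD; last exact: cutoff_limit.
  apply: (@cvg_sum_ord _ _ (fun i k => \int[mu]_x (cutoffD k i x * F i x))) => i.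
  exact: cutoffD_limit.
move: L; under eq_fun do rewrite H; rewrite big1// add0r => L.
rewrite -(cvg_lim (@Rhausdorff R) L); apply: (cvg_lim (@Rhausdorff R)).
exact: cvg_cst.
Qed.

End cutoff_limits.

(** * Decaying solutions off the origin as weak solutions *)

Lemma cvg_eq_limit {R : realType} (a b : nat -> R) (l m : R) :
  a k @[k --> \oo] --> l -> b k @[k --> \oo] --> m -> (forall k, a k = b k) -> l = m.
Proof.
move=> al bm /funext ab; rewrite -(cvg_lim (@Rhausdorff R) al).
by rewrite -(cvg_lim (@Rhausdorff R) bm) ab.
Qed.

Section decaying_solutions.
Context {R : realType} {N : nat} (N3 : (3 <= N)%N).
Local Notation V := 'rV[R]_N.
Local Notation mu := (lebesgue_rV R N).
Local Notation e i := (delta_mx 0 i : V).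
Local Notation itg f := (mu.-integrable setT (EFin \o f)).
Local Notation punctured := [set x : V | x != 0].
Local Notation c := ((N%:R - 2) / 2 : R).
Local Notation p := (@sobolev_exponent R N).
Implicit Types (f g phi : V -> R) (x : V).

Let N0 : (0 < N)%N. Proof. exact: leq_trans N3. Qed.

Let N2 : 2 < N%:R :> R. Proof. by rewrite ltr_nat. Qed.

Lemma sobolev_exponent_gt1 : 1 < p.
Proof. by rewrite /sobolev_exponent ltr_pdivlMr ?subr_gt0//; have := N2; lra. Qed.

Lemma Lfun_measurable (r : R) f : f \in Lfun mu r%:E -> measurable_fun setT f.
Proof. by rewrite inE => /andP[/[!inE]]. Qed.

Lemma itg_Lfun (r : R) f : 1 <= r -> measurable_fun setT f ->
  itg (fun x => `|f x| `^ r) -> f \in Lfun mu r%:E.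
Proof.
move=> r1 mf /integrableP[_ fi]; rewrite inE; apply/andP; split; rewrite inE//=.
rewrite /finite_norm unlock/= poweR_lty//; apply: le_lt_trans fi.
rewrite le_eqVlt; apply/orP; left; apply/eqP; apply: eq_integral => x _ /=.
by rewrite [X in _ = X%:E]ger0_norm ?powR_ge0.
Qed.

(** Young's inequality bounds the product pointwise by an integrable function. *)
Lemma itg_young (r q : R) f g : 0 < r -> 0 < q -> r^-1 + q^-1 = 1 ->
  measurable_fun setT f -> measurable_fun setT g ->
  itg (fun x => `|f x| `^ r) -> itg (fun x => `|g x| `^ q) ->
  itg (fun x => f x * g x).
Proof.
move=> r0 q0 rq mf mg fi gi.
apply: (@itg_le _ _ _ (fun x => r^-1 * `|f x| `^ r + q^-1 * `|g x| `^ q)).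
- exact: measurable_funM.
- by move=> x; rewrite normrM (le_trans (conjugate_powR _ _ r0 q0 rq))// ![_^-1 * _]mulrC.
- by apply: itgD; exact: itgZ.
Qed.

(** The exponent conjugate to 2N/(N - 2) is 2N/(N + 2). The two inequalities say that the kernel to
    this power is integrable at the origin and at infinity. *)
Lemma itg_L2star_kern a b w : 0 <= a -> 0 <= b ->
  2 * a < N%:R + 2 -> N%:R + 2 < 2 * (a + 2 * b) ->
  w \in Lfun mu p%:E -> itg (fun x => w x * kern a b x).
Proof.
move=> a0 b0 aN Nab wp.
have NR0 : 0 < N%:R :> R by rewrite ltr0n.
have H1 : N%:R * (2 * a) < N%:R * (N%:R + 2) by rewrite ltr_pM2l.
have H2 : N%:R * (N%:R + 2) < N%:R * (2 * (a + 2 * b)) by rewrite ltr_pM2l.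
have q0 : 0 < 2 * N%:R / (N%:R + 2) :> R by rewrite divr_gt0 ?mulr_gt0 ?addr_gt0 ?ltr0n.
apply: (@itg_young p (2 * N%:R / (N%:R + 2))) => //.
- exact: lt_trans sobolev_exponent_gt1.
- rewrite /sobolev_exponent !invf_div -mulrDl (_ : _ + _ = 2 * N%:R); last by ring.
  by rewrite divff// mulf_neq0// pnatr_eq0 -lt0n.
- exact: Lfun_measurable wp.
- exact: measurable_kern.
- by apply: Lfun_integrable => //; exact/ltW/sobolev_exponent_gt1.
- rewrite (_ : (fun _ => _) = kern (a * (2 * N%:R / (N%:R + 2))) (b * (2 * N%:R / (N%:R + 2)))).
    apply: integrable_kern; rewrite ?mulr_ge0// ?(ltW q0)//.
      by rewrite mulrA ltr_pdivrMr ?addr_gt0 ?ltr0n//; lra.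
    by rewrite [ltRHS](_ : _ = (a + 2 * b) * (2 * N%:R) / (N%:R + 2)) ?ltr_pdivlMr ?addr_gt0 ?ltr0n//; [lra|ring].
  by apply/funext => x; rewrite ger0_norm ?kern_ge0// kernX.
Qed.

Lemma itg_L2_kern a b g : 0 <= a -> 0 <= b ->
  2 * a < N%:R -> N%:R < 2 * (a + 2 * b) ->
  g \in Lfun mu 2%:E -> itg (fun x => g x * kern a b x).
Proof.
move=> a0 b0 aN Nab g2; apply: (@itg_young 2 2) => //.
- by field.
- exact: Lfun_measurable g2.
- exact: measurable_kern.
- by apply: Lfun_integrable => //; rewrite ler1n.
- rewrite (_ : (fun _ => _) = kern (a * 2) (b * 2)).
    by apply: integrable_kern; rewrite ?mulr_ge0//; lra.
  by apply/funext => x; rewrite ger0_norm ?kern_ge0// kernX.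
Qed.

Lemma enorm_inv_kern x : (enorm x)^-1 = kern 1 0 x.
Proof. by rewrite /kern oppr0 powRr0 mulr1 powR_inv1. Qed.

Lemma norm_mul_kern (t a b : R) x : `|t * kern a b x| = `|t| * kern a b x.
Proof. by rewrite normrM (ger0_norm (kern_ge0 _ _ _)). Qed.

Lemma weight_kern x : weight x = N%:R * (N%:R + 2) * kern 0 2 x.
Proof.
rewrite /weight /kern oppr0 powRr0 mul1r enorm_sqr; congr (_ * _).
by rewrite -powR_invn// addr_ge0.
Qed.

Lemma measurable_weight : measurable_fun setT (@weight R N).
Proof.
rewrite (funext weight_kern).
by apply: measurable_funM => //; exact: measurable_kern.
Qed.

Lemma weight_mul_le v C x : `|v x| <= C * kern 0 c x ->
  `|weight x * v x| <= N%:R * (N%:R + 2) * C * kern 0 (2 + c) x.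
Proof.
move=> vC; rewrite weight_kern normrM; set K := N%:R * _.
have K0 : 0 <= K by rewrite mulr_ge0// addr_ge0.
have K1 := kern_ge0 0 2 x.
rewrite ger0_norm; last exact: mulr_ge0.
rewrite (_ : kern 0 (2 + c) x = kern 0 2 x * kern 0 c x); last by rewrite kernM// addr0.
by rewrite [leRHS](mulrACA K C); apply: ler_wpM2l => //; exact: mulr_ge0.
Qed.

(** A derivative at a singular origin is an uncontrolled default value. Replacing it by 0 changes a
    null set and makes the bounds by [kern 1 c] hold everywhere. *)
Definition off0 f x : R := if x == 0 then 0 else f x.

Lemma measurable_off0 f : measurable_fun setT f -> measurable_fun setT (off0 f).
Proof.
move=> mf; rewrite (_ : off0 f = fun x => f x * \1_(~` [set 0]) x).
  apply: measurable_funM => //; apply: measurable_indic; apply: measurableC.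
  exact: measurable_set1_rV.
apply/funext => x; rewrite /off0 indicE in_setC; case: eqVneq => [->|x0].
  by rewrite mem_set// mulr0.
by rewrite memNset ?mulr1//= => /eqP; exact/negP.
Qed.

(** The rate (1 + s)^(-c) is |x|^(2 - N) at infinity, that of the fundamental solution. The gradient
    may blow up like 1/|x| at the origin, which is square integrable there for N >= 3. *)
Definition decaying (v : V -> R) := smooth_on punctured v /\
  exists2 C, 0 <= C & (forall x, `|v x| <= C * kern 0 c x) /\
    forall i x, x != 0 -> `|partial i v x| <= C * kern 1 c x.

Definition decaying_solution lambda (v : V -> R) := decaying v /\
  forall x, x != 0 -> \sum_i partial i (partial i v) x = - (lambda * weight x * v x).

Lemma decaying_off0 v : decaying v -> exists2 C, 0 <= C &
  forall i x, `|off0 (partial i v) x| <= C * kern 1 c x.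
Proof.
move=> [_ [C C0 [_ HC]]]; exists C => // i x; rewrite /off0.
by case: eqVneq => [->|x0]; [rewrite normr0 mulr_ge0// kern_ge0|exact: HC].
Qed.

Lemma measurable_decaying v : decaying v -> measurable_fun setT v.
Proof. by move=> [sv _]; exact: smooth_off0_measurable. Qed.

Lemma measurable_off0_partial v i : decaying v -> measurable_fun setT (off0 (partial i v)).
Proof.
by move=> [sv _]; apply: measurable_off0; apply: smooth_off0_measurable; exact: smooth_on_partial.
Qed.

Lemma itg_mul_le f g h k C : measurable_fun setT f -> measurable_fun setT g ->
  (forall x, `|f x| <= C * h x) -> (forall x, `|g x| <= k x) ->
  itg (fun x => h x * k x) -> itg (fun x => f x * g x).
Proof.
move=> mf mg fh gk hk; apply: (@itg_le _ _ _ (fun x => C * (h x * k x))).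
- exact: measurable_funM.
- by move=> x; rewrite normrM mulrA ler_pM.
- exact: itgZ.
Qed.

Lemma decaying_Lfun v : decaying v -> v \in Lfun mu p%:E.
Proof.
move=> dv; have [_ [C C0 [HC _]]] := dv.
have p1 := sobolev_exponent_gt1; have p0 : 0 < p by exact: lt_trans p1.
apply: itg_Lfun; [exact: ltW|exact: measurable_decaying|].
apply: (@itg_le _ _ _ (fun x => C `^ p * kern 0 (c * p) x)).
- apply: (@measurableT_comp _ _ _ _ _ _ (fun t : R => t `^ p)) => //.
  by apply: measurableT_comp => //; exact: measurable_decaying.
- move=> x; rewrite ger0_norm ?powR_ge0//.
  rewrite (_ : kern 0 (c * p) x = kern 0 c x `^ p); last by rewrite kernX mul0r.
  rewrite -powRM ?kern_ge0//.
  apply: ge0_ler_powR; rewrite ?nnegrE//; [exact: ltW|].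
  by rewrite mulr_ge0 ?kern_ge0.
- apply: itgZ; apply: integrable_kern => //; first by rewrite ltr0n.
    by rewrite mulr_ge0 ?(ltW p0)// divr_ge0// subr_ge0 ltW.
  (* Since c times the Sobolev exponent is N, the condition at infinity reads N < 2 N. *)
  rewrite add0r /sobolev_exponent [ltRHS](_ : _ = N%:R * 2) ?ltr_pMr ?ltr0n ?ltr1n//.
  by field; rewrite subr_eq0 gt_eqF.
Qed.

Lemma decaying_gradient_Lfun v : decaying v ->
  (fun x => enorm (\row_i off0 (partial i v) x)) \in Lfun mu 2%:E.
Proof.
move=> dv; have [C C0 HC] := decaying_off0 dv.
have mG i := measurable_off0_partial i dv.
pose G x : V := \row_i off0 (partial i v) x.
have GE x : enorm (G x) ^+ 2 = \sum_i (off0 (partial i v) x) ^+ 2.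
  by rewrite enorm_sqr sqE; apply: eq_bigr => i _; rewrite mxE.
have mE : measurable_fun setT (fun x => enorm (G x)).
  rewrite (_ : (fun _ => _) = fun x => Num.sqrt (\sum_i (off0 (partial i v) x) ^+ 2)).
    apply: measurableT_comp.
      by apply: continuous_measurable_fun; exact: sqrt_continuous.
    by apply: measurable_sum => i; exact: measurable_funX.
  by apply/funext => x; rewrite -GE sqrtr_sqr ger0_norm.
apply: itg_Lfun => //; first by rewrite ler1n.
rewrite (_ : (fun _ => _) = fun x => \sum_i (off0 (partial i v) x) ^+ 2).
  apply: itg_sum => i; apply: (@itg_le _ _ _ (fun x => C ^+ 2 * kern 2 (N%:R - 2) x)).
  - exact: measurable_funX.
  - move=> x; rewrite normrX (_ : kern 2 _ x = kern 1 c x ^+ 2).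
      by rewrite -exprMn ler_pXn2r ?nnegrE ?HC// mulr_ge0 ?kern_ge0.
    by rewrite expr2 kernM//; congr kern; field.
  (* For this kernel the conditions at the origin and at infinity both amount to N > 2. *)
  - by apply: itgZ; apply: integrable_kern => //; have := N2; lra.
by apply/funext => x; rewrite ger0_norm// (powR_mulrn 2)// GE.
Qed.

Lemma partialM_off0 f g i x : smooth_on punctured f -> smooth_on punctured g ->
  x != 0 -> partial i (fun y => f y * g y) x = f x * partial i g x + g x * partial i f x.
Proof.
move=> sf sg x0; apply: partialE.
have D1 := smooth_on_derive i sf x0; have D2 := smooth_on_derive i sg x0.
exact: is_deriveM.
Qed.

Lemma smooth_onM (A : set V) f g : open A -> smooth_on A f -> smooth_on A g ->
  smooth_on A (fun x => f x * g x).
Proof. by move=> oA sf sg k; apply: Ck_onM. Qed.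

Lemma smooth_on_sub (A B : set V) f : A `<=` B -> smooth_on B f -> smooth_on A f.
Proof. by move=> AB sf k; apply: Ck_on_sub (sf k). Qed.

Lemma itg_test_kern phi f a b C : 0 <= a -> a < N%:R -> 0 <= b ->
  measurable_fun setT f -> (forall x, `|f x| <= C * kern a b x) ->
  test_function phi -> itg (fun x => f x * phi x).
Proof.
move=> a0 aN b0 mf fC tphi.
have [C' C'0 HC'] := test_le_kern (ler0n R N) tphi.
apply: (itg_mul_le mf (test_measurable tphi) fC HC').
rewrite (_ : (fun _ => _) = fun x => C' * kern a (b + N%:R) x); last first.
  by apply/funext => x; rewrite mulrCA kernM// addr0.
by apply: itgZ; apply: integrable_kern => //; [exact: addr_ge0|have := N2; lra].
Qed.

Let c0 : 0 <= c. Proof. by rewrite divr_ge0// subr_ge0 ltW. Qed.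

Lemma decaying_weak_gradient v : decaying v ->
  weak_gradient v (fun x => \row_i off0 (partial i v) x).
Proof.
move=> dv phi tphi i; have [sv [C C0 [HC HD]]] := dv.
have [B B0 HB] := decaying_off0 dv.
have tp := test_partial i tphi.
have mv := measurable_decaying dv.
have i1 : itg (fun x => v x * partial i phi x).
  by apply: (@itg_test_kern _ _ 0 c) HC tp => //; rewrite ltr0n.
have i2 : itg (fun x => off0 (partial i v) x * phi x).
  apply: (@itg_test_kern _ _ 1 c) (HB i) tphi => //; first by have := N2; lra.
  exact: measurable_off0_partial.
have sphi : smooth_on punctured phi by apply: smooth_on_sub (test_smooth tphi).
under [X in _ = - X]eq_Rintegral => x _ do rewrite mxE.
apply/eqP; rewrite -addr_eq0 -RintegralD//; apply/eqP.
(* The field v phi e_i, whose divergence is the sum of the two integrands. *)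
pose F (j : 'I_N) : V -> R := if j == i then (fun x => v x * phi x) else cst 0.
apply: (@integral_divergence_eq0 _ _ N3 F) => //.
- move=> j; rewrite /F; case: ifP => _; first by apply: smooth_onM => //; exact: open_neq0.
  by move=> k; apply: Ck_on_cst; exact: open_neq0.
- move=> j; rewrite /F; case: ifP => _; last first.
    by rewrite (_ : (fun _ => _) = fun _ => 0); [exact: itg0|apply/funext => x; rewrite mulr0].
  rewrite (_ : (fun _ => _) = fun x => (v x * (enorm x)^-1) * phi x); last first.
    by apply/funext => x; rewrite mulrCA mulrA.
  apply: (@itg_test_kern _ _ 1 c C) tphi => //; first by have := N2; lra.
    apply: measurable_funM => //; under eq_fun do rewrite enorm_inv_kern.
    exact: measurable_kern.
  move=> x; rewrite enorm_inv_kern normrM [X in _ * X]ger0_norm ?kern_ge0//.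
  rewrite (_ : kern 1 c x = kern 0 c x * kern 1 0 x); last by rewrite kernM// add0r addr0.
  by rewrite mulrA ler_wpM2r ?kern_ge0.
- exact: itgD.
- move=> x x0; rewrite (bigD1 i)//= big1 ?addr0; last first.
    by move=> j /negPf ji; rewrite /F ji; exact: derive_cst.
  rewrite /F eqxx partialM_off0// /off0 (negPf x0); congr (_ + _); exact: mulrC.
Qed.

Lemma decaying_weak_solution lambda v :
  decaying_solution lambda v -> weak_solution lambda v.
Proof.
move=> [dv vE]; have [sv [C C0 [HC HD]]] := dv.
have [B B0 HB] := decaying_off0 dv.
have mG i := measurable_off0_partial i dv.
have mv := measurable_decaying dv.
exists (fun x => \row_i off0 (partial i v) x).
  split; [exact: decaying_Lfun|exact: decaying_weak_gradient| |exact: decaying_gradient_Lfun].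
  by apply: measurable_fun_rV => i; under eq_fun do rewrite mxE; exact: mG.
move=> phi tphi.
have i1 j : itg (fun x => off0 (partial j v) x * partial j phi x).
  apply: (@itg_test_kern _ _ 1 c) (HB j) _ => //; first by have := N2; lra.
  exact: test_partial.
have mW := measurable_weight.
have i2 : itg (fun x => weight x * v x * phi x).
  apply: (@itg_test_kern _ _ 0 (2 + c) (N%:R * (N%:R + 2) * C)) tphi => //.
  - by rewrite ltr0n.
  - by rewrite addr_ge0.
  - exact: measurable_funM.
  - by move=> x; exact: weight_mul_le.
have sphi : smooth_on punctured phi by apply: smooth_on_sub (test_smooth tphi).
rewrite -RintegralZl//; apply/eqP; rewrite -subr_eq0 -RintegralB//; last 2 first.
- rewrite (_ : (fun _ => _) = fun x => \sum_j off0 (partial j v) x * partial j phi x).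
    exact: itg_sum.
  by apply/funext => x; apply: eq_bigr => j _; rewrite !mxE.
- exact: itgZ.
(* The field phi grad v: its divergence is grad v . grad phi plus phi times the Laplacian of v,
   which the equation rewrites. *)
apply/eqP; apply: (@integral_divergence_eq0 _ _ N3 (fun j x => partial j v x * phi x)).
- move=> j; apply: smooth_onM => //; first exact: open_neq0.
  exact: smooth_on_partial.
- move=> j; rewrite (_ : (fun _ => _) = fun x => ((enorm x)^-1 * off0 (partial j v) x) * phi x); last first.
    apply/funext => x; rewrite -mulrA /off0; case: eqVneq => // ->.
    by rewrite enorm0 invr0 !mul0r.
  apply: (@itg_test_kern _ _ 2 c B) tphi => //.
    by apply: measurable_funM => //; under eq_fun do rewrite enorm_inv_kern; exact: measurable_kern.
  move=> x; rewrite enorm_inv_kern normrM [X in X * _]ger0_norm ?kern_ge0//.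
  rewrite (_ : kern 2 c x = kern 1 0 x * kern 1 c x); last by rewrite kernM// add0r.
  by rewrite mulrCA ler_wpM2l ?kern_ge0.
- rewrite (_ : (EFin \o _) = EFin \o (fun x => \sum_j off0 (partial j v) x * partial j phi x
      + (- lambda) * (weight x * v x * phi x))).
    by apply: itgD; [exact: itg_sum|exact: itgZ].
  apply/funext => x /=; congr EFin; rewrite mulNr; congr (_ - _).
  by apply: eq_bigr => j _; rewrite !mxE.
- move=> x x0; rewrite (eq_bigr (fun j => partial j v x * partial j phi x
      + phi x * partial j (partial j v) x)); last first.
    by move=> j _; apply: partialM_off0 => //; exact: smooth_on_partial.
  rewrite big_split/= -mulr_sumr vE//; congr (_ + _); last by ring.
  by apply: eq_bigr => j _; rewrite !mxE /off0 (negPf x0).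
Qed.

Lemma itg_L2star_test w phi : w \in Lfun mu p%:E -> test_function phi ->
  itg (fun x => w x * phi x).
Proof.
move=> wp tphi; have [C C0 HC] := test_le_kern (ler0n R N) tphi.
have mw := Lfun_measurable wp; have mp := test_measurable tphi.
have k0 : itg (fun x => `|w x * kern 0 N%:R x|).
  have := integrable_norm (itg_L2star_kern (lexx 0) (ler0n R N) _ _ wp).
  by apply; have := N2; lra.
apply: (@itg_le _ _ _ (fun x => C * `|w x * kern 0 N%:R x|)); last exact: itgZ.
  exact: measurable_funM.
move=> x; rewrite norm_mul_kern [leRHS]mulrCA normrM.
by apply: ler_wpM2l.
Qed.

Lemma itg_weight_kern w (v : V -> R) (C : R) : w \in Lfun mu p%:E -> measurable_fun setT v ->
  (forall x, `|v x| <= C * kern 0 c x) -> itg (fun x => weight x * w x * v x).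
Proof.
move=> wp mv HC; have mw := Lfun_measurable wp.
have i0 : itg (fun x => `|w x * kern 0 (2 + c) x|).
  have := integrable_norm (itg_L2star_kern (lexx 0) (addr_ge0 (ler0n R 2) c0) _ _ wp).
  by apply; have := N2; lra.
apply: (@itg_le _ _ _ (fun x => N%:R * (N%:R + 2) * C * `|w x * kern 0 (2 + c) x|)); last exact: itgZ.
  by apply: measurable_funM => //; apply: measurable_funM => //; exact: measurable_weight.
move=> x; rewrite mulrAC normrM norm_mul_kern.
by rewrite [leRHS]mulrCA mulrC; apply: ler_wpM2l => //; exact: weight_mul_le.
Qed.

(* Test both the equation of [w] against [cutoff * v] and the definition of its
   weak gradient against [cutoff * grad v], and let the cutoffs tend to 1. *)
Lemma weak_solution_orthogonal lambda lambda' v w :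
  decaying_solution lambda v -> weak_solution lambda' w ->
  lambda' * \int[mu]_x (weight x * w x * v x) =
  lambda * \int[mu]_x (weight x * w x * v x).
Proof.
move=> [dv vE] [G [wp wG mG G2] wE]; have [sv [C C0 [HC HD]]] := dv.
have [B B0 HB] := decaying_off0 dv.
have mD i := measurable_off0_partial i dv.
have mv := measurable_decaying dv; have mw := Lfun_measurable wp.
have mGi i : measurable_fun setT (fun x => G x 0 i).
  exact: (measurableT_comp (measurable_coord i) mG).
have Gi2 i : (fun x => G x 0 i) \in Lfun mu 2%:E.
  apply: itg_Lfun => //; first by rewrite ler1n.
  apply: (@itg_le _ _ _ (fun x => `|enorm (G x)| `^ 2)).
  - apply: (@measurableT_comp _ _ _ _ _ _ (fun t : R => t `^ 2)) => //.
    exact: measurableT_comp.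
  - move=> x; rewrite ger0_norm ?powR_ge0// ge0_ler_powR ?nnegrE//.
    by rewrite (ger0_norm (enorm_ge0 _)) coord_le_enorm.
  - by apply: Lfun_integrable => //; rewrite ler1n.
have iG1 i : itg (fun x => `|G x 0 i * kern 1 c x|).
  have := integrable_norm (itg_L2_kern (ler01) c0 _ _ (Gi2 i)).
  by apply; have := N2; lra.
have iw2 : itg (fun x => `|w x * kern 2 c x|).
  have := integrable_norm (itg_L2star_kern (ler0n R 2) c0 _ _ wp).
  by apply; have := N2; lra.
have iWwv := itg_weight_kern wp mv HC.
have iGv i : itg (fun x => (enorm x)^-1 * (G x 0 i * v x)).
  apply: (@itg_le _ _ _ (fun x => C * `|G x 0 i * kern 1 c x|)); last exact: itgZ.
    apply: measurable_funM; last exact: measurable_funM.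
    by rewrite (funext enorm_inv_kern); exact: measurable_kern.
  move=> x; rewrite enorm_inv_kern norm_mul_kern mulrC norm_mul_kern normrM mulrC.
  rewrite (_ : kern 1 c x = kern 1 0 x * kern 0 c x); last by rewrite kernM// addr0 add0r.
  rewrite mulrCA [leRHS]mulrCA; apply: ler_wpM2l => //.
  by rewrite [leRHS]mulrCA; apply: ler_wpM2l => //; exact: kern_ge0.
have iGD i : itg (fun x => G x 0 i * off0 (partial i v) x).
  apply: (@itg_le _ _ _ (fun x => B * `|G x 0 i * kern 1 c x|)); last exact: itgZ.
    exact: measurable_funM.
  move=> x; rewrite norm_mul_kern normrM.
  by rewrite [leRHS]mulrCA; apply: ler_wpM2l.
have iwD i : itg (fun x => (enorm x)^-1 * (w x * off0 (partial i v) x)).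
  apply: (@itg_le _ _ _ (fun x => B * `|w x * kern 2 c x|)); last exact: itgZ.
    apply: measurable_funM; last exact: measurable_funM.
    by rewrite (funext enorm_inv_kern); exact: measurable_kern.
  move=> x; rewrite enorm_inv_kern norm_mul_kern mulrC norm_mul_kern normrM mulrC.
  rewrite (_ : kern 2 c x = kern 1 0 x * kern 1 c x); last by rewrite kernM// add0r.
  rewrite mulrCA [leRHS]mulrCA; apply: ler_wpM2l => //.
  by rewrite [leRHS]mulrCA; apply: ler_wpM2l => //; exact: kern_ge0.
pose I := \int[mu]_x (weight x * w x * v x).
pose J := \sum_i \int[mu]_x (G x 0 i * off0 (partial i v) x).
have cut_off0 k i x : cutoff k x * off0 (partial i v) x = cutoff k x * partial i v x.
  by rewrite /off0; case: eqVneq => // ->; rewrite cutoff0 !mul0r.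
have tcv k : test_function (fun x => cutoff k x * v x) by exact: cutoff_test_function.
have tcp k i : test_function (fun x => cutoff k x * partial i v x).
  by apply: cutoff_test_function; exact: smooth_on_partial.
have E1 k : \sum_i \int[mu]_x (cutoffD k i x * (G x 0 i * v x))
    + \sum_i \int[mu]_x (cutoff k x * (G x 0 i * off0 (partial i v) x)) =
    lambda' * \int[mu]_x (cutoff k x * (weight x * w x * v x)).
  have -> : \int[mu]_x (cutoff k x * (weight x * w x * v x)) =
      \int[mu]_x (weight x * w x * (cutoff k x * v x)).
    by apply: eq_Rintegral => x _; rewrite mulrCA.
  rewrite -(wE _ (tcv k)) -!Rintegral_sum; last 2 first.
  - by move=> i; exact: itg_cutoff.
  - by move=> i; apply: itg_cutoffD => //; exact: measurable_funM.
  rewrite -RintegralD//; last 2 first.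
  - by apply: itg_sum => i; apply: itg_cutoffD => //; exact: measurable_funM.
  - by apply: itg_sum => i; exact: itg_cutoff.
  apply: eq_Rintegral => x _; rewrite -big_split; apply: eq_bigr => i _ /=.
  by rewrite (mulrCA (cutoff k x)) cut_off0 [gradient _ _ _ _]mxE partial_cutoff//; ring.
have E2 k : \sum_i \int[mu]_x (cutoffD k i x * (w x * off0 (partial i v) x))
    + - lambda * \int[mu]_x (cutoff k x * (weight x * w x * v x)) =
    - \sum_i \int[mu]_x (cutoff k x * (G x 0 i * off0 (partial i v) x)).
  have wGi i : \int[mu]_x (cutoff k x * (G x 0 i * off0 (partial i v) x)) =
      - \int[mu]_x (w x * partial i (fun y => cutoff k y * partial i v y) x).
    rewrite (wG _ (tcp k i)) opprK; apply: eq_Rintegral => x _.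
    by rewrite mulrCA cut_off0.
  rewrite (eq_bigr _ (fun i _ => wGi i)) sumrN opprK -!Rintegral_sum; last 2 first.
  - by move=> i; apply: itg_L2star_test => //; exact: test_partial.
  - by move=> i; apply: itg_cutoffD => //; exact: measurable_funM.
  have ic : itg (fun x => cutoff k x * (weight x * w x * v x)) by exact: itg_cutoff.
  rewrite -RintegralZl// -RintegralD//; last 2 first.
  - by apply: itg_sum => i; apply: itg_cutoffD => //; exact: measurable_funM.
  - exact: itgZ.
  apply: eq_Rintegral => x _; have [->|x0] := eqVneq x 0.
    rewrite cutoff0 mul0r mulr0 addr0 !big1// => i _; last by rewrite cutoffD0 mul0r.
    by rewrite partial_cutoff; [rewrite cutoffD0 cutoff0 !mul0r addr0 mulr0|exact: smooth_on_partial].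
  transitivity (\sum_i (cutoffD k i x * (w x * off0 (partial i v) x) +
      cutoff k x * w x * partial i (partial i v) x)).
    by rewrite big_split/= -mulr_sumr vE//; congr (_ + _); ring.
  apply: eq_bigr => i _; rewrite partial_cutoff; last exact: smooth_on_partial.
  by rewrite /off0 (negPf x0); ring.
have LJ : \sum_i \int[mu]_x (cutoff k x * (G x 0 i * off0 (partial i v) x))
    @[k --> \oo] --> J.
  apply: (@cvg_sum_ord _ _ (fun i k => \int[mu]_x (cutoff k x * (G x 0 i * off0 (partial i v) x)))) => i.
  exact: cutoff_limit.
have LI : \int[mu]_x (cutoff k x * (weight x * w x * v x)) @[k --> \oo] --> I.
  exact: cutoff_limit.
have L0 (F : 'I_N -> V -> R) : (forall i, measurable_fun setT (F i)) ->
    (forall i, itg (fun x => (enorm x)^-1 * F i x)) ->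
    \sum_i \int[mu]_x (cutoffD k i x * F i x) @[k --> \oo] --> (0 : R).
  move=> mF iF; rewrite [X in _ --> X](_ : _ = \sum_(i < N) 0); last by rewrite big1.
  apply: (@cvg_sum_ord _ _ (fun i k => \int[mu]_x (cutoffD k i x * F i x))) => i.
  exact: cutoffD_limit.
have EJ : 0 + J = lambda' * I.
  apply: (cvg_eq_limit _ _ E1); first by apply: cvgD => //; apply: L0 => // i; exact: measurable_funM.
  by apply: cvgM => //; exact: cvg_cst.
have EJ2 : 0 + - lambda * I = - J.
  apply: (cvg_eq_limit _ _ E2); last exact: cvgN.
  apply: cvgD; first by apply: L0 => // i; exact: measurable_funM.
  by apply: cvgM => //; exact: cvg_cst.
by apply: oppr_inj; rewrite -EJ add0r -EJ2 add0r mulNr.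
Qed.

End decaying_solutions.

(** * Homogeneous and harmonic polynomials and their dimensions *)

Section homogeneous_polynomials.
Context {R : realType} {N : nat}.
Local Notation V := 'rV[R]_N.
Local Notation e i := (delta_mx 0 i : V).
Implicit Types (f g P Q : V -> R) (x : V).

(** Only the first k variables may occur, for the sake of a dimension count by induction on k. The
    zero form is given every degree, so that each degree is a vector space. *)
Inductive homog (k : nat) : nat -> (V -> R) -> Prop :=
| homog_cst c : homog k 0 (cst c)
| homog_0 d : homog k d (cst 0)
| homog_X d (i : 'I_N) f : (i < k)%N -> homog k d f -> homog k d.+1 (fun x => x 0 i * f x)
| homog_D d f g : homog k d f -> homog k d g -> homog k d (fun x => f x + g x).

Lemma homogZ k d c f : homog k d f -> homog k d (fun x => c * f x).
Proof.
elim=> [a|{}d|{}d i {}f ik _ IH|{}d {}f g _ IHf _ IHg].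
- exact: (homog_cst k (c * a)).
- by rewrite (_ : (fun _ => _) = cst 0); [exact: homog_0|apply/funext => x; rewrite mulr0].
- rewrite (_ : (fun _ => _) = fun x => x 0 i * (c * f x)); first exact: homog_X.
  by apply/funext => x; rewrite mulrCA.
- rewrite (_ : (fun _ => _) = fun x => c * f x + c * g x); first exact: homog_D.
  by apply/funext => x; rewrite mulrDr.
Qed.

Lemma homog_sum k d n (F : 'I_n -> V -> R) :
  (forall j, homog k d (F j)) -> homog k d (fun x => \sum_j F j x).
Proof.
elim: n F => [|n IH] F hF.
  by rewrite (_ : (fun _ => _) = cst 0); [exact: homog_0|apply/funext => x; rewrite big_ord0].
rewrite (_ : (fun _ => _) = fun x => \sum_j F (widen_ord (leqnSn n) j) x + F ord_max x).
  by apply: homog_D => //; exact: IH.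
by apply/funext => x; rewrite big_ord_recr.
Qed.

Lemma homogM k d d' f g : homog k d f -> homog k d' g ->
  homog k (d + d') (fun x => f x * g x).
Proof.
move=> hf hg; elim: hf => [c|{}d|{}d i {}f ik _ IH|{}d {}f f' _ IH _ IH'].
- by rewrite add0n; exact: homogZ.
- by rewrite (_ : (fun _ => _) = cst 0); [exact: homog_0|apply/funext => x; rewrite mul0r].
- rewrite (_ : (fun _ => _) = fun x => x 0 i * (f x * g x)); first exact: homog_X.
  by apply/funext => x; rewrite mulrA.
- rewrite (_ : (fun _ => _) = fun x => f x * g x + f' x * g x); first exact: homog_D.
  by apply/funext => x; rewrite mulrDl.
Qed.

Lemma homog_le k k' d f : (k <= k')%N -> homog k d f -> homog k' d f.
Proof.
move=> kk; elim=> [c|{}d|{}d i {}f ik _ IH|{}d {}f g _ IHf _ IHg].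
- exact: homog_cst.
- exact: homog_0.
- by apply: homog_X => //; exact: leq_trans kk.
- exact: homog_D.
Qed.

Lemma homog_scale k d f (t : R) x : homog k d f -> f (t *: x) = t ^+ d * f x.
Proof.
elim=> [c|{}d|{}d i {}f ik _ IH|{}d {}f g _ IHf _ IHg].
- by rewrite expr0 mul1r.
- by rewrite mulr0.
- by rewrite mxE IH exprS; ring.
- by rewrite IHf IHg mulrDr.
Qed.

Lemma smooth_homog k d f (A : set V) : open A -> homog k d f -> smooth_on A f.
Proof.
move=> oA; elim=> [c|{}d|{}d i {}f ik _ IH|{}d {}f g _ IHf _ IHg] m.
- exact: Ck_on_cst.
- exact: Ck_on_cst.
- by apply: Ck_onM => //; exact: Ck_on_coord.
- exact: Ck_onD.
Qed.

Lemma partial_coordM f i j : smooth_on setT f ->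
  partial i (fun x : V => x 0 j * f x) = fun x => x 0 j * partial i f x + (j == i)%:R * f x.
Proof.
move=> sf; apply/funext => x; apply: partialE.
have D1 := is_derive_coord x (e i) j.
have D2 := smooth_on_derive i sf (I : setT x).
have D := is_deriveM D1 D2.
by apply: is_derive_eq; rewrite mxE eqxx/= -![_ *: _]/(_ * _) [f x * _]mulrC.
Qed.

Lemma partialD f g i : smooth_on setT f -> smooth_on setT g ->
  partial i (fun x : V => f x + g x) = fun x => partial i f x + partial i g x.
Proof.
move=> sf sg; apply/funext => x; apply: partialE.
have D1 := smooth_on_derive i sf (I : setT x).
have D2 := smooth_on_derive i sg (I : setT x).
exact: is_deriveD.
Qed.

Lemma partialZ f i c : smooth_on setT f ->
  partial i (fun x : V => c * f x) = fun x => c * partial i f x.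
Proof.
move=> sf; apply/funext => x; apply: partialE.
have D1 := smooth_on_derive i sf (I : setT x).
exact: is_deriveZ.
Qed.

Lemma partial_cst i (c : R) : partial i (cst c : V -> R) = cst 0.
Proof. by apply/funext => x; exact: derive_cst. Qed.

Lemma homog_partial k d f i : homog k d f ->
  if d is d'.+1 then homog k d' (partial i f) else partial i f = cst 0.
Proof.
elim=> [c|{}d|{}d j {}f jk hf IH|{}d {}f g hf IHf hg IHg].
- exact: partial_cst.
- by rewrite partial_cst; case: d => [//|d]; exact: homog_0.
- have sf := smooth_homog openT hf; rewrite partial_coordM//.
  case: d hf IH => [|d] hf IH; last first.
    by apply: homog_D; [exact: homog_X|exact: homogZ].
  rewrite (_ : (fun _ => _) = fun x => (j == i)%:R * f x); first exact: homogZ.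
  by apply/funext => x; rewrite IH mulr0 add0r.
- have sf := smooth_homog openT hf; have sg := smooth_homog openT hg.
  rewrite partialD//; case: d hf hg IHf IHg => [|d] hf hg IHf IHg; last exact: homog_D.
  by apply/funext => x; rewrite IHf IHg addr0.
Qed.

Definition laplace f x : R := \sum_i partial i (partial i f) x.

Lemma homog_laplace k d f : homog k d.+2 f -> homog k d (laplace f).
Proof.
move=> hf; apply: homog_sum => i.
by have := homog_partial i (homog_partial i hf).
Qed.

Lemma laplace_low k d f : (d < 2)%N -> homog k d f -> laplace f = cst 0.
Proof.
move=> d2 hf; apply/funext => x; rewrite /laplace big1// => i _.
have := homog_partial i hf; case: d d2 hf => [|[|//]] _ hf.
  by move=> ->; rewrite partial_cst.
by move=> /(homog_partial i) ->.
Qed.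

Lemma euler_homog k d f x : homog k d f -> \sum_i x 0 i * partial i f x = d%:R * f x.
Proof.
elim=> [c|{}d|{}d j {}f jk hf IH|{}d {}f g hf IHf hg IHg].
- by rewrite mul0r big1// => i _; rewrite partial_cst mulr0.
- by rewrite mulr0 big1// => i _; rewrite partial_cst mulr0.
- have sf := smooth_homog openT hf.
  under eq_bigr => i _ do rewrite partial_coordM// mulrDr mulrCA.
  rewrite big_split/= -mulr_sumr IH (bigD1 j)//= eqxx mul1r big1 ?addr0.
    by rewrite -natr1; ring.
  by move=> i /negPf ij; rewrite eq_sym ij mul0r mulr0.
- have sf := smooth_homog openT hf; have sg := smooth_homog openT hg.
  under eq_bigr => i _ do rewrite partialD// mulrDr.
  by rewrite big_split/= IHf IHg mulrDr.
Qed.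

Lemma laplaceD f g : smooth_on setT f -> smooth_on setT g ->
  laplace (fun x => f x + g x) = fun x => laplace f x + laplace g x.
Proof.
move=> sf sg; apply/funext => x; rewrite /laplace -big_split; apply: eq_bigr => i _.
by rewrite partialD// partialD//; exact: smooth_on_partial.
Qed.

Lemma laplaceZ f c : smooth_on setT f ->
  laplace (fun x => c * f x) = fun x => c * laplace f x.
Proof.
move=> sf; apply/funext => x; rewrite /laplace mulr_sumr; apply: eq_bigr => i _.
by rewrite partialZ// partialZ//; exact: smooth_on_partial.
Qed.

Lemma partial_sum (A : set V) m (c : 'I_m -> R) (v : 'I_m -> V -> R) i x :
  (forall j, smooth_on A (v j)) -> A x ->
  is_derive x (e i) (fun y => \sum_j c j * v j y) (\sum_j c j * partial i (v j) x).
Proof.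
move=> sv Ax; rewrite (_ : (fun _ => _) = \sum_j (c j \*: v j)).
  by apply: is_derive_sum => j; apply: is_deriveZ; exact: (smooth_on_derive i (sv j)).
by apply/funext => z; rewrite fct_sumE.
Qed.

Lemma laplace_sum m (c : 'I_m -> R) (v : 'I_m -> V -> R) :
  (forall j, smooth_on setT (v j)) ->
  laplace (fun x => \sum_j c j * v j x) = fun x => \sum_j c j * laplace (v j) x.
Proof.
move=> sv; apply/funext => x; rewrite /laplace.
transitivity (\sum_i \sum_j c j * partial i (partial i (v j)) x).
  apply: eq_bigr => i _.
  have -> : partial i (fun y => \sum_j c j * v j y) = fun y => \sum_j c j * partial i (v j) y.
    by apply/funext => y; exact: (partialE (partial_sum c i sv I)).
  exact: (partialE (partial_sum c i (fun j => smooth_on_partial i (sv j)) I)).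
by rewrite exchange_big; apply: eq_bigr => j _; rewrite mulr_sumr.
Qed.

Lemma radial_derive (A : set V) (K K1 : R -> R) f i x : A x -> smooth_on A f ->
  is_derive (sq x) 1 K (K1 (sq x)) ->
  is_derive x (e i) (fun y => K (sq y) * f y)
    (2 * x 0 i * K1 (sq x) * f x + K (sq x) * partial i f x).
Proof.
move=> Ax sf dK; have D1 := is_derive_comp (is_derive_sq x i) dK.
have D2 := smooth_on_derive i sf Ax.
have D := is_deriveM D1 D2.
by apply: is_derive_eq; rewrite addrC -![_ *: _]/(_ * _) /=; ring.
Qed.

Lemma radial_sum (a p q : 'I_N -> R) (k2 k1 k0 t d : R) :
  \sum_i a i * p i = d * t ->
  \sum_i (4 * a i ^+ 2 * k2 * t + 2 * k1 * t + 4 * k1 * (a i * p i) + k0 * q i) =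
  (4 * (\sum_i a i ^+ 2) * k2 + (2 * N%:R + 4 * d) * k1) * t + k0 * \sum_i q i.
Proof.
move=> ap; rewrite !big_split/=.
have -> : \sum_i 4 * a i ^+ 2 * k2 * t = 4 * (\sum_i a i ^+ 2) * k2 * t.
  by rewrite mulr_sumr !mulr_suml.
have -> : \sum_(i < N) 2 * k1 * t = N%:R * (2 * k1 * t).
  by rewrite sumr_const card_ord [RHS]mulr_natl.
rewrite -!mulr_sumr ap; move: (\sum_i q i) (\sum_i _) => L s; ring.
Qed.

(** In the variable s, a radial factor K on a function of Euler degree d contributes 4 s K'' + (2 N
    + 4 d) K'. This reduces the eigenvalue equation to an ordinary one; A is the whole space for
    polynomials and the punctured space for spherical harmonics. *)
Lemma radial_laplace (A : set V) (K K1 K2 : R -> R) f (d : R) x : open A -> A x ->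
  smooth_on A f ->
  (forall y, A y -> is_derive (sq y) 1 K (K1 (sq y))) ->
  (forall y, A y -> is_derive (sq y) 1 K1 (K2 (sq y))) ->
  \sum_i x 0 i * partial i f x = d * f x ->
  laplace (fun y => K (sq y) * f y) x =
  (4 * sq x * K2 (sq x) + (2 * N%:R + 4 * d) * K1 (sq x)) * f x
  + K (sq x) * laplace f x.
Proof.
move=> oA Ax sf dK dK1 euler; rewrite /laplace.
have D i : partial i (partial i (fun y => K (sq y) * f y)) x =
    4 * x 0 i ^+ 2 * K2 (sq x) * f x + 2 * K1 (sq x) * f x +
    4 * K1 (sq x) * (x 0 i * partial i f x) + K (sq x) * partial i (partial i f) x.
  apply: partialE.
  apply: (@is_derive_eq_on _ _ A (fun y => K1 (sq y) * ((2 * y 0 i) * f y) + K (sq y) * partial i f y)) => //.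
    move=> y Ay; rewrite (partialE (radial_derive i Ay sf (dK y Ay))).
    by congr (_ + _); ring.
  have sg : smooth_on A (fun y : V => (2 * y 0 i) * f y).
    move=> k; apply: Ck_onM => //; apply: Ck_onM => //; first exact: Ck_on_cst.
    exact: Ck_on_coord.
  have Dg : partial i (fun y : V => (2 * y 0 i) * f y) x = 2 * f x + 2 * x 0 i * partial i f x.
    apply: partialE; have D1 := is_derive_coord x (e i) i.
    have D2 := smooth_on_derive i sf Ax.
    have D3 := is_deriveM (is_deriveZ 2 D1) D2.
    by apply: is_derive_eq; rewrite mxE !eqxx/= -![_ *: _]/(_ * _); ring.
  have D1 := radial_derive i Ax sg (dK1 x Ax).
  have D2 := radial_derive i Ax (smooth_on_partial i sf) (dK x Ax).
  have D3 := is_deriveD D1 D2.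
  by apply: is_derive_eq; rewrite Dg; ring.
transitivity (\sum_i (4 * x 0 i ^+ 2 * K2 (sq x) * f x + 2 * K1 (sq x) * f x +
    4 * K1 (sq x) * (x 0 i * partial i f x) + K (sq x) * partial i (partial i f) x)).
  by apply: eq_bigr => i _; exact: D.
by rewrite (radial_sum _ _ _ _ euler) sqE.
Qed.

Lemma laplace_sqM k d f : homog k d f ->
  laplace (fun x => sq x * f x) = fun x => sq x * laplace f x + (2 * N%:R + 4 * d%:R) * f x.
Proof.
move=> hf; apply/funext => x.
rewrite (@radial_laplace setT id (cst 1) (cst 0) f d%:R) //.
- by rewrite /cst mulr0 add0r mulr1 addrC.
- exact: openT.
- exact: smooth_homog openT hf.
- exact: euler_homog hf.
Qed.

Lemma homog_sq : homog N 2 sq.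
Proof.
rewrite (_ : sq = fun x => \sum_i (x 0 i * (x 0 i * 1))); last first.
  by apply/funext => x; rewrite sqE; apply: eq_bigr => i _; rewrite mulr1 expr2.
have h i : homog N 2 (fun x => x 0 i * (x 0 i * 1)).
  by apply: homog_X => //; apply: homog_X => //; exact: homog_cst.
exact: homog_sum.
Qed.

(* On forms of degree d, [sq * laplace + gamma] is inverted by the same operator
   on forms of degree d - 2, with gamma replaced by a larger number. *)
Lemma laplace_sqM_surj d (gamma : R) f : (0 < N)%N -> 0 < gamma -> homog N d f ->
  exists2 Q, homog N d Q & forall x, sq x * laplace Q x + gamma * Q x = f x.
Proof.
move=> N0; elim/ltn_ind: d gamma f => -[|[|d]] IH gamma f g0 hf.
- exists (fun x => gamma^-1 * f x); first exact: homogZ.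
  move=> x; rewrite (laplace_low _ (homogZ gamma^-1 hf))// mulr0 add0r mulrA.
  by rewrite mulfV ?gt_eqF// mul1r.
- exists (fun x => gamma^-1 * f x); first exact: homogZ.
  move=> x; rewrite (laplace_low _ (homogZ gamma^-1 hf))// mulr0 add0r mulrA.
  by rewrite mulfV ?gt_eqF// mul1r.
have g'0 : 0 < 2 * N%:R + 4 * d%:R + gamma.
  by rewrite ltr_wpDl// addr_ge0// mulr_ge0.
have [] := IH d _ _ _ g'0 (homog_laplace hf); first by rewrite ltnS.
move=> Q' hQ' EQ'; have hs : homog N d.+2 (fun x => sq x * Q' x).
  exact: (homogM (homog_sq) hQ').
exists (fun x => gamma^-1 * (f x + (-1) * (sq x * Q' x))).
  by apply: homogZ; apply: homog_D => //; exact: homogZ.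
move=> x; have sf := smooth_homog openT hf; have ss := smooth_homog openT hs.
have s1 : smooth_on setT (fun x => (-1) * (sq x * Q' x)).
  exact: smooth_homog openT (homogZ (-1) hs).
have s2 : smooth_on setT (fun x => f x + (-1) * (sq x * Q' x)).
  by apply: (@smooth_homog N d.+2) => //; [exact: openT|apply: homog_D => //; exact: homogZ].
rewrite laplaceZ// laplaceD// laplaceZ// (laplace_sqM hQ') -EQ'.
move: (laplace Q' x) (Q' x) (f x) (sq x) => l q r s; field; exact: lt0r_neq0.
Qed.

Definition harmonic h f := homog N h f /\ laplace f = cst 0.

Lemma harmonic_sum h m (c : 'I_m -> R) (v : 'I_m -> V -> R) :
  (forall j, harmonic h (v j)) -> harmonic h (fun x => \sum_j c j * v j x).
Proof.
move=> hv; split; first by apply: homog_sum => j; apply: homogZ; case: (hv j).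
rewrite laplace_sum => [|j]; last by apply: smooth_homog (hv j).1; exact: openT.
by apply/funext => x; rewrite big1// => j _; rewrite (hv j).2 mulr0.
Qed.

(** Phrased as an induction principle for an additive predicate T, which spares an explicit indexed
    sum. No closure of T under scaling is asked, since scalars are absorbed into the harmonic
    forms. *)
Lemma harmonic_decomposition d f : (0 < N)%N -> homog N d f ->
  forall T : (V -> R) -> Prop,
  (forall f g, T f -> T g -> T (fun x => f x + g x)) ->
  (forall j h H, harmonic h H -> (2 * j + h)%N = d -> T (fun x => sq x ^+ j * H x)) ->
  T f.
Proof.
move=> N0; elim/ltn_ind: d f => d IH f hf T TD TH.
have [d2|] := ltnP d 2.
  rewrite (_ : f = fun x => sq x ^+ 0 * f x); last by apply/funext => x; rewrite mul1r.
  by apply: (TH 0 d) => //; split => //; exact: laplace_low hf.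
case: d hf IH TH => [|[|d]]// hf IH TH _.
(* This is the constant of [laplace_sqM], so that Q satisfies laplace (sq Q) = laplace f and f - sq
   Q is harmonic. *)
have g0 : 0 < 2 * N%:R + 4 * d%:R :> R by rewrite ltr_wpDr ?mulr_ge0 ?mulr_gt0// ltr0n.
have [Q hQ EQ] := laplace_sqM_surj N0 g0 (homog_laplace hf).
have hs : homog N d.+2 (fun x => sq x * Q x) by exact: (homogM (homog_sq) hQ).
have sf := smooth_homog openT hf; have ss := smooth_homog openT hs.
have s1 := smooth_homog openT (homogZ (-1) hs).
pose H x := f x + (-1) * (sq x * Q x).
rewrite (_ : f = fun x => sq x ^+ 0 * H x + sq x * Q x); last first.
  by apply/funext => x; rewrite /H expr0 mul1r mulN1r subrK.
apply: (TD _ _).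
  apply: (TH 0 d.+2) => //; split; first by apply: homog_D => //; exact: homogZ.
  apply/funext => x; rewrite /H laplaceD// laplaceZ// (laplace_sqM hQ) EQ /cst; ring.
(* The induction on Q runs with T precomposed with multiplication by [sq]. *)
apply: (IH d _ _ hQ (fun g => T (fun x => sq x * g x))); first by rewrite ltnS.
  move=> a b Ta Tb; rewrite (_ : (fun _ => _) = fun x => sq x * a x + sq x * b x).
    exact: TD.
  by apply/funext => x; rewrite mulrDr.
move=> j h K hK jh; rewrite (_ : (fun _ => _) = fun x => sq x ^+ j.+1 * K x).
  by apply: (TH j.+1 h) => //; lia.
by apply/funext => x; rewrite exprS mulrA.
Qed.

Lemma laplace_onto d f : (0 < N)%N -> homog N d f ->
  exists2 Q, homog N d.+2 Q & laplace Q = f.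
Proof.
move=> N0 hf; have g0 : 0 < 2 * N%:R + 4 * d%:R :> R.
  by rewrite ltr_wpDr ?mulr_ge0 ?mulr_gt0// ltr0n.
have [Q hQ EQ] := laplace_sqM_surj N0 g0 hf.
exists (fun x => sq x * Q x); first exact: (homogM (homog_sq) hQ).
by rewrite (laplace_sqM hQ); apply/funext => x; exact: EQ.
Qed.

Lemma homog_coord_eq k d f (x y : V) : homog k d f ->
  (forall i : 'I_N, (i < k)%N -> x 0 i = y 0 i) -> f x = f y.
Proof.
move=> + H; elim=> [//|//|{}d i {}f ik _ IH|{}d {}f g _ IHf _ IHg].
  by rewrite (H _ ik) IH.
by rewrite IHf IHg.
Qed.

Lemma homog_split (k : nat) d (k' : 'I_N) f : k = k' :> nat -> homog k.+1 d.+1 f ->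
  exists u w, [/\ homog k d.+1 u, homog k.+1 d w & f = fun x => u x + x 0 k' * w x].
Proof.
(* An induction on [homog] passes through all degrees, so degree 0 gets a statement of its own. *)
move=> kk'; have H d' : homog k.+1 d' f -> (if d' is d''.+1 then
    exists u w, [/\ homog k d''.+1 u, homog k.+1 d'' w & f = fun x => u x + x 0 k' * w x]
    else homog k 0 f).
  elim=> [c|d0|{}d' i {}f ik hf IH|d0 {}f g _ IHf _ IHg].
  - exact: homog_cst.
  - case: d0 => [|d0]; first exact: homog_0.
    exists (cst 0), (cst 0); split; [exact: homog_0|exact: homog_0|].
    by apply/funext => x; rewrite mulr0 addr0.
  - move: ik; rewrite ltnS leq_eqVlt => /orP[/eqP ik|ik].
      exists (cst 0), f; split; [exact: homog_0|by []|].
      apply/funext => x; rewrite add0r; congr (x 0 _ * _).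
      by apply/val_inj => /=; rewrite ik -kk'.
    case: d' hf IH => [|d'] hf IH.
      exists (fun x => x 0 i * f x), (cst 0); split; [exact: homog_X|exact: homog_0|].
      by apply/funext => x; rewrite mulr0 addr0.
    have [u [w [hu hw ->]]] := IH.
    exists (fun x => x 0 i * u x), (fun x => x 0 i * w x); split.
    + exact: homog_X.
    + by apply: homog_X => //; exact: ltnW.
    + by apply/funext => x; ring.
  - case: d0 IHf IHg => [|d0] IHf IHg; first exact: homog_D.
    have [u [w [hu hw ->]]] := IHf; have [u' [w' [hu' hw' ->]]] := IHg.
    exists (fun x => u x + u' x), (fun x => w x + w' x); split; [exact: homog_D|exact: homog_D|].
    by apply/funext => x; ring.
exact: H.
Qed.

Definition has_dim (W : (V -> R) -> Prop) (m : nat) := exists b : 'I_m -> V -> R,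
  [/\ forall j, W (b j),
      forall c : 'I_m -> R, (forall x, \sum_j c j * b j x = 0) -> forall j, c j = 0
    & forall f, W f -> exists c : 'I_m -> R, forall x, f x = \sum_j c j * b j x].

(** Forms in k + 1 variables are, in a unique way, a form in k variables plus the last variable
    times a form of one degree less: this is Pascal's rule. *)
Lemma has_dim_homog_split (k : nat) d (k' : 'I_N) m m' : k = k' :> nat ->
  has_dim (homog k d.+1) m -> has_dim (homog k.+1 d) m' ->
  has_dim (homog k.+1 d.+1) (m + m').
Proof.
move=> kk' [b [hb ib sb]] [b' [hb' ib' sb']].
pose B (j : 'I_(m + m')) := match fintype.split j with
  | inl j1 => b j1 | inr j2 => fun x => x 0 k' * b' j2 x end.
have BE c x : \sum_j c j * B j x = \sum_j c (lshift m' j) * b j x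
    + x 0 k' * \sum_j c (rshift m j) * b' j x.
  rewrite big_split_ord/= mulr_sumr; congr (_ + _); apply: eq_bigr => j _; rewrite /B.
    by case: split_ordP => j' /eqP; rewrite ?eq_lrshift// (inj_eq (@lshift_inj _ _)) => /eqP ->.
  by case: split_ordP => j' /eqP; rewrite ?eq_rlshift// (inj_eq (@rshift_inj _ _)) => /eqP ->; ring.
exists B; split.
- move=> j; rewrite /B; case: fintype.split => j'.
    exact: (homog_le (leqnSn k)).
  by apply: homog_X => //; rewrite -kk'.
- move=> c H.
  pose u x := \sum_j c (lshift m' j) * b j x.
  pose w x := \sum_j c (rshift m j) * b' j x.
  have hw : homog k.+1 d w by apply: homog_sum => j; exact: homogZ.
  have hu : homog k d.+1 u by apply: homog_sum => j; exact: homogZ.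
  have uw x : u x + x 0 k' * w x = 0 by rewrite -BE.
  have u0 x : u x = 0.
    (* Setting the last variable to 0 removes the second term and leaves u unchanged. *)
    pose y : V := \row_i (if i == k' then 0 else x 0 i).
    have := uw y; rewrite mxE eqxx mul0r addr0 => <-.
    apply: (homog_coord_eq hu) => i ik; rewrite mxE ifF//.
    by apply/eqP => iE; move: ik; rewrite kk' iE ltnn.
  have xw x : x 0 k' * w x = 0 by rewrite -[LHS]add0r -(u0 x) uw.
  have w0 x : w x = 0.
    have [x0|x0] := eqVneq (x 0 k') 0; last first.
      by have /eqP := xw x; rewrite mulf_eq0 (negPf x0) => /eqP.
    (* Where the last variable vanishes, w is recovered as the derivative of its product with that
       variable. *)
    have := congr1 (fun h => h x) (partial_coordM k' k' (smooth_homog openT hw)).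
    rewrite /= x0 mul0r add0r eqxx mul1r => <-.
    by rewrite (_ : (fun _ => _) = cst 0) ?partial_cst//; apply/funext => z; rewrite xw.
  by move=> j; case: (split_ordP j) => j' ->; [exact: (ib (fun j => c (lshift m' j)))|exact: (ib' (fun j => c (rshift m j)))].
- move=> f /(homog_split kk')[u [w [hu hw ->]]].
  have [c cE] := sb _ hu; have [c' cE'] := sb' _ hw.
  exists (fun j => match fintype.split j with inl j1 => c j1 | inr j2 => c' j2 end) => x.
  rewrite BE cE cE'; congr (_ + _ * _); apply: eq_bigr => j _.
    by case: split_ordP => j' /eqP; rewrite ?eq_lrshift// (inj_eq (@lshift_inj _ _)) => /eqP ->.
  by case: split_ordP => j' /eqP; rewrite ?eq_rlshift// (inj_eq (@rshift_inj _ _)) => /eqP ->.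
Qed.

Lemma homog_deg0 k f : homog k 0 f -> f = cst (f 0).
Proof.
have H d : homog k d f -> d = 0 -> f = cst (f 0).
  elim=> [//|//|//|{}d {}f g _ IHf _ IHg d0].
  by apply/funext => x; rewrite (IHf d0) (IHg d0).
by move=> /H; exact.
Qed.

Lemma has_dim_homog k d : (k <= N)%N ->
  has_dim (homog k d) (if k is k'.+1 then 'C(k' + d, d) else (d == 0)).
Proof.
elim: k d => [|k IHk] d kN.
  case: d => [|d] /=; last first.
    exists (fun _ => cst 0); split => [[]//|c _ []//|f hf]; exists (fun _ => 0) => x.
    suff -> : f = cst 0 by rewrite big_ord0.
    have H d' g : homog 0 d' g -> d' = d.+1 -> g = cst 0.
      elim=> [//|//|//|d0 {}g g' _ IHf _ IHg d'd].
      by rewrite (IHf d'd) (IHg d'd); apply/funext => y; exact: addr0.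
    exact: H hf (erefl _).
  exists (fun _ => cst 1); split => [j|c H j|f /homog_deg0 ->].
  - exact: homog_cst.
  - by have := H 0; rewrite big_ord1 mulr1 (ord1 j).
  - by exists (fun _ => f 0) => x; rewrite big_ord1 mulr1.
elim: d => [|d IHd].
  rewrite addn0 bin0; exists (fun _ => cst 1); split => [j|c H j|f /homog_deg0 ->].
  - exact: homog_cst.
  - by have := H 0; rewrite big_ord1 mulr1 (ord1 j).
  - by exists (fun _ => f 0) => x; rewrite big_ord1 mulr1.
have := has_dim_homog_split (erefl : k = Ordinal kN) (IHk d.+1 (ltnW kN)) IHd.
congr has_dim; case: k {IHk IHd} kN => [|k] _; first by rewrite !add0n !binn.
by rewrite addSnnS addSn binS.
Qed.

(* Rank-nullity, the Laplacian being onto. *)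
Lemma has_dim_harmonic h m m' : (0 < N)%N ->
  has_dim (homog N h.+2) m -> has_dim (homog N h) m' ->
  (m' <= m)%N /\ has_dim (harmonic h.+2) (m - m').
Proof.
move=> N0 [b [hb ib sb]] [b' [hb' ib' sb']].
have smb j : smooth_on setT (b j) by exact: smooth_homog openT (hb j).
have /choice[a aE] : forall j, exists c : 'I_m' -> R,
    forall x, laplace (b j) x = \sum_l c l * b' l x.
  by move=> j; exact: sb' (homog_laplace (hb j)).
pose A : 'M[R]_(m, m') := \matrix_(j, l) a j l.
have lapA (c : 'rV[R]_m) x : laplace (fun x => \sum_j c 0 j * b j x) x =
    \sum_l (c *m A) 0 l * b' l x.
  rewrite laplace_sum//; under eq_bigr => j _ do rewrite aE mulr_sumr.
  rewrite exchange_big; apply: eq_bigr => l _; rewrite mxE mulr_suml.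
  by apply: eq_bigr => j _; rewrite mxE mulrA.
have fullA : row_full A.
  rewrite -sub1mx; apply/row_subP => l.
  have [Q hQ lQ] := laplace_onto N0 (hb' l); have [c cE] := sb _ hQ.
  apply/submxP; exists (\row_j c j); apply/rowP => k; rewrite row1.
  have QE : Q = fun x => \sum_j (\row_j c j) 0 j * b j x.
    by apply/funext => x; rewrite cE; apply: eq_bigr => j _; rewrite mxE.
  have := ib' (fun k => (delta_mx 0 l : 'rV[R]_m') 0 k - (\row_j c j *m A) 0 k).
  move=> /(_ _ k) H; apply/eqP; rewrite -subr_eq0; apply/eqP/H => x.
  under eq_bigr => k' _ do rewrite mulrBl.
  rewrite sumrB -lapA -QE lQ (bigD1 l)//= mxE !eqxx mul1r big1 ?addr0 ?subrr//.
  by move=> k' /negPf kl; rewrite mxE eqxx/= kl mul0r.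
have rA : \rank A = m' by apply/eqP.
have rk : \rank (kermx A) = (m - m')%N by rewrite mxrank_ker rA.
split; first by rewrite -rA rank_leq_row.
pose K := row_base (kermx A).
rewrite -rk; exists (fun r x => \sum_j K r j * b j x); split.
- move=> r; have KA : row r K *m A = 0.
    apply/eqP; rewrite -sub_kermx; apply: (submx_trans (row_sub _ _)).
    by rewrite eq_row_base.
  split; first by apply: homog_sum => j; exact: homogZ.
  rewrite (_ : (fun _ => _) = fun x => \sum_j (row r K) 0 j * b j x); last first.
    by apply/funext => x; apply: eq_bigr => j _; rewrite [row _ _ _ _]mxE.
  apply/funext => x; apply: (etrans (lapA _ _)); rewrite KA big1// => l _.
  by rewrite mxE mul0r.
- move=> c H; have cK : (\row_r c r) *m K = 0.
    apply/rowP => j; rewrite [RHS]mxE; apply: (ib (fun j => (\row_r c r *m K) 0 j)) => x.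
    rewrite -[RHS](H x); under eq_bigr => i _ do rewrite [(_ *m _) _ _]mxE mulr_suml.
    rewrite exchange_big; apply: eq_bigr => r _; rewrite mulr_sumr.
    by apply: eq_bigr => i _; rewrite [(\row_r c r) _ _]mxE mulrA.
  have c0 : \row_r c r = 0.
    by apply: (row_free_inj (row_base_free (kermx A))); rewrite cK mul0mx.
  by move=> r; have := congr1 (fun M : 'rV_(\rank (kermx A)) => M 0 r) c0; rewrite !mxE.
- move=> f [hf lf]; have [c cE] := sb _ hf.
  have fE : f = fun x => \sum_j (\row_j c j) 0 j * b j x.
    by apply/funext => x; rewrite cE; apply: eq_bigr => j _; rewrite mxE.
  have cA : (\row_j c j) *m A = 0.
    apply/rowP => l; rewrite [RHS]mxE; apply: (ib' (fun l => (\row_j c j *m A) 0 l)) => x.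
    by rewrite -lapA -fE lf.
  have /submxP[D DE] : (\row_j c j <= K)%MS.
    by rewrite eq_row_base sub_kermx cA.
  exists (fun r => D 0 r) => x; rewrite fE DE.
  under eq_bigr => j _ do rewrite [(_ *m _) _ _]mxE mulr_suml.
  rewrite exchange_big; apply: eq_bigr => r _; rewrite mulr_sumr.
  by apply: eq_bigr => j _; rewrite mulrA.
Qed.

End homogeneous_polynomials.

(** * Jacobi polynomials in homogenized form and their equation *)

Section jacobi_polynomials.
Context {R : realType}.
Implicit Types (a b t : R) (p : {poly R}).

Lemma gbinom0 b : gbinom b 0 = 1.
Proof. by rewrite /gbinom big_ord0 fact0 divr1. Qed.

Lemma gbinomS b i : gbinom b i.+1 * i.+1%:R = gbinom b i * (b - i%:R).
Proof.
rewrite /gbinom big_ord_recr/= factS natrM invfM.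
have h1 : i.+1%:R != 0 :> R by rewrite pnatr_eq0.
have h2 : i`!%:R != 0 :> R by rewrite pnatr_eq0 -lt0n fact_gt0.
by rewrite mulrACA; move: (\prod_(_ < _) _) => P; field; rewrite nat1r h1 h2.
Qed.

Lemma gbinom_gt0 b i : i%:R < b + 1 -> 0 < gbinom b i.
Proof.
move=> ib; rewrite /gbinom divr_gt0 ?ltr0n ?fact_gt0//.
apply: prodr_gt0 => j _; rewrite subr_gt0.
have : j.+1%:R <= i%:R :> R by rewrite ler_nat.
rewrite -natr1; lra.
Qed.

(* [jac m b] is P_m^(a,a), a = b - m, homogenized at xi = (1 - t) / (1 + t). *)
Definition jac (m : nat) b : {poly R} :=
  \poly_(i < m.+1) ((-1) ^+ i * (gbinom b i * gbinom b (m - i))).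

Lemma jac_coef m b i : (i <= m)%N ->
  (jac m b)`_i = (-1) ^+ i * (gbinom b i * gbinom b (m - i)).
Proof. by move=> im; rewrite coef_poly ltnS im. Qed.

Lemma jac_coef0 m b i : (m < i)%N -> (jac m b)`_i = 0.
Proof. by move=> mi; rewrite coef_poly ltnS leqNgt mi. Qed.

Lemma size_jac m b : (size (jac m b) <= m.+1)%N.
Proof. exact: size_poly. Qed.

Lemma jac_rec m b i : (jac m b)`_i.+1 * (i.+1%:R * (b - m%:R + 1 + i%:R)) =
  - ((b - i%:R) * (m%:R - i%:R)) * (jac m b)`_i.
Proof.
have [im|mi|<-] := ltngtP i m; last 2 first.
- by rewrite !jac_coef0// ?mul0r ?mulr0//; exact: ltnW.
- by rewrite jac_coef0// subrr mulr0 oppr0 !mul0r.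
rewrite !jac_coef ?(ltnW im)// -[in gbinom b (m - i)](subnSK im).
have := gbinomS b i; have := gbinomS b (m - i.+1).
rewrite exprS subnSK// natrB ?natrB// ?(ltnW im)//.
rewrite -[i.+1%:R]natr1.
move: (gbinom b i.+1) (gbinom b i) (gbinom b (m - i)) (gbinom b (m - i.+1)) => G1 G0 H1 H0 E1 E2.
rewrite (_ : -1 * (-1) ^+ i * (G1 * H0) * _ =
  - (-1) ^+ i * (G1 * (i%:R + 1)) * (H0 * (b - (m%:R - (i%:R + 1))))); last by ring.
rewrite E2 -E1; ring.
Qed.

(** The coefficient of t^i is the two-term recursion [jac_rec]. This is the hypergeometric equation
    of 2F1(-m, -b; b - m + 1; -t). *)
Lemma jac_ode m b t :
  t * (1 + t) * (jac m b)^`()^`().[t]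
  + ((b - m%:R + 1) + (1 - m%:R - b) * t) * (jac m b)^`().[t]
  + b * m%:R * (jac m b).[t] = 0.
Proof.
set p := jac m b.
have E : 'X * p^`()^`() + 'X^2 * p^`()^`() + (b - m%:R + 1) *: p^`()
    + (1 - m%:R - b) *: ('X * p^`()) + (b * m%:R) *: p = 0.
  apply/polyP => i; rewrite !coefD !coefZ coef0.
  have C1 : ('X * p^`()^`())`_i = i.+1%:R * i%:R * p`_i.+1.
    rewrite coefXM; case: i => [|i] /=; first by rewrite mulr0 mul0r.
    rewrite !coef_deriv -[LHS]mulr_natr -[X in X * _]mulr_natr.
    by rewrite [RHS]mulrC mulrA.
  have C2 : ('X^2 * p^`()^`())`_i = i%:R * (i%:R - 1) * p`_i.
    rewrite coefXnM; case: i C1 => [|[|i]] _ /=; [by rewrite !mul0r|by rewrite subrr mulr0 mul0r|].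
    rewrite !subSS subn0 !coef_deriv -[LHS]mulr_natr -[X in X * _]mulr_natr.
    by rewrite -[i.+2%:R]natr1 addrK; ring.
  have C3 : p^`()`_i = i.+1%:R * p`_i.+1 by rewrite coef_deriv mulr_natl.
  have C4 : ('X * p^`())`_i = i%:R * p`_i.
    by rewrite coefXM; case: i {C1 C2 C3} => [|i] /=; [rewrite mul0r|rewrite coef_deriv mulr_natl].
  rewrite C1 C2 C3 C4; have := jac_rec m b i; rewrite -/p -[i.+1%:R]natr1 => J.
  transitivity (p`_i.+1 * ((i%:R + 1) * (b - m%:R + 1 + i%:R)) + (b - i%:R) * (m%:R - i%:R) * p`_i).
    by ring.
  by rewrite J; ring.
have := congr1 (horner^~ t) E; rewrite !(hornerD, hornerZ, hornerM, hornerX, hornerXn) horner0.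
by move=> H; rewrite -[RHS]H; ring.
Qed.

Lemma jac_jacobi m b t : 0 <= t ->
  jacobi m (b - m%:R) (b - m%:R) ((1 - t) / (1 + t)) = (1 + t) ^- m * (jac m b).[t].
Proof.
move=> t0; have t1 : 1 + t != 0 by rewrite gt_eqF// ltr_pwDl.
(* [jac] is indexed by the exponent of (xi - 1)/2 = -t/(1 + t), [jacobi] by that of (xi + 1)/2 =
   1/(1 + t), so the sum is reversed. *)
rewrite /jacobi addrC subrK /jac horner_poly mulr_sumr (reindex_inj rev_ord_inj)/=.
apply: eq_bigr => i _; rewrite subSS.
have im : (i <= m)%N by rewrite -ltnS.
rewrite subKn//.
rewrite (_ : (_ - 1) / 2 = - t / (1 + t)); last by field.
rewrite (_ : (_ + 1) / 2 = (1 + t)^-1); last by field.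
have -> : (1 + t) ^- m = (1 + t)^-1 ^+ i * (1 + t)^-1 ^+ (m - i).
  by rewrite -exprD subnKC// exprVn.
rewrite exprMn -[- t]mulN1r [(-1 * t) ^+ i]exprMn.
move: (gbinom b (m - i)) (gbinom b i) ((-1) ^+ i) (t ^+ i) => G H s u; ring.
Qed.

Lemma jac_at0_gt0 m b : m%:R < b + 1 -> 0 < (jac m b).[0].
Proof.
move=> mb; rewrite horner_coef0 jac_coef// gbinom0 subn0 expr0 !mul1r.
exact: gbinom_gt0.
Qed.

(** At -1 all signs cancel and every term is positive. The point -1 is the root of 1 + t, the
    polynomial by which [eigenfun_span] divides. *)
Lemma jac_atN1_gt0 m b : m%:R < b + 1 -> 0 < (jac m b).[-1].
Proof.
move=> mb; rewrite /jac horner_poly.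
have H i : (i <= m)%N -> 0 < gbinom b i.
  by move=> im; apply: gbinom_gt0; rewrite (le_lt_trans _ mb)// ler_nat.
rewrite big_ord_recl ltr_pwDl//=.
  by rewrite !expr0 mul1r mulr1 mulr_gt0// ?H// leq_subr.
apply: sumr_ge0 => i _; rewrite mulrAC -exprMn mulrNN mulr1 expr1n mul1r.
by rewrite ltW// mulr_gt0// H ?leq_subr//=; exact: ltn_ord.
Qed.

Definition powpoly b p t : R := (1 + t) `^ (- b) * p.[t].

(** Differentiation of [powpoly b p] raises b by 1 and replaces p by this polynomial, whose degree
    is no larger. *)
Definition powpolyD b p : {poly R} := (1 + 'X) * p^`() - b *: p.

Lemma powR_pred (r u : R) : 0 < u -> u `^ (r - 1) = u `^ r / u.
Proof.
move=> u0; rewrite powRB ?powRr1 ?(ltW u0)//.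
by apply/implyP => _; rewrite gt_eqF.
Qed.

Lemma is_derive_powpoly b p t : 0 <= t ->
  is_derive t 1 (powpoly b p) (powpoly (b + 1) (powpolyD b p) t).
Proof.
move=> t0; have t1 : 0 < 1 + t by rewrite ltr_pwDl.
have D0 : is_derive t 1 (fun u : R => 1 + u) (1 : R).
  rewrite (_ : (fun _ => _) = cst 1 + id)//.
  by apply: is_derive_eq; rewrite add0r.
have D1 := is_derive_comp D0 (is_derive1_powR (- b) t1).
have D2 := is_derive_poly p t.
have D := is_deriveM D1 D2.
apply: is_derive_eq; rewrite /powpoly /powpolyD !hornerE -![_ *: _]/(_ * _) /=.
rewrite opprD powR_pred//.
by move: (_ `^ (- b)) => P; field; rewrite gt_eqF.
Qed.

(** The left side is the radial part found in [radial_laplace]. The difference of the two sides is 4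
    (1 + t)^(-b - 1) times the left side of [jac_ode]. *)
Lemma powpoly_ode m b (N h : R) t : 0 <= t -> 2 * N + 4 * h = 4 * (b - m%:R + 1) ->
  4 * t * powpoly (b + 1 + 1) (powpolyD (b + 1) (powpolyD b (jac m b))) t
  + (2 * N + 4 * h) * powpoly (b + 1) (powpolyD b (jac m b)) t
  = - (4 * b * (b + 1) / (1 + t) ^+ 2 * powpoly b (jac m b) t).
Proof.
move=> t0 ->; have t1 : 0 < 1 + t by rewrite ltr_pwDl.
have ode := jac_ode m b t.
rewrite /powpoly !opprD !powR_pred// /powpolyD.
rewrite !(derivD, derivM, derivZ, derivN, derivC, derivX).
rewrite !(hornerD, hornerN, hornerM, hornerZ, hornerC, hornerX).
move: ode; move: (jac m b)^`()^`().[t] (jac m b)^`().[t] (jac m b).[t] (_ `^ (- b)) => p2 p1 p0 P ode.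
apply/eqP; rewrite -subr_eq0; apply/eqP.
transitivity (4 * P / (1 + t) * (t * (1 + t) * p2 + (b - m%:R + 1 + (1 - m%:R - b) * t) * p1 + b * m%:R * p0)).
  by field; rewrite gt_eqF.
by rewrite ode mulr0.
Qed.

End jacobi_polynomials.

(** * Spherical harmonics and their solid extensions *)

Section spherical_harmonics.
Context {R : realType} {N : nat}.
Local Notation V := 'rV[R]_N.
Local Notation e i := (delta_mx 0 i : V).
Local Notation punctured := [set x : V | x != 0].
Implicit Types (f Y : V -> R) (x : V).

Lemma enorm_unit x : x != 0 -> enorm ((enorm x)^-1 *: x) = 1.
Proof.
by move=> x0; rewrite enormZ ?invr_ge0// mulVf// gt_eqF// enorm_gt0.
Qed.

Lemma ray_ext_scale (T : Type) (f : V -> T) (t : R) x : 0 < t ->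
  ray_ext f (t *: x) = ray_ext f x.
Proof.
move=> t0; rewrite /ray_ext enormZ ?ltW// scalerA; congr (f (_ *: _)).
by rewrite invfM mulrAC mulVf ?mul1r// gt_eqF.
Qed.

Lemma scale_partial f (t a : R) i x : smooth_on punctured f -> 0 < t ->
  (forall y, y != 0 -> f (t *: y) = a * f y) -> x != 0 ->
  partial i f (t *: x) = a / t * partial i f x.
Proof.
move=> sf t0 fE x0; have tn0 : t != 0 by rewrite gt_eqF.
have tx0 : t *: x != 0 by rewrite scaler_eq0 negb_or tn0.
apply: partialE.
apply: (@is_derive_eq_on _ _ punctured (fun y : V => a * f (t^-1 *: y))) => //.
- exact: open_neq0.
- move=> y y0; rewrite -fE ?scalerA ?mulfV ?scale1r//.
  by rewrite scaler_eq0 negb_or invr_eq0 tn0.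
rewrite -mulrA; apply: is_deriveZ; apply/is_derive_line.
rewrite (_ : (fun _ => _) = fun h => f (h *: (t^-1 *: e i) + x)); last first.
  apply/funext => h; rewrite scalerDr !scalerA; congr (f (_ + _)).
    by rewrite mulrC.
  by rewrite mulVf// scale1r.
by apply/is_derive_line; apply: is_derive_scale; exact: smooth_on_derive.
Qed.

(** The sum is the derivative of f at x in the direction x, by [C1_is_derive], and f is constant
    along that ray. *)
Lemma euler_ray f x : smooth_on punctured f ->
  (forall t y, 0 < t -> f (t *: y) = f y) -> x != 0 ->
  \sum_i x 0 i * partial i f x = 0.
Proof.
move=> sf fE x0.
have D : is_derive x x f (\sum_i x 0 i * partial i f x).
  apply: C1_is_derive.
    apply: filterS (open_nbhs_nbhs (conj open_neq0 x0)) => y y0 i.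
    by have := smooth_on_derive i sf y0 => ?; exact: ex_derive.
  by move=> i; exact: (smooth_on_continuous (smooth_on_partial i sf)).
have D' : is_derive x x f 0.
  apply/is_derive_line.
  apply: (@is_derive_near_eq R R (cst (f x))).
  have : \forall h \near (0 : R), -1 < h by apply: lt_nbhsr; rewrite ltrN10.
  apply: filterS => h h1; rewrite /cst (_ : _ + x = (h + 1) *: x) ?fE//.
    by rewrite -ltrBlDr sub0r.
  by rewrite scalerDl scale1r.
by have [_ <-] := D; have [_ ->] := D'.
Qed.

(** The gradient of [ray_ext Y] has degree -1, so its extension constant along rays is |x| times it.
    Differentiating the factor |x| adds the terms x_i times the i-th derivative, whose sum is 0 by
    [euler_ray]. *)
Lemma laplace_beltrami_unit Y x : smooth_on punctured (ray_ext Y) -> enorm x = 1 ->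
  laplace_beltrami Y x = laplace (ray_ext Y) x.
Proof.
move=> sY x1; have x0 : x != 0 by rewrite -enorm_gt0 x1.
have s1 : sq x = 1 by rewrite -enorm_sqr x1 expr1n.
have gE i y : y != 0 ->
    ray_ext (sphere_grad Y) y 0 i = sq y `^ 2^-1 * partial i (ray_ext Y) y.
  move=> y0; have ny0 : 0 < enorm y by rewrite enorm_gt0.
  rewrite /ray_ext /sphere_grad /gradient mxE.
  rewrite (@scale_partial _ _ 1)//; first by rewrite invrK mul1r enormE.
    by rewrite invr_gt0.
  by move=> z _; rewrite mul1r ray_ext_scale// invr_gt0.
rewrite /laplace_beltrami /sphere_div.
transitivity (\sum_i (x 0 i * partial i (ray_ext Y) x + partial i (partial i (ray_ext Y)) x)).
  apply: eq_bigr => i _; apply: partialE.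
  apply: (@is_derive_eq_on _ _ punctured (fun y => sq y `^ 2^-1 * partial i (ray_ext Y) y)) => //.
  - exact: open_neq0.
  - by move=> y /gE ->.
  have sp := smooth_on_partial i sY.
  have := @radial_derive _ _ punctured (fun t : R => t `^ 2^-1)
    (fun t : R => 2^-1 * t `^ (2^-1 - 1)) _ i x x0 sp.
  rewrite s1 => /(_ (is_derive1_powR _ ltr01)); rewrite !powR1 mulr1 mul1r.
  by move=> H; apply: is_derive_eq; congr (_ + _); field.
rewrite big_split/= euler_ray ?add0r//.
by move=> t y; exact: ray_ext_scale.
Qed.

(** The Laplacian of a function of degree 0 has degree -2, which carries the equation from the
    sphere to the punctured space. *)
Lemma spherical_harmonic_laplace h Y x : spherical_harmonic h Y -> x != 0 ->
  laplace (ray_ext Y) x = - (h%:R * (h%:R + N%:R - 2) / sq x * ray_ext Y x).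
Proof.
move=> [sY YE] x0; have nx0 : 0 < enorm x by rewrite enorm_gt0.
have it0 : 0 < (enorm x)^-1 by rewrite invr_gt0.
have u1 := enorm_unit x0.
have u0 : (enorm x)^-1 *: x != 0 by rewrite -enorm_gt0 u1.
have L : laplace (ray_ext Y) ((enorm x)^-1 *: x) = enorm x ^+ 2 * laplace (ray_ext Y) x.
  rewrite /laplace mulr_sumr; apply: eq_bigr => i _.
  rewrite (@scale_partial _ _ (enorm x))//; first by rewrite invrK expr2.
    exact: smooth_on_partial.
  move=> y y0; rewrite (@scale_partial _ _ 1)//; first by rewrite invrK mul1r.
  by move=> z _; rewrite mul1r ray_ext_scale.
have := YE _ u1; rewrite laplace_beltrami_unit// L enorm_sqr.
rewrite -[Y _]/(ray_ext Y x) => H.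
apply: (@mulfI _ (sq x)); first by rewrite sq_eq0.
rewrite -[LHS]opprK H; field; by rewrite sq_eq0.
Qed.

Lemma smooth_radial (B : set R) (K : R -> R) f : (forall x, x != 0 -> B (sq x)) ->
  (forall k, Ck1_on B k K) -> smooth_on punctured f ->
  smooth_on punctured (fun x => K (sq x) * f x).
Proof.
move=> HB HK sf; apply: smooth_onM => //; first exact: open_neq0.
by move=> k; apply: (Ck_on_comp open_neq0 HB); [apply: smooth_sq; exact: open_neq0|exact: HK].
Qed.

Let Ck1_pow (r : R) k : Ck1_on [set t : R | 0 < t] k (fun t : R => t `^ r).
Proof.
rewrite (_ : (fun _ => _) = fun t => 1 * t `^ r); first exact: Ck1_on_powR.
by apply/funext => t; rewrite mul1r.
Qed.

Lemma powR_laplace (r d : R) f x : smooth_on punctured f -> x != 0 ->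
  \sum_i x 0 i * partial i f x = d * f x ->
  laplace (fun y => sq y `^ r * f y) x =
  sq x `^ r * ((4 * r * (r - 1) + (2 * N%:R + 4 * d) * r) / sq x * f x + laplace f x).
Proof.
move=> sf x0 euler.
have D1 (y : V) : y != 0 -> is_derive (sq y) 1 (fun u : R => u `^ r) (r * sq y `^ (r - 1)).
  by move=> y0; apply: is_derive1_powR; rewrite sq_gt0.
have D2 (y : V) : y != 0 -> is_derive (sq y) 1 (fun u : R => r * u `^ (r - 1))
    (r * ((r - 1) * sq y `^ (r - 1 - 1))).
  by move=> y0; apply: is_deriveZ; apply: is_derive1_powR; rewrite sq_gt0.
have s0 : 0 < sq x by rewrite sq_gt0.
have := @radial_laplace _ _ punctured (fun t : R => t `^ r) (fun t : R => r * t `^ (r - 1))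
  (fun t : R => r * ((r - 1) * t `^ (r - 1 - 1))) f d x open_neq0 x0 sf D1 D2 euler.
move=> ->.
rewrite !powR_pred//; field; exact: lt0r_neq0.
Qed.

Lemma harmonic_ray_ext h (H : V -> R) x : harmonic h H -> x != 0 ->
  ray_ext H x = sq x `^ (- (h%:R / 2)) * H x.
Proof.
move=> [hH _] x0; rewrite /ray_ext (homog_scale _ _ hH) enormE exprVn; congr (_ * _).
by rewrite powRN -powR_mulrn ?powR_ge0// -powRrM mulrC.
Qed.

Lemma harmonic_spherical h (H : V -> R) : harmonic h H -> spherical_harmonic h H.
Proof.
move=> hH; have [H0 lH] := hH.
have sH : smooth_on punctured H by apply: smooth_homog H0; exact: open_neq0.
have sP : smooth_on punctured (fun x => sq x `^ (- (h%:R / 2)) * H x).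
  by apply: (smooth_radial _ (Ck1_pow _) sH) => x /=; rewrite sq_gt0.
have sR : smooth_on punctured (ray_ext H).
  move=> k; apply: Ck_on_eq (sP k); first exact: open_neq0.
  by move=> y y0; rewrite (harmonic_ray_ext hH y0).
split=> // x x1; have x0 : x != 0 by rewrite -enorm_gt0 x1.
have s1 : sq x = 1 by rewrite -enorm_sqr x1 expr1n.
rewrite laplace_beltrami_unit//.
rewrite (_ : laplace _ x = laplace (fun x => sq x `^ (- (h%:R / 2)) * H x) x).
  (* With r = -h/2 and d = h the coefficient in [powR_laplace] is -h (h + N - 2). *)
  rewrite (powR_laplace _ _ x0 (euler_homog _ H0))// lH s1 powR1 /cst; by field.
apply: eq_bigr => i _.
have E j y : y != 0 -> partial j (ray_ext H) y = partial j (fun x => sq x `^ (- (h%:R / 2)) * H x) y.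
  move=> y0; apply: partialE.
  apply: (is_derive_eq_on open_neq0 y0 _ (smooth_on_derive j sP y0)) => z z0.
  by rewrite (harmonic_ray_ext hH z0).
apply: partialE; apply: (is_derive_eq_on open_neq0 x0 _ (smooth_on_derive i (smooth_on_partial i sP) x0)).
by move=> y /E ->.
Qed.

(** For an arbitrary spherical harmonic this is smooth and harmonic off the origin; for a harmonic
    form it gives the form back. *)
Definition solid h Y x : R := enorm x ^+ h * ray_ext Y x.

Let solidE h Y x : solid h Y x = sq x `^ (h%:R / 2) * ray_ext Y x.
Proof.
by rewrite /solid enormE; congr (_ * _); rewrite -powR_mulrn ?powR_ge0// -powRrM mulrC.
Qed.

Lemma solid_harmonic h (H : V -> R) : harmonic h H -> solid h H = H.
Proof.
move=> hH; apply/funext => x; have [->|x0] := eqVneq x 0.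
  rewrite /solid /ray_ext enorm0 scaler0.
  case: h hH => [|h] [hH _]; first by rewrite mul1r.
  by rewrite expr0n mul0r -[in RHS](scale0r 0) (homog_scale _ _ hH) expr0n mul0r.
rewrite /solid /ray_ext (homog_scale _ _ hH.1) mulrA -exprMn mulfV ?expr1n ?mul1r//.
by rewrite gt_eqF// enorm_gt0.
Qed.

Lemma smooth_solid h Y : spherical_harmonic h Y -> smooth_on punctured (solid h Y).
Proof.
move=> [sY _]; rewrite (funext (solidE h Y)).
by apply: (smooth_radial _ (Ck1_pow _) sY) => x /=; rewrite sq_gt0.
Qed.

Lemma partial_solid h Y i x : spherical_harmonic h Y -> x != 0 ->
  partial i (solid h Y) x = enorm x ^+ h * (h%:R * x 0 i / sq x * ray_ext Y x + partial i (ray_ext Y) x).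
Proof.
move=> [sY _] x0; rewrite (funext (solidE h Y)); have s0 : 0 < sq x by rewrite sq_gt0.
apply: partialE.
have := @radial_derive _ _ punctured _ (fun t : R => h%:R / 2 * t `^ (h%:R / 2 - 1))
  _ i x x0 sY (is_derive1_powR (h%:R / 2) s0).
rewrite powR_pred// => D; apply: is_derive_eq.
rewrite enormE -powR_mulrn ?powR_ge0// -powRrM [_^-1 * _]mulrC.
field; exact: lt0r_neq0.
Qed.

Lemma euler_solid h Y x : spherical_harmonic h Y -> x != 0 ->
  \sum_i x 0 i * partial i (solid h Y) x = h%:R * solid h Y x.
Proof.
move=> hY x0; have s0 : sq x != 0 by rewrite sq_eq0.
transitivity (\sum_i (x 0 i ^+ 2 * (h%:R * enorm x ^+ h / sq x * ray_ext Y x)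
    + enorm x ^+ h * (x 0 i * partial i (ray_ext Y) x))).
  by apply: eq_bigr => i _; rewrite partial_solid//; ring.
rewrite big_split/= -mulr_suml -mulr_sumr euler_ray//; last 2 first.
- by case: hY.
- by move=> t y; exact: ray_ext_scale.
rewrite -sqE mulr0 addr0 /solid; field.
exact: s0.
Qed.

(** With r = h/2 and d = 0 the coefficient in [powR_laplace] is h (h + N - 2), which cancels the
    eigenvalue. *)
Lemma laplace_solid h Y x : spherical_harmonic h Y -> x != 0 ->
  laplace (solid h Y) x = 0.
Proof.
move=> hY x0; have s0 : sq x != 0 by rewrite sq_eq0.
rewrite (funext (solidE h Y)) (@powR_laplace _ 0)//; first last.
- by rewrite mul0r euler_ray//; [case: hY|move=> t y; exact: ray_ext_scale].
- by case: hY.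
rewrite (spherical_harmonic_laplace hY)//; field; exact: s0.
Qed.

End spherical_harmonics.

(** * The functions w_{n,h} are decaying solutions *)

Lemma poly_bound {R : realType} (p : {poly R}) m : (size p <= m.+1)%N ->
  exists2 C, 0 <= C & forall t, 0 <= t -> `|p.[t]| <= C * (1 + t) ^+ m.
Proof.
move=> pm; exists (\sum_(i < size p) `|p`_i|) => [|t t0]; first exact: sumr_ge0.
rewrite horner_coef mulr_suml (le_trans (ler_norm_sum _ _ _))//.
apply: ler_sum => i _; rewrite normrM ler_wpM2l// ger0_norm ?exprn_ge0//.
have t1 : 1 <= 1 + t by rewrite lerDl.
apply: (@le_trans _ _ ((1 + t) ^+ i)).
  by rewrite lerXn2r ?nnegrE ?addr_ge0// lerDr.
by rewrite ler_weXn2l// -ltnS (leq_trans (ltn_ord i)).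
Qed.

Section decaying_eigenfunctions.
Context {R : realType} {N : nat} (N3 : (3 <= N)%N).
Local Notation V := 'rV[R]_N.
Local Notation punctured := [set x : V | x != 0].
Local Notation c := ((N%:R - 2) / 2 : R).
Implicit Types (f Y : V -> R) (x : V).

Lemma sphere_compact : compact [set x : V | enorm x = 1].
Proof.
apply: bounded_closed_compact.
  exists 1; split=> // M M1 x /= x1; apply: le_trans (ltW M1).
  by apply: rV_norm_le => // i; rewrite -x1 coord_le_enorm.
rewrite (_ : mkset _ = @enorm R N @^-1` [set 1]).
  by apply: closed_comp; [move=> x _; exact: continuous_enorm|exact: closed_eq].
by apply/seteqP; split.
Qed.

Lemma degree0_bounded f : (forall x, x != 0 -> {for x, continuous f}) ->
  (forall t x, 0 < t -> x != 0 -> f (t *: x) = f x) ->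
  exists2 C, 0 <= C & forall x, x != 0 -> `|f x| <= C.
Proof.
move=> cf fE.
have cf' : {within [set x : V | enorm x = 1], continuous f}.
  apply: continuous_in_subspaceT => x; rewrite inE /= => x1; apply: cf.
  by rewrite -enorm_gt0 x1.
have /compact_bounded[C [_ HC]] := continuous_compact cf' sphere_compact.
exists (`|C| + 1) => [|x x0]; first by rewrite addr_ge0.
rewrite -(fE (enorm x)^-1)//; last by rewrite invr_gt0 enorm_gt0.
apply: HC; first by rewrite (le_lt_trans (ler_norm C))// ltrDl.
by exists ((enorm x)^-1 *: x) => //=; exact: enorm_unit.
Qed.

(** Both [ray_ext Y] and |x| times its gradient have degree 0, hence are bounded by compactness of
    the sphere. *)
Lemma solid_bound h Y : spherical_harmonic h Y -> exists2 C, 0 <= C &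
  (forall x, `|solid h Y x| <= C * enorm x ^+ h) /\
  forall i x, x != 0 -> `|partial i (solid h Y) x| <= C * (enorm x ^+ h / enorm x).
Proof.
move=> hY; have [sY _] := hY.
have [A A0 HA] : exists2 C, 0 <= C & forall x, x != 0 -> `|ray_ext Y x| <= C.
  apply: degree0_bounded => [x x0|t x t0 _]; last exact: ray_ext_scale.
  exact: smooth_on_continuous sY x0.
have /choice[B HB] : forall i, exists C, 0 <= C /\ forall x, x != 0 ->
    `|enorm x * partial i (ray_ext Y) x| <= C.
  move=> i; suff [C ? ?] : exists2 C, 0 <= C & forall x, x != 0 ->
    `|enorm x * partial i (ray_ext Y) x| <= C by exists C.
  apply: degree0_bounded => [x x0|t x t0 x0].
    apply: continuousM; first exact: continuous_enorm.
    by apply: smooth_on_continuous x0; exact: smooth_on_partial.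
  rewrite (@scale_partial _ _ _ _ 1)//; last first.
    by move=> y _; rewrite mul1r ray_ext_scale.
  by rewrite enormZ ?ltW// mul1r [t * _]mulrC -mulrA mulVKf// gt_eqF.
(* [|Y 0|] accounts for the origin, where [ray_ext Y] takes the value [Y 0]; this matters when h =
   0. *)
pose C := (h%:R + 1) * (A + `|Y 0| + \sum_i B i).
have B0 : 0 <= \sum_i B i by apply: sumr_ge0 => i _; case: (HB i).
have AC : A + `|Y 0| + \sum_i B i <= C.
  by rewrite ler_peMl ?addr_ge0// lerDr.
exists C; first by rewrite mulr_ge0 ?addr_ge0.
split=> [x|i x x0].
  rewrite /solid mulrC normrM [`|_ ^+ h|]ger0_norm ?exprn_ge0// ler_wpM2r ?exprn_ge0//.
  apply: le_trans AC; have [->|/HA Ax] := eqVneq x 0.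
    by rewrite /ray_ext scaler0 -addrA addrCA lerDl addr_ge0.
  by rewrite -addrA (le_trans Ax)// lerDl addr_ge0.
have n0 : 0 < enorm x by rewrite enorm_gt0.
rewrite partial_solid// normrM ger0_norm ?exprn_ge0// mulrCA ler_wpM2l ?exprn_ge0//.
rewrite ler_pdivlMr// mulrC -[X in X * _](ger0_norm (ltW n0)) -normrM.
rewrite [X in `|X|](_ : _ = h%:R * (x 0 i / enorm x * ray_ext Y x)
    + enorm x * partial i (ray_ext Y) x); last first.
  by rewrite -enorm_sqr; field; exact: lt0r_neq0.
apply: (le_trans (ler_normD _ _)).
rewrite /C mulrDl mul1r lerD//.
  rewrite normrM ger0_norm// ler_wpM2l// normrM.
  apply: (@le_trans _ _ (1 * A)); last by rewrite mul1r -addrA lerDl addr_ge0.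
  rewrite ler_pM ?HA// normrM normfV (ger0_norm (enorm_ge0 x)).
  by rewrite ler_pdivrMr// mul1r coord_le_enorm.
have [B0i /(_ _ x0)/le_trans] := HB i; apply.
rewrite (bigD1 i)//= addrCA lerDl !addr_ge0// sumr_ge0// => j _.
by case: (HB j).
Qed.

(** The exponent does not depend on h: it adds the h + c of [w_] and the n - h released by
    homogenizing the Jacobi polynomial. Here f may be a solid harmonic or a harmonic form. *)
Definition eigenfun n h f x : R := powpoly (n%:R + c) (jac (n - h) (n%:R + c)) (sq x) * f x.

Lemma w_E n h Y : (h <= n)%N -> w_ n h Y = eigenfun n h (solid h Y).
Proof.
move=> hn; apply/funext => x; rewrite /w_ /eigenfun /powpoly /solid enorm_sqr.
have s1 : 0 < 1 + sq x by rewrite ltr_pwDl.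
have -> : n%:R + c = h%:R + c + (n - h)%:R by rewrite natrB//; ring.
move: (h%:R + c) (n - h)%N => a m.
have := @jac_jacobi R m (a + m%:R) (sq x) (sq_ge0 x); rewrite addrK => ->.
rewrite opprD powRD; last by apply/implyP => _; rewrite gt_eqF.
rewrite !powRN powR_mulrn; last exact: ltW.
move: (_ .[_]) (_ `^ _) (_ ^+ m) (_ ^+ h) (ray_ext _ _) => ? ? ? ? ?.
by ring.
Qed.

Lemma powpoly_bound (b : R) (p : {poly R}) m : (size p <= m.+1)%N -> exists2 C, 0 <= C &
  forall x : V, `|powpoly b p (sq x)| <= C * kern 0 (b - m%:R) x.
Proof.
move=> /poly_bound[C C0 HC]; exists C => // x.
have s1 : 0 < 1 + sq x by rewrite ltr_pwDl.
rewrite /powpoly /kern oppr0 powRr0 mul1r normrM ger0_norm ?powR_ge0//.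
rewrite opprB [m%:R - b]addrC powRD; last by apply/implyP => _; rewrite gt_eqF.
by rewrite powR_mulrn ?(ltW s1)// mulrCA ler_wpM2l ?powR_ge0// HC.
Qed.

Lemma size_powpolyD (b : R) (p : {poly R}) m : (size p <= m.+1)%N -> (size (powpolyD b p) <= m.+1)%N.
Proof.
move=> pm; rewrite /powpolyD (leq_trans (size_polyD _ _))// geq_max; apply/andP; split.
  rewrite (leq_trans (size_polyMleq _ _))//.
  have s1 : (size (1 + 'X : {poly R})%R <= 2)%N by rewrite addrC size_XaddC.
  have : (size p^`() <= m)%N by rewrite (leq_trans (size_poly _ _))//; case: (size p) pm.
  lia.
by rewrite size_polyN (leq_trans (size_scale_leq _ _)).
Qed.

Lemma enormX_le_kern h x : enorm x ^+ h <= kern 0 (- h%:R) x.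
Proof.
rewrite /kern oppr0 powRr0 mul1r opprK powR_mulrn ?addr_ge0// lerXn2r ?nnegrE ?addr_ge0//.
rewrite -enorm_sqr; have := enorm_ge0 x; nra.
Qed.

Let kernM0 a b x : kern 0 a x * kern 0 b x = kern 0 (a + b) x.
Proof. by rewrite kernM// addr0. Qed.

(** By the crude bounds |p(s)| <= C (1 + s)^m and r^h <= (1 + s)^h, the exponent left is b - m - h,
    which is c. *)
Lemma decaying_radial h m (b : R) (p : {poly R}) Y : spherical_harmonic h Y -> (size p <= m.+1)%N ->
  b - m%:R - h%:R = c -> decaying (fun x => powpoly b p (sq x) * solid h Y x).
Proof.
move=> hY pm bE; have [A A0 [HA HB]] := solid_bound hY.
have [C C0 HC] := powpoly_bound b pm.
have [D D0 HD] := powpoly_bound (b + 1) (size_powpolyD b pm).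
have sS := smooth_solid hY.
have dP x := is_derive_powpoly b p (sq_ge0 x).
split.
  apply: smooth_onM => //; first exact: open_neq0.
  rewrite (_ : (fun _ => _) = fun x => (1 * (1 + sq x) `^ (- b)) * p.[sq x]); last first.
    by apply/funext => x; rewrite mul1r.
  have s0 := smooth_sq (@open_neq0 R N).
  apply: smooth_onM; first exact: open_neq0.
    move=> k; have S1 : Ck_on punctured k (fun x => 1 + sq x).
      by apply: Ck_onD; [exact: open_neq0|apply: Ck_on_cst; exact: open_neq0|exact: s0].
    apply: (Ck_on_comp open_neq0 _ S1 (Ck1_on_powR 1 (- b) k)) => x _ /=.
    by rewrite ltr_pwDl.
  by move=> k; exact: (Ck_on_comp open_neq0 (fun _ _ => I) (s0 k) (Ck1_on_poly setT p k)).
have k0 x : kern 0 (b - m%:R) x * enorm x ^+ h <= kern 0 c x.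
  rewrite -bE -[in leRHS]kernM0; apply: ler_wpM2l; first exact: kern_ge0.
  exact: enormX_le_kern.
exists (A * (C + 2 * D)); first by rewrite !mulr_ge0// addr_ge0// mulr_ge0.
split=> [x|i x x0].
  rewrite normrM (le_trans (ler_pM _ _ (HC x) (HA x)))//.
  rewrite mulrACA [C * A]mulrC.
  apply: (@le_trans _ _ (A * C * kern 0 c x)); first by rewrite ler_wpM2l// mulr_ge0.
  by rewrite ler_wpM2r ?kern_ge0// ler_wpM2l// lerDl mulr_ge0.
have n0 : 0 < enorm x by rewrite enorm_gt0.
have K1E : kern 1 c x = (enorm x)^-1 * kern 0 c x.
  by rewrite enorm_inv_kern kernM// addr0 add0r.
rewrite (partialE (@radial_derive _ _ punctured _ (powpoly (b + 1) (powpolyD b p)) _ i x x0 sS (dP x))).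
rewrite (le_trans (ler_normD _ _))// mulrDr addrC mulrDl lerD//.
  rewrite normrM (le_trans (ler_pM _ _ (HC x) (HB i x x0)))// K1E.
  rewrite mulrACA [C * A]mulrC ler_wpM2l ?mulr_ge0//.
  by rewrite mulrA [leRHS]mulrC ler_wpM2r// invr_ge0.
(* The derivative of the radial factor brings 2 x_i and one more power of 1/(1 + s), and |x|/(1 + s)
   <= 1/|x|. *)
have k1 : enorm x * kern 0 1 x <= (enorm x)^-1.
  rewrite /kern oppr0 powRr0 mul1r powR_inv1 ?addr_ge0// ler_pdivrMr ?ltr_pwDl//.
  by rewrite ler_pdivlMl// -expr2 enorm_sqr lerDr.
rewrite normrM.
apply: (@le_trans _ _ (2 * enorm x * (D * kern 0 (b + 1 - m%:R) x) * (A * enorm x ^+ h))).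
  apply: ler_pM => //; rewrite normrM; apply: ler_pM => //.
  by rewrite normrM ger0_norm// ler_wpM2l// coord_le_enorm.
rewrite (_ : b + 1 - m%:R = b - m%:R + 1); last by ring.
rewrite -kernM0 K1E.
apply: (@le_trans _ _ (A * (2 * D) * ((enorm x * kern 0 1 x) * (kern 0 (b - m%:R) x * enorm x ^+ h)))).
  by rewrite le_eqVlt; apply/orP; left; apply/eqP; ring.
apply: ler_wpM2l; first by rewrite !mulr_ge0.
by apply: ler_pM => //; apply: mulr_ge0; rewrite ?kern_ge0 ?exprn_ge0.
Qed.

Lemma eigenfun_decaying n h Y : (h <= n)%N -> spherical_harmonic h Y ->
  decaying (eigenfun n h (solid h Y)).
Proof.
move=> hn hY; apply: (decaying_radial (b := n%:R + c) hY (size_jac _ _)).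
by rewrite natrB//; ring.
Qed.

Lemma eigenfun_solution n h Y : (h <= n)%N -> spherical_harmonic h Y ->
  decaying_solution (lambda_ N n) (eigenfun n h (solid h Y)).
Proof.
move=> hn hY; split=> [|x x0]; first exact: eigenfun_decaying.
have s1 : 0 < 1 + sq x by rewrite ltr_pwDl.
rewrite -[LHS]/(laplace (eigenfun n h (solid h Y)) x).
set b := n%:R + c; set p := jac (n - h) b.
have D1 (y : V) : y != 0 -> is_derive (sq y) 1 (powpoly b p) (powpoly (b + 1) (powpolyD b p) (sq y)).
  by move=> _; exact: is_derive_powpoly.
have D2 (y : V) : y != 0 -> is_derive (sq y) 1 (powpoly (b + 1) (powpolyD b p))
    (powpoly (b + 1 + 1) (powpolyD (b + 1) (powpolyD b p)) (sq y)).
  by move=> _; exact: is_derive_powpoly.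
rewrite (radial_laplace open_neq0 x0 (smooth_solid hY) D1 D2 (euler_solid hY x0)).
rewrite laplace_solid// mulr0 addr0 powpoly_ode//; last by rewrite natrB// /b; field.
rewrite /eigenfun -/b -/p /lambda_ /weight enorm_sqr.
have NN : N%:R != 0 :> R by rewrite pnatr_eq0; case: (N) N3.
rewrite mulNr /b; field.
by rewrite NN gt_eqF//= gt_eqF// ltr_wpDl.
Qed.

Lemma harmonic_eigenfun n h f : (h <= n)%N -> harmonic h f ->
  decaying_solution (lambda_ N n) (eigenfun n h f).
Proof.
move=> hn hf; have := eigenfun_solution hn (harmonic_spherical hf).
by rewrite (solid_harmonic hf).
Qed.

End decaying_eigenfunctions.

(** * Integrable functions with zero integral over all orthants *)

Section lower_orthants.
Context {R : realType} {N : nat}.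
Local Notation V := 'rV[R]_N.
Local Notation mu := (lebesgue_rV R N).
Local Notation itg f := (mu.-integrable setT (EFin \o f)).
Implicit Types (f : V -> R) (a x : V).

Definition orthant a : set V := [set x | forall i, x 0 i < a 0 i].

Let G : set (set V) := [set A | A = setT \/ exists a, A = orthant a].

Lemma measurable_orthant a : measurable (orthant a).
Proof.
apply: (@measurable_forall_coord _ _ (fun i => `]-oo, a 0 i[%classic)) => i.
exact: measurable_itv.
Qed.

Let setI_closed_G : setI_closed G.
Proof.
move=> A B [->|[a ->]] [->|[b ->]].
- by left; rewrite setTI.
- by right; exists b; rewrite setTI.
- by right; exists a; rewrite setIT.
- right; exists (\row_i Num.min (a 0 i) (b 0 i)); apply/seteqP; split => x /=.
    by move=> [xa xb] i; rewrite mxE lt_min xa xb.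
  by move=> H; split => i; have := H i; rewrite mxE lt_min => /andP[].
Qed.

Let measurable_G : @measurable _ V = <<s G >>.
Proof.
apply/seteqP; split; last first.
  apply: smallest_sub; first exact: sigma_algebra_measurable.
  by move=> A [->|[a ->]]; [exact: measurableT|exact: measurable_orthant].
apply: smallest_sub; first exact: smallest_sigma_algebra.
move=> A; rewrite -bigcup_seq => -[i _ [B mB <-]] /=; rewrite setTI.
have [sG0 sGC sGU] := smallest_sigma_algebra setT G.
have H : @measurable _ (measurableTypeR R) `<=` [set B | <<s G >> ((fun x : V => x 0 i) @^-1` B)].
  rewrite RGenInftyO.measurableE; apply: smallest_sub.
    split => /=; first by rewrite preimage_set0.
      by move=> C HC; rewrite setTD preimage_setC -setTD; exact: sGC.
    by move=> F HF; rewrite preimage_bigcup; exact: sGU.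
  move=> C [t ->] /=.
  (* A half-space x_i < t is exhausted by orthants whose other bounds k tend to infinity. *)
  rewrite (_ : _ @^-1` _ = \bigcup_k orthant (\row_j if j == i then t else k%:R)).
    by apply: sGU => k; apply: sub_sigma_algebra; right; eexists.
  apply/seteqP; split => [x /=|x [k _ /(_ i)]]; last first.
    by rewrite mxE eqxx /= in_itv.
  rewrite in_itv /= => xt; exists (Num.truncn `|x|).+1 => // j; rewrite mxE.
  case: eqP => [->//|_].
  rewrite (le_lt_trans (ler_norm _))// (le_lt_trans (rV_coord_le_norm _ _))//.
  exact: truncnS_gt.
exact: H.
Qed.

(** Orthants are stable under intersection and generate the sigma-algebra, while the sets over which
    f integrates to 0 form a Dynkin class; hence they are all the measurable sets. *)
Lemma orthant_integral_eq0 f : itg f -> \int[mu]_x f x = 0 ->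
  (forall a, \int[mu]_x (f x * \1_(orthant a) x) = 0) -> f = cst 0 %[ae mu].
Proof.
move=> fi f0 fa.
have fin_eq0 g : itg g -> \int[mu]_x g x = 0 -> (\int[mu]_x (g x)%:E = 0)%E.
  move=> gi g0; rewrite -[LHS]fineK; last exact: integrable_fin_num gi.
  by rewrite -[fine _]/(\int[mu]_x g x) g0.
have mf := measurable_int _ fi.
have mfA (A : set V) : measurable_fun A (EFin \o f) by exact: measurable_funS mf.
have H (A : set V) : measurable A -> (\int[mu]_(x in A) (f x)%:E = 0)%E.
  rewrite measurable_G; move: A; apply: (@dynkin_induction _ _ _
    (fun A : set V => (\int[mu]_(x in A) (f x)%:E = 0)%E) measurable_G setI_closed_G).
  - exact: fin_eq0.
  - move=> _ [->|[a ->]]; first exact: fin_eq0.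
    rewrite integral_mkcond -[RHS](fin_eq0 (fun x => f x * \1_(orthant a) x))//.
      apply: eq_integral => x _; rewrite patchE indicE; case: ifP => _ /=; first by rewrite mulr1.
      by rewrite mulr0.
    apply: (@itg_le _ _ _ (fun x => `|f x|)); last by have := integrable_norm fi.
      apply: measurable_funM; first exact: itg_measurable.
      by apply: measurable_indic; exact: measurable_orthant.
    move=> x; rewrite normrM ler_piMr// indicE; case: (_ \in _) => /=;
      by rewrite ?normr0 ?normr1.
  - move=> S mS S0; have := fin_eq0 _ fi f0; rewrite -(setUv S).
    rewrite integral_setU//= ?S0 ?add0e//; first exact: measurableC.
    by apply/disj_setPCl.
  - move=> F mF tF F0; rewrite integral_bigcup//.
      by apply: eseries0 => k _ _; exact: F0.
    apply: (integrableS measurableT) => //; exact: bigcup_measurable.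
have AE : ae_eq mu setT (EFin \o f) (EFin \o cst 0).
  apply: integral_ae_eq => //; first exact/measurable_EFinP/measurable_cst.
  by move=> E _ mE; rewrite integral0 H.
by apply: filterS AE => x /= /(_ I) [].
Qed.

End lower_orthants.

(** * Polynomial approximation of a step on [0, 1] *)

Section step_approximation.
Context {R : realType}.
Implicit Types (t y z : R) (k m : nat).

Lemma bernoulli_le m y : 0 <= y <= 1 -> 1 - m%:R * y <= (1 - y) ^+ m.
Proof.
move=> /andP[y0 y1]; elim: m => [|m IH]; first by rewrite mul0r subr0.
have y2 : 0 <= 1 - y by rewrite subr_ge0.
rewrite exprS (le_trans _ (ler_wpM2l y2 IH))// -natr1.
have := mulr_ge0 (ler0n R m) (sqr_ge0 y); rewrite expr2; lra.
Qed.

Lemma bernoulli_inv_le m y : 0 <= y <= 1 -> (1 - y) ^+ m * (1 + m%:R * y) <= 1.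
Proof.
move=> /andP[y0 y1]; elim: m => [|m IH]; first by rewrite mul0r addr0 mulr1.
have y2 : 0 <= 1 - y by rewrite subr_ge0.
apply: le_trans IH; rewrite exprSr -mulrA ler_wpM2l ?exprn_ge0// -natr1.
have := mulr_ge0 (ler0n R m) (sqr_ge0 y); have := sqr_ge0 y; rewrite expr2; lra.
Qed.

(** With y the square root of z, k z^k = (k y^k) y^k, and k y^k <= 1/(1 - y) by
    [bernoulli_inv_le]. *)
Lemma cvg_natM_exp z : 0 <= z < 1 -> k%:R * z ^+ k @[k --> \oo] --> 0.
Proof.
move=> /andP[z0 z1]; set y := Num.sqrt z.
have y0 : 0 <= y by exact: sqrtr_ge0.
have y1 : y < 1 by rewrite -[ltRHS]sqrtr1 ltr_sqrt.
have d0 : 0 < 1 - y by rewrite subr_gt0.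
have B k : k%:R * z ^+ k <= (1 - y)^-1 * y ^+ k.
  rewrite -(sqr_sqrtr z0) -/y -exprM mulnC exprM expr2 mulrA ler_wpM2r ?exprn_ge0//.
  rewrite -[leRHS]mulr1 ler_pdivlMl//.
  have := @bernoulli_inv_le k (1 - y); rewrite subKr => H.
  have /H : 0 <= 1 - y <= 1 by rewrite (ltW d0)/= gerBl.
  have := exprn_ge0 k y0; move: (y ^+ k) => u; nra.
apply: (@squeeze_cvgr _ _ _ _ (cst 0) (fun k => (1 - y)^-1 * y ^+ k)).
- by apply: nearW => k; rewrite B mulr_ge0 ?exprn_ge0.
- exact: cvg_cst.
- by rewrite -(mulr0 (1 - y)^-1); apply: cvgMr; apply: cvg_expr; rewrite ger0_norm.
Qed.

(* k 2^k t^k = k (2t)^k tends to 0 if t < 1/2 and to infinity if t >= 1/2. *)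
Definition soft_step k t : R := (1 - t ^+ k) ^+ (k * 2 ^ k).

Lemma soft_step_itv k t : 0 <= t <= 1 -> 0 <= soft_step k t <= 1.
Proof.
move=> /andP[t0 t1]; have y1 : t ^+ k <= 1 by rewrite exprn_ile1.
by rewrite exprn_ge0 ?subr_ge0// exprn_ile1 ?subr_ge0// gerBl exprn_ge0.
Qed.

Lemma soft_step_cvg t : 0 <= t <= 1 ->
  soft_step k t @[k --> \oo] --> ((t < 2^-1)%R%:R : R).
Proof.
move=> t01; have /andP[t0 t1] := t01.
have y01 k : 0 <= t ^+ k <= 1 by rewrite exprn_ge0//= exprn_ile1.
have mE k : (k * 2 ^ k)%:R * t ^+ k = k%:R * (2 * t) ^+ k.
  by rewrite natrM natrX -mulrA -exprMn.
have [t2|t2] := ltP t 2^-1.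
  apply: (@squeeze_cvgr _ _ _ _ (fun k => 1 - k%:R * (2 * t) ^+ k) (cst 1)).
  - apply: nearW => k; rewrite -mE bernoulli_le//=.
    by have /andP[] := soft_step_itv k t01.
  - rewrite -[X in _ --> X]subr0; apply: cvgB; first exact: cvg_cst.
    by apply: cvg_natM_exp; lra.
  - exact: cvg_cst.
(* For 2 t >= 1 the value is at most 1/(1 + k (2t)^k) <= 1/(k + 1). This includes t = 1/2, so the
   limit is the indicator of a strict inequality. *)
rewrite (_ : false%:R = 0 :> R)//.
apply: (@squeeze_cvgr _ _ _ _ (cst 0) (fun k => k.+1%:R^-1)).
- apply: nearW => k; have /andP[-> _] /= := soft_step_itv k t01.
  have := bernoulli_inv_le (k * 2 ^ k) (y01 k); rewrite mE -/(soft_step k t) => H.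
  rewrite /harmonic -[leRHS]mul1r ler_pdivlMr ?ltr0n//; apply: le_trans H.
  have /andP[s0 _] := soft_step_itv k t01.
  rewrite ler_wpM2l// -natr1 addrC lerD2l ler_peMr// exprn_ege1//; lra.
- exact: cvg_cst.
- exact: cvg_harmonic.
Qed.

End step_approximation.

(** * Completeness of the eigenfunctions *)

Section completeness.
Context {R : realType} {N : nat} (N3 : (3 <= N)%N).
Local Notation V := 'rV[R]_N.
Local Notation mu := (lebesgue_rV R N).
Local Notation itg f := (mu.-integrable setT (EFin \o f)).
Local Notation c := ((N%:R - 2) / 2 : R).
Local Notation p := (@sobolev_exponent R N).
Implicit Types (f u v w : V -> R) (x : V) (T : (V -> R) -> Prop).

(* A suitable multiple of the Jacobi polynomial agrees with q at -1, so that the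
   difference is divisible by 1 + X. *)
Lemma eigenfun_span T h f m (q : {poly R}) : (size q <= m.+1)%N ->
  (forall u v, T u -> T v -> T (fun x => u x + v x)) ->
  (forall n k, (h <= n)%N -> T (fun x => k * eigenfun n h f x)) ->
  T (fun x => powpoly ((m + h)%:R + c) q (sq x) * f x).
Proof.
move=> qm TD TE; elim: m q qm => [|m IH] q qm; set b : R := (_ + h)%:R + c.
  have [a ->] : exists a, q = a%:P.
    by exists q`_0; exact: size1_polyC.
  rewrite (_ : (fun _ => _) = fun x => a * eigenfun (0 + h) h f x).
    by apply: TE; exact: leq_addl.
  apply/funext => x; rewrite /eigenfun addnK -/b /powpoly hornerC.
  rewrite /jac poly_def big_ord1 /= gbinom0 hornerZ hornerXn; ring.
pose J := jac m.+1 b.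
have J1 : 0 < J.[-1].
  apply: jac_atN1_gt0; rewrite /b natrD.
  have : 2 < N%:R :> R by rewrite ltr_nat.
  have := ler0n R h; lra.
pose k := q.[-1] / J.[-1].
have /factor_theorem[q' q'E] : root (q - k *: J) (-1).
  by rewrite /root hornerD hornerN hornerZ divfK ?subrr// gt_eqF.
have qE : q = k *: J + q' * (1 + 'X).
  by rewrite [1 + _]addrC -[1]opprK -polyCN -q'E addrC subrK.
have sq' : (size q' <= m.+1)%N.
  have [->|q0] := eqVneq q' 0; first by rewrite size_poly0.
  have : (size (q' * ('X - (-1)%:P))%R <= m.+2)%N.
    rewrite -q'E (leq_trans (size_polyD _ _))// geq_max qm size_polyN.
    by rewrite (leq_trans (size_scale_leq _ _))// size_jac.
  by rewrite size_Mmonic ?monicXsubC// size_XsubC addn2.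
rewrite (_ : (fun _ => _) = fun x => k * eigenfun (m.+1 + h) h f x
    + powpoly ((m + h)%:R + c) q' (sq x) * f x); first by apply: TD; [apply: TE; exact: leq_addl|exact: IH].
apply/funext => x; rewrite /eigenfun addnK -/b -/J /powpoly {1}qE.
have s1 : 0 < 1 + sq x by rewrite ltr_pwDl.
rewrite hornerD hornerZ hornerM hornerD hornerC hornerX.
have -> : (1 + sq x) `^ (- ((m + h)%:R + c)) = (1 + sq x) `^ (- b) * (1 + sq x).
  rewrite -[X in _ = _ * X]powRr1 ?(ltW s1)// -powRD; last by apply/implyP => _; rewrite gt_eqF.
  by congr (_ `^ _); rewrite /b addSn -natr1; ring.
ring.
Qed.

(* Polynomial functions on the sphere, in stereographic coordinates. *)
Inductive stereo : (V -> R) -> Prop :=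
| stereo_cst k : stereo (cst k)
| stereo_inv : stereo (fun x => (1 + sq x)^-1)
| stereo_X i : stereo (fun x => x 0 i / (1 + sq x))
| stereo_D u v : stereo u -> stereo v -> stereo (fun x => u x + v x)
| stereo_M u v : stereo u -> stereo v -> stereo (fun x => u x * v x).

Lemma stereo_exp u m : stereo u -> stereo (fun x => u x ^+ m).
Proof.
move=> su; elim: m => [|m IH]; first exact: (stereo_cst 1).
rewrite (_ : (fun _ => _) = fun x => u x * u x ^+ m); first exact: stereo_M.
by apply/funext => x; rewrite exprS.
Qed.

Lemma stereo_prod n (F : 'I_n -> V -> R) : (forall i, stereo (F i)) ->
  stereo (fun x => \prod_i F i x).
Proof.
elim: n F => [|n IH] F sF.
  rewrite (_ : (fun _ => _) = cst 1); first exact: stereo_cst.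
  by apply/funext => x; rewrite big_ord0.
rewrite (_ : (fun _ => _) = fun x => F ord0 x * \prod_i F (lift ord0 i) x).
  by apply: stereo_M => //; apply: IH => i; exact: sF.
by apply/funext => x; rewrite big_ord_recl.
Qed.

Lemma stereo_soft_step k u : stereo u -> stereo (fun x => soft_step k (u x)).
Proof.
move=> su; apply: stereo_exp.
rewrite (_ : (fun _ => _) = fun x => cst 1 x + cst (-1) x * u x ^+ k).
  apply: stereo_D; first exact: stereo_cst.
  by apply: stereo_M; [exact: stereo_cst|exact: stereo_exp].
by apply/funext => x; rewrite mulN1r.
Qed.

(** Every product of the generators is (1 + s)^(-m) times a form of degree d <= m. In the product
    case the two induction hypotheses are nested, each with T suitably translated. *)
Lemma stereo_ind_homog u : stereo u -> forall T,
  (forall u v, T u -> T v -> T (fun x => u x + v x)) ->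
  (forall m d f, (d <= m)%N -> homog N d f -> T (fun x => (1 + sq x) ^- m * f x)) ->
  T u.
Proof.
elim=> [l||i|{}u v _ IHu _ IHv|{}u v _ IHu _ IHv] T TD TH.
- rewrite (_ : cst l = fun x => (1 + sq x) ^- 0 * cst l x).
    by apply: (TH 0 0) => //; exact: homog_cst.
  by apply/funext => x; rewrite expr0 invr1 mul1r.
- rewrite (_ : (fun _ => _) = fun x => (1 + sq x) ^- 1 * cst 1 x).
    by apply: (TH 1 0) => //; exact: homog_cst.
  by apply/funext => x; rewrite mulr1.
- rewrite (_ : (fun _ => _) = fun x => (1 + sq x) ^- 1 * (x 0 i * cst 1 x)).
    by apply: (TH 1 1) => //; apply: homog_X => //; exact: homog_cst.
  by apply/funext => x; rewrite mulr1 mulrC.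
- exact: (TD _ _ (IHu T TD TH) (IHv T TD TH)).
- apply: (IHu (fun u => T (fun x => u x * v x))) => [f g Tf Tg|m d f dm hf].
    by under eq_fun do rewrite mulrDl; exact: TD.
  apply: (IHv (fun v => T (fun x => (1 + sq x) ^- m * f x * v x))) => [a b Ta Tb|m' d' f' dm' hf'].
    by under eq_fun do rewrite mulrDr; exact: TD.
  rewrite (_ : (fun _ => _) = fun x => (1 + sq x) ^- (m + m') * (f x * f' x)).
    by apply: (TH _ (d + d')); [exact: leq_add|exact: homogM].
  by apply/funext => x; rewrite exprD invfM; ring.
Qed.

(** T will be orthogonality to a fixed w. The factor [kern 0 c] is what the eigenfunctions carry
    beyond a polynomial on the sphere. *)
Lemma stereo_eigenfun_ind u T : stereo u ->
  (forall u v, T u -> T v -> T (fun x => u x + v x)) ->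
  (forall n h k f, (h <= n)%N -> harmonic h f -> T (fun x => k * eigenfun n h f x)) ->
  T (fun x => u x * kern 0 c x).
Proof.
move=> su TD TE; have N0 : (0 < N)%N by exact: leq_trans N3.
apply: (stereo_ind_homog su (T := fun u => T (fun x => u x * kern 0 c x))) => [f g Tf Tg|m d f dm hf].
  rewrite (_ : (fun _ => _) = fun x => f x * kern 0 c x + g x * kern 0 c x); first exact: TD.
  by apply/funext => x; rewrite mulrDl.
apply: (harmonic_decomposition N0 hf (T := fun f => T (fun x => (1 + sq x) ^- m * f x * kern 0 c x))) => [a b Ta Tb|j h H hH jh].
  rewrite (_ : (fun _ => _) = fun x => (1 + sq x) ^- m * a x * kern 0 c x + (1 + sq x) ^- m * b x * kern 0 c x); first exact: TD.
  by apply/funext => x; ring.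
have hm : (h <= m)%N by lia.
(* The degree j is at most the m - h allowed by [eigenfun_span], as 2 j + h = d <= m. *)
rewrite (_ : (fun _ => _) = fun x => powpoly ((m - h + h)%:R + c) 'X^j (sq x) * H x).
  apply: eigenfun_span => //; first by rewrite size_polyXn ltnS; lia.
  by move=> n k hn; exact: TE.
apply/funext => x; have s1 : 0 < 1 + sq x by rewrite ltr_pwDl.
rewrite subnK// /powpoly hornerXn /kern oppr0 powRr0 mul1r.
rewrite [- (m%:R + _)]opprD powRD; last by apply/implyP => _; rewrite gt_eqF.
by rewrite (powRN _ m%:R) powR_mulrn ?(ltW s1)//; ring.
Qed.

Lemma cvg_prod_ord n (F : 'I_n -> nat -> R) (l : 'I_n -> R) :
  (forall i, F i k @[k --> \oo] --> l i) ->
  \prod_i F i k @[k --> \oo] --> \prod_i l i.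
Proof.
elim: n F l => [|n IH] F l H.
  by under eq_fun do rewrite big_ord0; rewrite big_ord0; exact: cvg_cst.
under eq_fun do rewrite big_ord_recr; rewrite big_ord_recr.
by apply: cvgM => //; apply: IH.
Qed.

(** Affine in the stereographic coordinates and below 1/2 exactly when x_i < a_i. The denominator
    keeps it in [0, 1], where [soft_step] converges, since |x_i - a_i| <= (1 + |a_i|) (1 + s). *)
Let gauge (a : V) i x : R :=
  2^-1 + (x 0 i - a 0 i) / (2 * (1 + `|a 0 i|) * (1 + sq x)).

Let gauge_itv a i x : 0 <= gauge a i x <= 1.
Proof.
have s1 : 0 < 1 + sq x by rewrite ltr_pwDl.
have A1 : 0 < 1 + `|a 0 i| by rewrite ltr_pwDl.
have D0 : 0 < (1 + `|a 0 i|) * (1 + sq x) by rewrite mulr_gt0.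
have : `|(x 0 i - a 0 i) / ((1 + `|a 0 i|) * (1 + sq x))| <= 1.
  rewrite normrM normfV (gtr0_norm D0) ler_pdivrMr// mul1r.
  apply: (le_trans (ler_normB _ _)).
  have x1 : `|x 0 i| <= 1 + sq x.
    apply: le_trans (coord_le_enorm x i) _.
    rewrite -enorm_sqr; have := enorm_ge0 x; have := sqr_ge0 (enorm x - 1); nra.
  have := normr_ge0 (a 0 i); have := sq_ge0 x; nra.
have -> : gauge a i x = 2^-1 + 2^-1 * ((x 0 i - a 0 i) / ((1 + `|a 0 i|) * (1 + sq x))).
  by rewrite /gauge -[2 * _ * _]mulrA invfM; congr (_ + _); exact: mulrCA.
rewrite ler_norml; move: ((x 0 i - a 0 i) / _) => z; lra.
Qed.

Let gauge_lt a i x : (gauge a i x < 2^-1) = (x 0 i < a 0 i).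
Proof.
have s1 : 0 < 1 + sq x by rewrite ltr_pwDl.
have A1 : 0 < 1 + `|a 0 i| by rewrite ltr_pwDl.
by rewrite /gauge gtrDl pmulr_llt0 ?subr_lt0// invr_gt0 !mulr_gt0.
Qed.

Let stereo_gauge a i : stereo (gauge a i).
Proof.
set k := 2 * (1 + `|a 0 i|).
have k0 : k != 0 by rewrite gt_eqF// mulr_gt0// ltr_pwDl.
rewrite (_ : gauge a i = fun x => cst 2^-1 x + (cst k^-1 x * (x 0 i / (1 + sq x)) + cst (- a 0 i / k) x * (1 + sq x)^-1)).
  apply: stereo_D; first exact: stereo_cst.
  by apply: stereo_D; apply: stereo_M; [exact: stereo_cst|exact: stereo_X|exact: stereo_cst|exact: stereo_inv].
apply/funext => x; rewrite /gauge -/k /cst; congr (_ + _).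
have : 1 + sq x != 0 by rewrite gt_eqF// ltr_pwDl.
by move=> s0; field; rewrite s0.
Qed.

Let soft_orthant a k x : R := \prod_i soft_step k (gauge a i x).

Let stereo_soft_orthant a k : stereo (soft_orthant a k).
Proof.
by apply: stereo_prod => i; apply: stereo_soft_step; exact: stereo_gauge.
Qed.

Let soft_orthant_itv a k x : 0 <= soft_orthant a k x <= 1.
Proof.
have H i := soft_step_itv k (gauge_itv a i x).
apply/andP; split; first by apply: prodr_ge0 => i _; case/andP: (H i).
by apply: prodr_ile1 => i _; exact: H.
Qed.

Let soft_orthant_cvg a x :
  soft_orthant a k x @[k --> \oo] --> (\1_(orthant a) x : R).
Proof.
have -> : \1_(orthant a) x = \prod_i ((gauge a i x < 2^-1)%R%:R : R).
  rewrite indicE; case: (boolP [forall i, x 0 i < a 0 i]) => [/forallP H|].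
    by rewrite mem_set// big1// => i _; rewrite gauge_lt H.
  rewrite negb_forall => /existsP[i /negbTE xi].
  rewrite memNset; first by rewrite (bigD1 i)//= gauge_lt xi mul0r.
  by move=> /(_ i); rewrite xi.
by apply: cvg_prod_ord => i; exact: soft_step_cvg.
Qed.

Lemma stereo_complete f : itg f ->
  (forall u, stereo u -> itg (fun x => f x * u x) /\ \int[mu]_x (f x * u x) = 0) ->
  f = cst 0 %[ae mu].
Proof.
move=> fi fu; apply: orthant_integral_eq0; first exact: fi.
  have [_ <-] := fu _ (stereo_cst 1); apply: eq_Rintegral => x _.
  by rewrite mulr1.
move=> a.
have cv : \int[mu]_x (f x * soft_orthant a k x) @[k --> \oo] --> \int[mu]_x (f x * \1_(orthant a) x).
  apply: (@Rdominated_cvg _ _ _ _ (fun x => `|f x|)).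
  - exact: leq_trans N3.
  - by move=> k; apply: itg_measurable; case: (fu _ (stereo_soft_orthant a k)).
  - apply: measurable_funM; first exact: itg_measurable.
    by apply: measurable_indic; exact: measurable_orthant.
  - by have := integrable_norm fi.
  - move=> k x; have /andP[h0 h1] := soft_orthant_itv a k x.
    by rewrite normrM (ger0_norm h0) ler_piMr.
  - by move=> x _; apply: cvgM; [exact: cvg_cst|exact: soft_orthant_cvg].
apply: (cvg_eq_limit cv (cvg_cst (0 : R))) => k.
by case: (fu _ (stereo_soft_orthant a k)).
Qed.

Lemma kern0_gt0 b x : 0 < kern 0 b x.
Proof. by rewrite /kern oppr0 powRr0 mul1r powR_gt0// ltr_pwDl. Qed.

Lemma weight_gt0 x : 0 < weight x.
Proof.
by rewrite weight_kern mulr_gt0 ?kern0_gt0// mulr_gt0 ?ltr_wpDr// ltr0n (leq_trans _ N3).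
Qed.

Theorem eigenfun_complete w : w \in Lfun mu p%:E ->
  (forall n h f, (h <= n)%N -> harmonic h f ->
    \int[mu]_x (weight x * w x * eigenfun n h f x) = 0) ->
  w = cst 0 %[ae mu].
Proof.
move=> wp w0; have mw := Lfun_measurable wp.
(* Integrability is carried along with the vanishing because additivity of the integral requires
   it. *)
pose T v := itg (fun x => weight x * w x * v x) /\ \int[mu]_x (weight x * w x * v x) = 0.
have TD u v : T u -> T v -> T (fun x => u x + v x).
  move=> [iu u0] [iv v0]; rewrite /T.
  rewrite (_ : (fun x => _ * _ * (u x + v x)) = fun x => weight x * w x * u x + weight x * w x * v x); last first.
    by apply/funext => x; rewrite mulrDr.
  by split; [exact: itgD|rewrite RintegralD// u0 v0 addr0].
have TE n h k f : (h <= n)%N -> harmonic h f -> T (fun x => k * eigenfun n h f x).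
  move=> hn hf; have [df _] := harmonic_eigenfun N3 hn hf.
  have [_ [C C0 [HC _]]] := df.
  have ie := itg_weight_kern N3 wp (measurable_decaying df) HC.
  rewrite /T (_ : (fun x => _ * _ * (k * _)) = fun x => k * (weight x * w x * eigenfun n h f x)); last first.
    by apply/funext => x; rewrite mulrCA.
  by split; [exact: itgZ|rewrite RintegralZl// w0// mulr0].
(* This function is integrable, and w vanishes wherever it does, the other two factors being
   positive. *)
pose g x := weight x * w x * kern 0 c x.
have g0 : g = cst 0 %[ae mu].
  apply: stereo_complete => [|u su].
    apply: (itg_weight_kern (C := 1) N3 wp) => [|x]; first exact: measurable_kern.
    by rewrite mul1r ger0_norm ?kern_ge0.
  have [] := stereo_eigenfun_ind su TD TE.
  rewrite (_ : (fun _ => _) = fun x => g x * u x)//.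
  by apply/funext => x; rewrite /g; ring.
apply: filterS g0 => x /= H Ix; have /eqP := H Ix.
rewrite /g mulf_eq0 (gt_eqF (kern0_gt0 c x)) orbF mulf_eq0 (gt_eqF (weight_gt0 x)).
by move=> /eqP.
Qed.

End completeness.

(** * The dimension of the harmonic forms of each degree *)

Section harmonic_dimension.
Context {R : realType} {N : nat} (N3 : (3 <= N)%N).
Local Notation V := 'rV[R]_N.
Implicit Types (f : V -> R) (W : (V -> R) -> Prop).

Lemma has_dim_eq W W' m : (forall f, W f <-> W' f) -> has_dim W m -> has_dim W' m.
Proof.
move=> WW [b [Wb ib sb]]; exists b; split=> // [j|f /WW]; last exact: sb.
exact/WW.
Qed.

Lemma harmonic_low h f : (h < 2)%N -> homog N h f <-> harmonic h f.
Proof.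
move=> h2; split=> [hf|[]//]; split=> //; exact: laplace_low hf.
Qed.

Lemma bin_factR (a b : nat) : 'C(a + b, b)%:R = (a + b)`!%:R / (a`!%:R * b`!%:R) :> R.
Proof.
have /(congr1 (fun k : nat => k%:R : R)) := bin_fact (leq_addl a b).
rewrite addnK !natrM [b`!%:R * _]mulrC => <-; rewrite mulfK// mulf_neq0// pnatr_eq0 -lt0n fact_gt0//.
Qed.

Lemma harmonic_dimension h : exists2 d, has_dim (@harmonic R N h) d &
  d%:R = (N%:R + 2 * h%:R - 2) * ((N + h - 3)`!)%:R / (((N - 2)`!)%:R * (h`!)%:R) :> R.
Proof.
have [M NE] : exists M, N = M.+3 by exists (N - 3)%N; lia.
have N0 : (0 < N)%N by exact: leq_trans N3.
have H d : has_dim (@homog R N N d) 'C(M.+2 + d, d).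
  have := @has_dim_homog R N N d (leqnn N); congr has_dim.
  by rewrite NE.
have f0 k : k`!%:R != 0 :> R by rewrite pnatr_eq0 -lt0n fact_gt0.
have M0 := ler0n R M.
(* The Laplacian lowers the degree by 2, so below degree 2 every form is harmonic and no subtraction
   occurs. *)
case: h => [|[|h]].
- exists 1%N; first by apply: (has_dim_eq (fun f => harmonic_low f (isT : (0 < 2)%N))); have := H 0; rewrite bin0.
  rewrite NE addn0 (_ : (M.+3 - 3 = M)%N); last by lia.
  rewrite (_ : (M.+3 - 2 = M.+1)%N); last by lia.
  rewrite factS natrM fact0 -!natr1; have := f0 M; move: (M`!%:R) => F F0.
  by field; rewrite F0 natr1 pnatr_eq0.
- exists M.+3; first by apply: (has_dim_eq (fun f => harmonic_low f (isT : (1 < 2)%N))); have := H 1; rewrite bin1 addn1.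
  rewrite NE (_ : (M.+3 + 1 - 3 = M.+1)%N); last by lia.
  rewrite (_ : (M.+3 - 2 = M.+1)%N); last by lia.
  rewrite [1`!]/= -!natr1; have := f0 M.+1; move: (M.+1`!%:R) => F F0.
  by field; rewrite F0.
have [le hd] := has_dim_harmonic N0 (H h.+2) (H h).
exists ('C(M.+2 + h.+2, h.+2) - 'C(M.+2 + h, h))%N => //.
rewrite natrB// !bin_factR NE (_ : (M.+3 + h.+2 - 3 = M.+2 + h)%N); last by lia.
rewrite (_ : (M.+3 - 2 = M.+1)%N); last by lia.
have E1 : (M.+2 + h.+2)`!%:R = (M%:R + h%:R + 4) * ((M%:R + h%:R + 3) * (M.+2 + h)`!%:R) :> R.
  by rewrite !addnS 2!factS !natrM -!natr1 natrD -?natr1; ring.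
have E2 : M.+2`!%:R = (M%:R + 2) * M.+1`!%:R :> R.
  by rewrite factS natrM -!natr1; ring.
have E3 : h.+2`!%:R = (h%:R + 2) * ((h%:R + 1) * h`!%:R) :> R.
  by rewrite 2!factS !natrM -!natr1; ring.
rewrite E1 E2 E3 -!natr1; have h0 := ler0n R h.
have := f0 M.+1; have := f0 h; move: ((M.+2 + h)`!%:R) (h`!%:R) (M.+1`!%:R) => A B C B0 C0.
field; rewrite B0 C0 !gt_eqF//; lra.
Qed.

End harmonic_dimension.

(** * Independence of the eigenfunctions *)

Section linear_independence.
Context {R : realType} {N : nat} (N3 : (3 <= N)%N).
Local Notation V := 'rV[R]_N.
Local Notation mu := (lebesgue_rV R N).
Implicit Types (f : V -> R) (x : V).

(** Around a point where f is nonzero there is a box of positive measure on which f does not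
    vanish. *)
Lemma continuous_ae_eq0 f : continuous f -> f = cst 0 %[ae mu] -> forall x, f x = 0.
Proof.
move=> cf [A [mA A0 fA]] x; apply: contrapT => fx0.
have /nbhs_ballP[e /= e0 eP] : nbhs x (f @^-1` [set t | t != 0]).
  by apply: cf; apply: open_nbhs_nbhs; split; [exact: open_neq|exact/eqP].
pose a : V := \row_i (x 0 i - e / 2); pose b : V := \row_i (x 0 i + e / 2).
have ab i : a 0 i <= b 0 i by rewrite !mxE; lra.
have BA : [set y : V | forall i, y 0 i \in `[a 0 i, b 0 i]] `<=` A.
  move=> y yab; apply: fA => /= /(_ I) fy.
  suff /eP : ball x e y by rewrite /= fy eqxx.
  rewrite -ball_normE /=; apply: (@le_lt_trans _ _ (e / 2)); last by lra.
  apply: rV_norm_le => [|i]; first by rewrite divr_ge0// ltW.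
  by have := yab i; rewrite !mxE in_itv /= ler_norml; lra.
have := lebesgue_rV_box ab; set B := [set y | _] in BA *.
have mB : measurable B.
  apply: (@measurable_forall_coord _ _ (fun i => [set` `[a 0 i, b 0 i]])) => i.
  exact: measurable_itv.
have -> : lebesgue_rV R N B = 0%E.
  apply/eqP; rewrite eq_le measure_ge0 andbT -A0.
  by apply: le_measure => //; rewrite inE.
move=> [] /esym/eqP; rewrite gt_eqF//; apply: prodr_gt0 => i _.
by rewrite !mxE; lra.
Qed.

Lemma continuous_eigenfun n h f : homog N h f -> continuous (eigenfun n h f).
Proof.
move=> hf x; apply: (@continuousM _ _ (fun x => powpoly _ _ (sq x)) f); last first.
  exact: (smooth_on_continuous (smooth_homog openT hf)).
apply: continuous_comp; first exact: continuous_sq.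
have := is_derive_powpoly (n%:R + (N%:R - 2) / 2) (jac (n - h) (n%:R + (N%:R - 2) / 2)) (sq_ge0 x).
move=> D; apply/differentiable_continuous/derivable1_diffP; exact: ex_derive.
Qed.

Lemma poly_horner_eq0 (p : {poly R}) : (forall t, p.[t] = 0) -> p = 0.
Proof.
move=> p0; apply/eqP; apply: contraT => pn0.
have := @max_poly_roots _ p [seq i%:R | i <- iota 0 (size p)] pn0.
rewrite size_map size_iota ltnn; apply.
  by apply/allP => t _; rewrite /root p0.
by rewrite map_inj_uniq ?iota_uniq// => i j /eqP; rewrite eqr_nat => /eqP.
Qed.

(* Along a ray, the lowest order term of the sum at the origin is that of the
   smallest index h. *)
Lemma eigenfun_independent n (H : 'I_n.+1 -> V -> R) :
  (forall h : 'I_n.+1, harmonic h (H h)) ->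
  (fun x => \sum_(h < n.+1) eigenfun n h (H h) x) = cst 0 %[ae mu] ->
  forall h x, H h x = 0.
Proof.
move=> hH /continuous_ae_eq0 E h x; set b : R := n%:R + (N%:R - 2) / 2.
have {}E y : \sum_(h < n.+1) eigenfun n h (H h) y = 0.
  apply: E => z; have : forall h : 'I_n.+1, Ck_on setT 0 (eigenfun n h (H h)).
    by move=> k; split=> // u _; exact: continuous_eigenfun (hH k).1 _.
  by move=> /(Ck_on_sum openT)[+ _]; exact.
pose q (k : 'I_n.+1) := jac (n - k) b \Po (sq x *: 'X^2).
pose P := \sum_k H k x *: (q k * 'X^k).
have P0 : P = 0.
  apply: poly_horner_eq0 => t; rewrite /P horner_sum.
  have s1 : 0 < (1 + sq (t *: x)) `^ (- b) by rewrite powR_gt0// ltr_pwDl.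
  apply: (mulfI (lt0r_neq0 s1)); rewrite mulr0 -[RHS](E (t *: x)) mulr_sumr.
  apply: eq_bigr => k _; rewrite /eigenfun /powpoly -/b.
  rewrite (homog_scale _ _ (hH k).1) hornerZ hornerM hornerXn horner_comp.
  by rewrite hornerZ hornerXn sqZ [sq x * _]mulrC; ring.
have q0 (k : 'I_n.+1) : 0 < (q k)`_0.
  rewrite -horner_coef0 horner_comp hornerZ hornerXn expr0n mulr0 jac_at0_gt0//.
  have : (n - k)%:R <= n%:R :> R by rewrite ler_nat leq_subr.
  have : 2 < N%:R :> R by rewrite ltr_nat.
  rewrite /b; lra.
have [k] := ubnP (val h); elim: k h => // k IH h hk.
have := congr1 (fun p : {poly R} => p`_h) P0; rewrite coef0 /P coef_sum (bigD1 h)//= big1 ?addr0.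
  rewrite coefZ coefMXn ltnn subnn => /eqP; rewrite mulf_eq0 (gt_eqF (q0 h)) orbF.
  by move/eqP.
move=> i ih; rewrite coefZ coefMXn; case: (ltnP h i) => hi; first by rewrite mulr0.
rewrite IH ?mul0r//.
apply: leq_trans (_ : (h <= k)%N); last by rewrite -ltnS.
by rewrite ltn_neqAle hi andbT.
Qed.

End linear_independence.

(** * Orthogonal projection for the weighted scalar product *)

Section projection.
Context {R : realType} {N : nat} (N3 : (3 <= N)%N).
Local Notation V := 'rV[R]_N.
Local Notation e i := (delta_mx 0 i : V).
Local Notation mu := (lebesgue_rV R N).
Local Notation itg f := (mu.-integrable setT (EFin \o f)).
Local Notation punctured := [set x : V | x != 0].
Local Notation p := (@sobolev_exponent R N).
Implicit Types (f g v w : V -> R) (x : V).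

Lemma decaying_sum m (c : 'I_m -> R) (v : 'I_m -> V -> R) :
  (forall j, decaying (v j)) -> decaying (fun x => \sum_j c j * v j x).
Proof.
move=> dv; have sv j : smooth_on punctured (v j) by case: (dv j).
have /choice[C HC] : forall j, exists C, 0 <= C /\
    (forall x, `|v j x| <= C * kern 0 ((N%:R - 2) / 2) x) /\
    forall i x, x != 0 -> `|partial i (v j) x| <= C * kern 1 ((N%:R - 2) / 2) x.
  by move=> j; have [_ [C C0 H]] := dv j; exists C.
split.
  move=> k; apply: Ck_on_sum => [|j]; first exact: open_neq0.
  by apply: Ck_onM; [exact: open_neq0|apply: Ck_on_cst; exact: open_neq0|exact: sv].
exists (\sum_j `|c j| * C j).
  by apply: sumr_ge0 => j _; rewrite mulr_ge0//; case: (HC j).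
split=> [x|i x x0].
  rewrite (le_trans (ler_norm_sum _ _ _))// mulr_suml ler_sum// => j _.
  by rewrite normrM -mulrA ler_wpM2l//; case: (HC j) => _ [].
rewrite (partialE (partial_sum c i sv x0)).
rewrite (le_trans (ler_norm_sum _ _ _))// mulr_suml ler_sum// => j _.
by rewrite normrM -mulrA ler_wpM2l//; case: (HC j) => _ [_]; apply.
Qed.

Lemma decaying_solution_sum lambda m (c : 'I_m -> R) (v : 'I_m -> V -> R) :
  (forall j, decaying_solution lambda (v j)) ->
  decaying_solution lambda (fun x => \sum_j c j * v j x).
Proof.
move=> dv; have sv j : smooth_on punctured (v j) by case: (dv j) => -[].
split; first by apply: decaying_sum => j; case: (dv j).
move=> x x0; transitivity (\sum_i \sum_j c j * partial i (partial i (v j)) x).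
  apply: eq_bigr => i _; apply: partialE.
  apply: (is_derive_eq_on open_neq0 x0 _ (partial_sum c i (fun j => smooth_on_partial i (sv j)) x0)).
  by move=> y y0; rewrite (partialE (partial_sum c i sv y0)).
rewrite exchange_big mulr_sumr -sumrN; apply: eq_bigr => j _.
by rewrite -mulr_sumr (dv j).2//; ring.
Qed.

Lemma itg_weight_decaying w v : w \in Lfun mu p%:E -> decaying v ->
  itg (fun x => weight x * w x * v x).
Proof.
move=> wp dv; have [_ [C _ [HC _]]] := dv.
exact: (itg_weight_kern N3 wp (measurable_decaying dv) HC).
Qed.

Lemma weight_integral_sum w m (c : 'I_m -> R) (v : 'I_m -> V -> R) :
  w \in Lfun mu p%:E -> (forall j, decaying (v j)) ->
  \int[mu]_x (weight x * w x * \sum_j c j * v j x) =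
  \sum_j c j * \int[mu]_x (weight x * w x * v j x).
Proof.
move=> wp dv; have iv j := itg_weight_decaying wp (dv j).
rewrite (_ : (fun _ => _) = fun x => \sum_j c j * (weight x * w x * v j x)).
  rewrite Rintegral_sum => [|j]; last exact: itgZ.
  by apply: eq_bigr => j _; rewrite RintegralZl.
by apply/funext => x; rewrite mulr_sumr; apply: eq_bigr => j _; rewrite mulrCA.
Qed.

Lemma Rintegral_eq0_ae f : itg f -> (forall x, 0 <= f x) -> \int[mu]_x f x = 0 ->
  f = cst 0 %[ae mu].
Proof.
move=> fi f0 if0.
have : (\int[mu]_x `|(f x)%:E| = 0)%E.
  rewrite (eq_integral (EFin \o f)) => [|x _]; last by rewrite /= ger0_norm.
  rewrite -[LHS]fineK; last exact: integrable_fin_num fi.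
  by rewrite -[fine _]/(\int[mu]_x f x) if0.
move=> /(ae_eq_integral_abs mu measurableT (measurable_int _ fi)) H.
by apply: filterS H => x /= /(_ I)[].
Qed.

(** The coefficients solve the normal equations. The Gram matrix is invertible because the weight is
    positive and the family is independent almost everywhere. *)
Lemma gram_projection w m (v : 'I_m -> V -> R) : w \in Lfun mu p%:E ->
  (forall j, decaying (v j)) ->
  (forall c : 'I_m -> R, (fun x => \sum_j c j * v j x) = cst 0 %[ae mu] ->
    forall j, c j = 0) ->
  exists c : 'I_m -> R, forall l,
    \int[mu]_x (weight x * (w x - \sum_j c j * v j x) * v l x) = 0.
Proof.
move=> wp dv iv; have vp j := decaying_Lfun N3 (dv j).
pose G : 'M[R]_m := \matrix_(j, l) \int[mu]_x (weight x * v j x * v l x).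
have dS (c : 'I_m -> R) := decaying_sum c dv.
have GE (c : 'rV[R]_m) l :
    \int[mu]_x (weight x * (\sum_j c 0 j * v j x) * v l x) = (c *m G) 0 l.
  rewrite mxE; transitivity (\sum_j c 0 j * \int[mu]_x (weight x * v l x * v j x)).
    rewrite -weight_integral_sum//; apply: eq_Rintegral => x _; exact: mulrAC.
  apply: eq_bigr => j _; rewrite mxE; congr (_ * _).
  apply: eq_Rintegral => x _; exact: mulrAC.
have uG : G \in unitmx.
  (* A vector r killed by the Gram matrix gives a combination f with zero integral of W f^2, hence f
     = 0 almost everywhere. *)
  rewrite -row_free_unit; apply: inj_row_free => r rG.
  pose f x := \sum_j r 0 j * v j x.
  have df : decaying f by exact: dS.
  have fp := decaying_Lfun N3 df.
  have : f = cst 0 %[ae mu].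
    have H : (fun x => weight x * f x * f x) = cst 0 %[ae mu].
      apply: Rintegral_eq0_ae.
      - exact: itg_weight_decaying.
      - move=> x; rewrite -mulrA -expr2; apply: mulr_ge0; last exact: sqr_ge0.
        exact/ltW/weight_gt0.
      - rewrite weight_integral_sum// big1// => l _.
        by rewrite GE rG mxE mulr0.
    apply: filterS H => x /= H Ix; have /eqP := H Ix.
    rewrite mulf_eq0 mulf_eq0 (gt_eqF (weight_gt0 N3 x)) orbb.
    by move=> /eqP.
  by move=> /(iv (fun j => r 0 j)) r0; apply/rowP => j; rewrite r0 mxE.
pose c := (\row_l \int[mu]_x (weight x * w x * v l x)) *m invmx G.
exists (fun j => c 0 j) => l; have fp := decaying_Lfun N3 (dS (fun j => c 0 j)).
have i1 := itg_weight_decaying wp (dv l).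
have i2 := itg_weight_decaying fp (dv l).
rewrite (_ : (fun _ => _) = fun x => weight x * w x * v l x
    - weight x * (\sum_j c 0 j * v j x) * v l x).
  by rewrite RintegralB// GE /c mulmxKV// mxE subrr.
by apply/funext => x; ring.
Qed.

End projection.

(** * Eigenspaces: bases, spanning and change of representative *)

Section eigenspaces.
Context {R : realType} {N : nat} (N3 : (3 <= N)%N).
Local Notation V := 'rV[R]_N.
Local Notation mu := (lebesgue_rV R N).
Local Notation p := (@sobolev_exponent R N).
Implicit Types (f g v w : V -> R) (x : V).

Definition eigenbasis n m (h : 'I_m -> 'I_n.+1) (f : 'I_m -> V -> R) :=
  [/\ forall j, harmonic (h j) (f j),
      forall c : 'I_m -> R,
        (fun x => \sum_j c j * eigenfun n (h j) (f j) x) = cst 0 %[ae mu] ->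
        forall j, c j = 0
    & forall (k : 'I_n.+1) g, harmonic k g -> exists c : 'I_m -> R,
        forall x, eigenfun n k g x = \sum_j c j * eigenfun n (h j) (f j) x].

Lemma eigenbasis_exists n : exists m (h : 'I_m -> 'I_n.+1) (f : 'I_m -> V -> R),
  eigenbasis h f /\
  m%:R = \sum_(h < n.+1) ((N%:R + 2 * h%:R - 2) * ((N + h - 3)`!)%:R
             / (((N - 2)`!)%:R * (h`!)%:R)) :> R.
Proof.
have /choice[D HD] : forall h : 'I_n.+1, exists D : {d : nat & 'I_d -> V -> R},
  [/\ forall j, harmonic h (tagged D j),
    forall c : 'I_(tag D) -> R, (forall x, \sum_j c j * tagged D j x = 0) -> forall j, c j = 0,
    forall f, harmonic h f -> exists c : 'I_(tag D) -> R, forall x, f x = \sum_j c j * tagged D j x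
    & (tag D)%:R = (N%:R + 2 * h%:R - 2) * ((N + h - 3)`!)%:R / (((N - 2)`!)%:R * (h`!)%:R) :> R].
  move=> h; have [d [b [hb ib sb]] dE] := @harmonic_dimension R N N3 h.
  by exists (Tagged (fun d : nat => 'I_d -> V -> R) b).
(* The index set is the disjoint union over h of the bases in each degree; its enumeration turns it
   into an ordinal. *)
pose U : finType := {h : 'I_n.+1 & 'I_(tag (D h))}.
pose B (u : U) : V -> R := tagged (D (tag u)) (tagged u).
pose mk h (j : 'I_(tag (D h))) : U := existT _ h j.
have sumU (F : U -> R) : \sum_u F u = \sum_h \sum_j F (mk h j).
  rewrite (sig_big_dep _ _ (fun h (j : 'I_(tag (D h))) => F (mk h j))).
  by apply: eq_bigr => -[].
have sumE (F : U -> R) : \sum_(j < #|U|) F (enum_val j) = \sum_u F u.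
  exact/esym/(big_enum_val (A := predT)).
have sumB (a : U -> R) x : \sum_u a u * eigenfun n (tag u) (B u) x =
    \sum_(h < n.+1) eigenfun n h (fun x => \sum_j a (mk h j) * B (mk h j) x) x.
  rewrite sumU; apply: eq_bigr => h _; rewrite /eigenfun mulr_sumr.
  by apply: eq_bigr => j _; rewrite mulrCA.
have hB (h : 'I_n.+1) j : harmonic h (B (mk h j)) by have [+ _ _ _] := HD h; exact.
exists #|U|, (fun j => tag (enum_val j)), (fun j => B (enum_val j)); split; last first.
  have -> : #|U|%:R = \sum_(u : U) 1 :> R by rewrite sumr_const.
  rewrite sumU; apply: eq_bigr => h _; rewrite sumr_const card_ord.
  by have [_ _ _ ->] := HD h.
split.
- by move=> j; case: (enum_val j) => h i; exact: hB.
- move=> c c0 j; pose a u := c (enum_rank u).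
  have ca i : c i = a (enum_val i) by rewrite /a enum_valK.
  (* [eigenfun_independent] kills the component in each degree h, which is a harmonic form, and the
     basis of that degree then kills its coefficients. *)
  have a0 h i : a (mk h i) = 0.
    have [_ ib _ _] := HD h; apply: (ib (fun i => a (mk h i))) => x.
    apply: (@eigenfun_independent R N N3 n (fun h x => \sum_j a (mk h j) * B (mk h j) x)).
      by move=> k; apply: harmonic_sum.
    apply: filterS c0 => y /= H Iy; rewrite -[RHS](H Iy) -sumB -sumE.
    by apply: eq_bigr => l _; rewrite ca.
  by rewrite ca; case: (enum_val j) => h i; exact: a0.
- move=> k g hg; have [_ _ + _] := HD k; move=> /(_ _ hg)[c cE].
  pose a (u : U) := untag 0 c u.
  exists (fun j => a (enum_val j)) => x.
  rewrite (sumE (fun u => a u * eigenfun n (tag u) (B u) x)) sumB (bigD1 k)//= big1 ?addr0.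
    rewrite /eigenfun cE; congr (_ * _); apply: eq_bigr => j _; congr (_ * _).
    by rewrite /a (untagE 0 c (erefl : tag (mk k j) = k)).
  move=> l lk; rewrite /eigenfun big1 ?mulr0// => j _.
  by rewrite /a untag_dflt ?mul0r.
Qed.

Lemma lambda_inj : injective (@lambda_ R N).
Proof.
move=> n n' E; have N2 : 2 < N%:R :> R by rewrite ltr_nat.
have NN : 0 < N%:R * (N%:R + 2) :> R by rewrite mulr_gt0//; lra.
have /(mulIf _) := E; rewrite invr_eq0 gt_eqF// => /(_ isT) {}E.
have n0 := ler0n R n; have n'0 := ler0n R n'.
apply/eqP; rewrite -(eqr_nat R); apply/eqP.
(* The difference of the numerators is 4 times this product, whose second factor is positive. *)
have : (n%:R - n'%:R) * (n%:R + n'%:R + N%:R - 1) = 0 :> R by lra.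
by move=> /eqP; rewrite mulf_eq0 => /orP[/eqP|/eqP]; lra.
Qed.

Lemma orthogonal_eigenfun lambda n h f w : weak_solution lambda w ->
  lambda != lambda_ N n -> (h <= n)%N -> harmonic h f ->
  \int[mu]_x (weight x * w x * eigenfun n h f x) = 0.
Proof.
move=> sw ln hn hf; have := weak_solution_orthogonal N3 (harmonic_eigenfun N3 hn hf) sw.
move=> /eqP; rewrite -subr_eq0 -mulrBl mulf_eq0 subr_eq0 (negPf ln) => /eqP.
exact.
Qed.

Lemma weak_solution_Lfun lambda w : weak_solution lambda w -> w \in Lfun mu p%:E.
Proof. by move=> [G []]. Qed.

Lemma LfunB f g : f \in Lfun mu p%:E -> g \in Lfun mu p%:E ->
  (fun x => f x - g x) \in Lfun mu p%:E.
Proof.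
move=> fp gp; have p1 : (1 <= p%:E)%E by rewrite lee_fin ltW// sobolev_exponent_gt1.
have [_ +] := Lfun_addr_closed mu p1; move=> /(_ f (- g) fp).
by apply; exact: Lfun_oppr_closed.
Qed.

Lemma weak_solution_span n m (h : 'I_m -> 'I_n.+1) (f : 'I_m -> V -> R) w :
  eigenbasis h f -> weak_solution (lambda_ N n) w ->
  exists c : 'I_m -> R, w = (fun x => \sum_j c j * eigenfun n (h j) (f j) x) %[ae mu].
Proof.
move=> [hf ind gen] sw; have wp := weak_solution_Lfun sw.
pose v j := eigenfun n (h j) (f j).
have dv j : decaying_solution (lambda_ N n) (v j).
  by apply: (harmonic_eigenfun N3 _ (hf j)); rewrite -ltnS.
have [c cE] := gram_projection N3 wp (fun j => (dv j).1) ind.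
pose s x := \sum_j c j * v j x.
have ds : decaying_solution (lambda_ N n) s by exact: decaying_solution_sum.
have sp := decaying_Lfun N3 ds.1; have ss := decaying_weak_solution N3 ds.
have rp := LfunB wp sp.
exists c; have : (fun x => w x - s x) = cst 0 %[ae mu].
  apply: (eigenfun_complete N3 rp) => n' k g kn' hg.
  (* For n' = n the remainder is orthogonal by construction; for n' != n both w and its projection
     are, as weak solutions with the eigenvalue of n. *)
  have [nn'|nn'] := eqVneq n' n.
    rewrite nn' in kn' *; have [a aE] := gen (Ordinal (kn' : (k < n.+1)%N)) g hg.
    transitivity (\int[mu]_x (weight x * (w x - s x) * \sum_j a j * v j x)).
      by apply: eq_Rintegral => x _; rewrite -aE.
    rewrite (weight_integral_sum N3 a rp (fun j => (dv j).1)) big1// => j _.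
    by rewrite cE mulr0.
  have ln : lambda_ N n != lambda_ N n' :> R by rewrite (inj_eq lambda_inj) eq_sym.
  have [dg _] := harmonic_eigenfun N3 kn' hg.
  have i1 := itg_weight_decaying N3 wp dg; have i2 := itg_weight_decaying N3 sp dg.
  rewrite (_ : (fun _ => _) = fun x => weight x * w x * eigenfun n' k g x
    - weight x * s x * eigenfun n' k g x); last by apply/funext => x; ring.
  by rewrite RintegralB// (orthogonal_eigenfun sw) // (orthogonal_eigenfun ss)// subrr.
by apply: filterS => x /= H Ix; apply/eqP; rewrite -subr_eq0; exact/eqP/H.
Qed.

(** Measurability of w is a hypothesis because it is not inherited through equality almost
    everywhere: the sigma-algebra is that of Borel sets. *)
Lemma weak_solution_ae lambda v w : measurable_fun setT w -> w = v %[ae mu] ->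
  weak_solution lambda v -> weak_solution lambda w.
Proof.
move=> mw wv [G [vp gv mG G2] vE].
have mv := Lfun_measurable vp.
have wvM g g' : measurable_fun setT g -> measurable_fun setT g' ->
    \int[mu]_x (g x * w x * g' x) = \int[mu]_x (g x * v x * g' x).
  move=> mg mg'; congr fine; apply: ae_eq_integral => //.
  - by apply/measurable_EFinP; apply: measurable_funM => //; exact: measurable_funM.
  - by apply/measurable_EFinP; apply: measurable_funM => //; exact: measurable_funM.
  - by apply: filterS wv => x /= H Ix; rewrite H.
exists G => [|phi tphi].
  split=> //.
    have p1 : 1 <= p by exact/ltW/sobolev_exponent_gt1.
    apply: itg_Lfun => //.
    have mX (u : V -> R) : measurable_fun setT u -> measurable_fun setT (EFin \o (fun x => `|u x| `^ p)).
      move=> mu'; apply/measurable_EFinP.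
      apply: (@measurableT_comp _ _ _ _ _ _ (fun t : R => t `^ p)) => //.
      exact: measurableT_comp.
    have /integrableP[_ fin] := Lfun_integrable p1 vp.
    apply/integrableP; split; first exact: mX.
    rewrite (ae_eq_integral (fun x => `|(`|v x| `^ p)%:E|)%E)//.
    - by apply: measurableT_comp => //; exact: mX.
    - by apply: measurableT_comp => //; exact: mX.
    - by apply: filterS wv => x /= H Ix; rewrite H.
  move=> phi' tphi' i; rewrite -gv//; have := wvM (cst 1) _ (measurable_cst _) (test_measurable (test_partial i tphi')).
  rewrite /cst; under eq_Rintegral do rewrite mul1r.
  by under [in RHS]eq_Rintegral do rewrite mul1r.
rewrite vE// wvM//; last exact: test_measurable.
exact: measurable_weight.
Qed.

End eigenspaces.

Theorem theorem1p1 (R : realType) (N : nat) (hN : (3 <= N)%N) :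
  [/\ forall lambda : R,
        @is_eigenvalue R N lambda <-> exists n : nat, lambda = lambda_ N n,
      forall n : nat, exists2 m : nat,
        @multiplicity R N (lambda_ N n) m &
        m%:R = \sum_(h < n.+1)
          ((N%:R + 2 * h%:R - 2) * ((N + h - 3)`!)%:R
             / (((N - 2)`!)%:R * (h`!)%:R)) :> R
    & forall (n : nat) (w : 'rV[R]_N -> R), measurable_fun setT w ->
        (weak_solution (lambda_ N n) w <->
         exists2 v, w_combination n v & w = v %[ae lebesgue_rV R N])].
Proof.
have eigen_sol n m (h : 'I_m -> 'I_n.+1) (f : 'I_m -> 'rV[R]_N -> R) j :
    (forall j, harmonic (h j) (f j)) ->
    decaying_solution (lambda_ N n) (eigenfun n (h j) (f j)).
  by move=> hf; apply: (harmonic_eigenfun hN _ (hf j)); rewrite -ltnS.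
split=> [lambda|n|n w mw].
- split=> [[w sw wn0]|[n ->]].
    (* If lambda is none of the lambda_n, then w is orthogonal to all eigenfunctions, hence zero. *)
    apply: contrapT => /forallNP ln; apply: wn0.
    apply: (eigenfun_complete hN (weak_solution_Lfun sw)) => n h f hn hf.
    by apply: (orthogonal_eigenfun hN sw _ hn hf); exact/eqP.
  (* The eigenfunction built on the constant 1 is nonzero: it is continuous, and its value at the
     origin is that of [jac] at 0, which is positive. *)
  have h1 : harmonic 0 (cst 1 : 'rV[R]_N -> R).
    by apply/harmonic_low => //; exact: homog_cst.
  exists (eigenfun n 0 (cst 1)).
    exact: (decaying_weak_solution hN (harmonic_eigenfun hN (leq0n n) h1)).
  move=> /(continuous_ae_eq0 (continuous_eigenfun h1.1)) /(_ 0)/eqP.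
  have N2 : 2 < N%:R :> R by rewrite ltr_nat.
  rewrite /eigenfun /powpoly (_ : sq 0 = 0); last by apply/eqP; rewrite sq_eq0.
  rewrite addr0 powR1 mul1r mulr1 subn0 gt_eqF// jac_at0_gt0//; lra.
- have [m [h [f [bhf mE]]]] := eigenbasis_exists (R := R) hN n.
  exists m => //; exists (fun j => eigenfun n (h j) (f j)).
  have [hf ind _] := bhf; split=> // [j|w sw].
    exact: (decaying_weak_solution hN (eigen_sol _ _ _ _ _ hf)).
  exact: (weak_solution_span hN bhf sw).
- split=> [sw|[v [k [c [h [Y [hY ->]]]]]] wv].
    have [m [h [f [bhf _]]]] := eigenbasis_exists (R := R) hN n.
    have [c wE] := weak_solution_span hN bhf sw; have [hf _ _] := bhf.
    exists (fun x => \sum_j c j * eigenfun n (h j) (f j) x) => //.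
    exists m, c, h, f; split=> [j|]; first exact: harmonic_spherical.
    apply/funext => x; apply: eq_bigr => j _.
    by rewrite w_E -1?ltnS// (solid_harmonic (hf j)).
  (* The [Y j] are arbitrary spherical harmonics here, so their solid extensions are used instead of
     harmonic forms. *)
  apply: (weak_solution_ae hN mw wv); apply: (decaying_weak_solution hN).
  apply: decaying_solution_sum => j; have hn : (h j <= n)%N by rewrite -ltnS.
  by rewrite w_E//; exact: (eigenfun_solution hN hn (hY j)).
Qed.
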